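(* Let $n,d\ge1$ be integers. The algebra $\mathrm{TL}_{d,n}$ is a $d$-framization of the Temperley–Lieb algebra $\mathrm{TL}_n$; that is, its presentation becomes the presentation of $\mathbb{C}[J_{d,n}]$ when all the parameters $x,y_1,\dots,y_{d-1}$ are specialized to $1$, and the algebra becomes $\mathrm{TL}_n(x)$ when $y_1,\dots,y_{d-1}$ are specialized to $1$ and all $z_i$ are sent to $1$. Its dimension over $\mathbb{K}=\mathbb{C}(x,y_1,\dots,y_{d-1})$ is $Cat_n\, d^n$, where $Cat_n=\frac1{n+1}\binom{2n}{n}$.
   Context: Let $x,y_1,\dots,y_{d-1}$ be indeterminates over $\mathbb{C}$, put $y_0=y_d=1$, and $\mathbb{K}=\mathbb{C}(x,y_1,\dots,y_{d-1})$. $\mathrm{TL}_{d,n}$ is the unital associative $\mathbb{K}$-algebra generated by $t_1,\dots,t_{n-1},z_1,\dots,z_n$ with relations (whenever the indices make sense): $t_it_j=t_jt_i$ if $|i-j|>1$; $t_it_jt_i=t_i$ if $|i-j|=1$; $z_i^d=1$; $z_iz_j=z_jz_i$; $t_iz_i=t_iz_{i+1}$; $z_it_i=z_{i+1}t_i$; $z_it_j=t_jz_i$ for $i\ne j,j+1$; $t_iz_i^kt_i=x\,y_k\,t_i$ for $k\in\mathbb{Z}/d\mathbb{Z}$ (in particular $t_i^2=x\,t_i$). Since the relations depend polynomially on the parameters, specializations of parameters are understood at the level of the algebra with this presentation over $\mathbb{C}[x^{\pm1},y_1^{\pm1},\dots,y_{d-1}^{\pm1}]$. $\mathrm{TL}_n=\mathrm{TL}_n(x)$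 is the algebra generated by $t_1,\dots,t_{n-1}$ with relations $t_i^2=x t_i$; $t_it_j=t_jt_i$ if $|i-j|>1$; $t_it_jt_i=t_i$ if $|i-j|=1$. At $x=1$ it is $\mathbb{C}[J_n]$, where $J_n$ is the Jones monoid, generated by $t_1,\dots,t_{n-1}$ with relations $t_i^2=t_i$, $t_it_j=t_jt_i$ if $|i-j|>1$, $t_it_jt_i=t_i$ if $|i-j|=1$. The framed Jones monoid $J_{d,n}$ is the monoid generated by $t_1,\dots,t_{n-1},z_1,\dots,z_n$ with relations: $t_i^2=t_i$; $t_it_j=t_jt_i$ if $|i-j|>1$; $t_it_jt_i=t_i$ if $|i-j|=1$; $z_i^d=1$; $z_iz_j=z_jz_i$; $t_iz_i=t_iz_{i+1}$; $z_it_i=z_{i+1}t_i$; $z_it_j=t_jz_i$ for $i\ne j,j+1$; $t_iz_i^kt_i=t_i$ for all $k$. Definition of $d$-framization. For an algebra $A$ with a fixed finite presentation $\langle X,R\rangle$ and a finite set of parameters $\mathsf{a}$, $\mathcal{F}_A$ denotes the class of $\mathbb{C}[\mathsf{a}^{\pm1}]$-algebras with a presentation $\langle X,R(\mathsf{a})\rangle$ whose relations depend polynomially on $\mathsf{a}$ and reduce to $R$ when all parameters are set equal to $1$. Given a monoid $M$ with framization $M_{d,n}$ and $\mathcal{A}(\mathsf{a})\in\mathcal{F}_{\mathbb{C}[M]}$, an algebra $f\mathcal{A}(\mathsf{a}')\in\mathcal{F}_{\mathbb{C}[M_{d,n}]}$ with $\mathsf{a}\subseteq\mathsf{a}'$ is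 a $d$-framization of $\mathcal{A}(\mathsf{a})$ if specializing $\mathsf{a}'$ to $\mathsf{a}$ (the extra parameters being sent to $1$) and sending every $z_i$ to $1$ turns $f\mathcal{A}(\mathsf{a}')$ into $\mathcal{A}(\mathsf{a})$. Here $M=J_n$, $M_{d,n}=J_{d,n}$, $\mathsf{a}=\{x\}$ and $\mathsf{a}'=\{x,y_1,\dots,y_{d-1}\}$. *)

(* Defs.v *)
From HB Require Import structures.
From mathcomp Require Import all_boot all_order all_algebra.
From mathcomp Require Import finmap boolp reals complex.
From mathcomp.multinomials Require monalg mpoly.

Set Implicit Arguments.
Unset Strict Implicit.
Unset Printing Implicit Defensive.

Import GRing.Theory Num.Theory.
Local Open Scope ring_scope.
Local Open Scope quotient_scope.

(* [monalg.v] only multiplies [{malg k[M]}] when 1 is the sole unit of [M],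
   which excludes both Laurent monomials and the framed Jones monoid, hence
   the convolution product below for an arbitrary [M : monoidType]. *)

Module MonoidRing.
Import monalg.
Local Open Scope fset_scope.

Definition monring (k : nzRingType) (M : monoidType) : Type := {malg k[M]}.

Section Lmod.
Context (k : nzRingType) (M : monoidType).
HB.instance Definition _ := GRing.Lmodule.copy (monring k M) {malg k[M]}.
End Lmod.

Section Ring.
Context (k : nzRingType) (M : monoidType).
Implicit Types (f g h : {malg k[M]}) (a b : M).

Definition mone : {malg k[M]} := << 1%g >>.

Definition mmul f g : {malg k[M]} :=
  \sum_(a <- msupp f) \sum_(b <- msupp g) << f@_a * g@_b *g (a * b)%g >>.

Lemma mmulw (d1 d2 : {fset M}) f g : msupp f `<=` d1 -> msupp g `<=` d2 ->
  mmul f g = \sum_(a <- d1) \sum_(b <- d2) << f@_a * g@_b *g (a * b)%g >>.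
Proof.
move=> le1 le2; rewrite /mmul (big_fset_incl _ le1) /=.
  apply/eq_bigr=> a _; apply/big_fset_incl => // b _ /mcoeff_outdom ->.
  by rewrite mulr0 monalgU0.
move=> a _ /mcoeff_outdom fa.
by rewrite big1 // => b _; rewrite fa mul0r monalgU0.
Qed.

Lemma mmulDl : left_distributive mmul +%R.
Proof.
move=> f g h; have s := fsubset_refl (msupp h).
rewrite (mmulw (msuppD_le f g) s) (mmulw (fsubsetUl _ (msupp g)) s).
rewrite (mmulw (fsubsetUr (msupp f) _) s) -big_split /=; apply/eq_bigr=> a _.
by rewrite -big_split /=; apply/eq_bigr=> b _; rewrite mcoeffD mulrDl monalgUD.
Qed.

Lemma mmulDr : right_distributive mmul +%R.
Proof.
move=> h f g; have s := fsubset_refl (msupp h).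
rewrite (mmulw s (msuppD_le f g)) (mmulw s (fsubsetUl _ (msupp g))).
rewrite (mmulw s (fsubsetUr (msupp f) _)) -big_split /=; apply/eq_bigr=> a _.
by rewrite -big_split /=; apply/eq_bigr=> b _; rewrite mcoeffD mulrDr monalgUD.
Qed.

Lemma mmul0r : left_zero 0 mmul.
Proof. by move=> f; rewrite /mmul msupp0 big_seq_fset0. Qed.

Lemma mmulr0 : right_zero 0 mmul.
Proof. by move=> f; rewrite /mmul big1 // => a _; rewrite msupp0 big_seq_fset0. Qed.

Lemma mmulUU x y a b :
  mmul << x *g a >> << y *g b >> = << x * y *g (a * b)%g >>.
Proof. by rewrite (mmulw msuppU_le msuppU_le) !big_seq_fset1 !mcoeffUU. Qed.

Lemma mmul_suml I (r : seq I) (F : I -> {malg k[M]}) g :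
  mmul (\sum_(i <- r) F i) g = \sum_(i <- r) mmul (F i) g.
Proof. exact: (big_morph (mmul^~ g) (fun _ _ => mmulDl _ _ _) (mmul0r _)). Qed.

Lemma mmul_sumr I (r : seq I) (F : I -> {malg k[M]}) f :
  mmul f (\sum_(i <- r) F i) = \sum_(i <- r) mmul f (F i).
Proof. exact: (big_morph (mmul f) (fun _ _ => mmulDr _ _ _) (mmulr0 _)). Qed.

Lemma mmulA : associative mmul.
Proof.
move=> f g h; rewrite (monalgE f) (monalgE g) (monalgE h).
rewrite !mmul_suml; apply/eq_bigr=> a _.
rewrite mmul_sumr [X in mmul X _]mmul_sumr mmul_suml; apply/eq_bigr=> b _.
rewrite !mmul_sumr; apply/eq_bigr=> c _.
by rewrite !mmulUU mulrA mulgA.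
Qed.

Lemma mmul1r : left_id mone mmul.
Proof.
move=> f; rewrite (monalgE f) mmul_sumr; apply/eq_bigr=> a _.
by rewrite mmulUU mul1r mul1g.
Qed.

Lemma mmulr1 : right_id mone mmul.
Proof.
move=> f; rewrite (monalgE f) mmul_suml; apply/eq_bigr=> a _.
by rewrite mmulUU mulr1 mulg1.
Qed.

Lemma mone_neq0 : mone != 0.
Proof. by rewrite monalgU_eq0 oner_eq0. Qed.

HB.instance Definition _ := GRing.Zmodule_isNzRing.Build (monring k M)
  mmulA mmul1r mmulr1 mmulDl mmulDr mone_neq0.

Lemma mscaleU x y a : x *: << y *g a >> = << x * y *g a >> :> {malg k[M]}.
Proof. by apply/malgP=> b; rewrite mcoeffZ !mcoeffU mulrnAr. Qed.

Lemma mscaleAl x (f g : monring k M) : x *: (f * g) = (x *: f) * g.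
Proof.
change (x *: mmul f g = mmul (x *: (f : {malg k[M]})) g).
rewrite (monalgE f) mmul_suml !scaler_sumr mmul_suml; apply/eq_bigr=> a _.
rewrite (monalgE g) !mmul_sumr scaler_sumr; apply/eq_bigr=> b _.
by rewrite !mscaleU !mmulUU mscaleU mulrA.
Qed.

HB.instance Definition _ := GRing.Lmodule_isLalgebra.Build k (monring k M)
  mscaleAl.

Definition mon (a : M) : monring k M := << a >>.

End Ring.

Lemma monring_mulC (k : comNzRingType) (M : monoidType) :
  (forall a b : M, (a * b = b * a)%g) -> @commutative (monring k M) _ *%R.
Proof.
move=> MC f g; change (mmul f g = mmul g f).
rewrite /mmul exchange_big; apply/eq_bigr=> a _; apply/eq_bigr=> b _.
by rewrite mulrC MC.
Qed.

Definition monpush (k : nzRingType) (M N : monoidType) (h : M -> N)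
    (u : monring k M) : monring k N :=
  \sum_(a <- msupp u) << u@_a *g h a >>.

Lemma monpush_mon (k : nzRingType) (M N : monoidType) (h : M -> N) (a : M) :
  monpush h (mon k a) = mon k (h a).
Proof. by rewrite /monpush msuppU oner_eq0 big_seq_fset1 mcoeffUU. Qed.

Definition augment (k : nzRingType) (M : monoidType) (u : monring k M) : k :=
  \sum_(a <- msupp u) u@_a.

Definition word (X : choiceType) := seq X.

Definition freealg (k : nzRingType) (X : choiceType) : lalgType k :=
  {malg k[{fmonom X}]}.

Definition fword (k : nzRingType) (X : choiceType) (w : word X) : freealg k X :=
  << FMonom w >>.

Definition fcoeff (k k' : nzRingType) (X : choiceType) (phi : k -> k')
    (u : freealg k X) : freealg k' X :=
  \sum_(w <- msupp u) << phi u@_w *g w >>.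

End MonoidRing.
Import MonoidRing mpoly.

Arguments mon {k M} a.
Arguments fword k {X} w.

(* The group Z^m, written multiplicatively: exponents of Laurent monomials. *)
Definition zpow (m : nat) : Type := {ffun 'I_m -> int}.
HB.instance Definition _ m := Choice.on (zpow m).

Section ZPow.
Context (m : nat).
Let mul (a b : zpow m) : zpow m := ((a : {ffun _}) + b)%R.
Let mulA : associative mul. Proof. exact: addrA. Qed.
Let mul1 : left_id (0 : {ffun 'I_m -> int}) mul. Proof. exact: add0r. Qed.
Let mulr1 : right_id (0 : {ffun 'I_m -> int}) mul. Proof. exact: addr0. Qed.
HB.instance Definition _ := isMonoid.Build (zpow m) mulA mul1 mulr1.

Lemma zpow_mulC (a b : zpow m) : (a * b = b * a)%g.
Proof. exact: (@addrC {ffun 'I_m -> int}). Qed.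
End ZPow.

Definition laurent (k : nzRingType) (m : nat) : Type := monring k (zpow m).

HB.instance Definition _ k m := GRing.NzRing.on (laurent k m).
HB.instance Definition _ k m := GRing.Lalgebra.on (laurent k m).

Lemma laurent_mulC (k : comNzRingType) m : @commutative (laurent k m) _ *%R.
Proof. exact/monring_mulC/zpow_mulC. Qed.

HB.instance Definition _ (k : comNzRingType) m :=
  GRing.PzRing_hasCommutativeMul.Build (laurent k m) (@laurent_mulC k m).

Definition laurent_var (k : nzRingType) m (i : 'I_m) : laurent k m :=
  mon ([ffun j => (i == j)%:Z] : zpow m).

Definition laurent_of_mpoly (k : comNzRingType) m (p : {mpoly k[m]}) :
    laurent k m :=
  mmap (in_alg (laurent k m)) (@laurent_var k m) p.

Definition laurent_at1 (k : nzRingType) m (u : laurent k m) : k := augment u.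

(* For an inclusion [iota] of m parameters among m', keep the former and set
   the others to 1: on monomials, restrict the exponent along [iota]. *)
Definition laurent_keep (k : nzRingType) m m' (iota : 'I_m -> 'I_m')
    (u : laurent k m') : laurent k m :=
  monpush (fun e : zpow m' => [ffun j => e (iota j)] : zpow m) u.

Inductive ideal_gen (A : pzRingType) (S : A -> Prop) : A -> Prop :=
| Ideal0 : ideal_gen S 0
| IdealM a s b : S s -> ideal_gen S (a * s * b)
| IdealB u v : ideal_gen S u -> ideal_gen S v -> ideal_gen S (u - v).

Lemma ideal_genMl (A : pzRingType) (S : A -> Prop) a u :
  ideal_gen S u -> ideal_gen S (a * u).
Proof.
elim=> [|b s c Ss|v w _ Sv _ Sw]; first by rewrite mulr0; apply: Ideal0.
  by rewrite !mulrA; apply: IdealM.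
by rewrite mulrBr; apply: IdealB.
Qed.

Lemma ideal_genMr (A : pzRingType) (S : A -> Prop) a u :
  ideal_gen S u -> ideal_gen S (u * a).
Proof.
elim=> [|b s c Ss|v w _ Sv _ Sw]; first by rewrite mul0r; apply: Ideal0.
  by rewrite -mulrA; apply: IdealM.
by rewrite mulrBl; apply: IdealB.
Qed.

Section QuotientAlgebra.
Context (k : nzRingType) (A : lalgType k) (S : A -> Prop).

Definition ideal_pred : {pred A} := fun u => `[< ideal_gen S u >].

Lemma ideal_predP u : reflect (ideal_gen S u) (u \in ideal_pred).
Proof. exact: asboolP. Qed.

Lemma ideal_zmod_closed : zmod_closed ideal_pred.
Proof.
split=> [|u v /ideal_predP Su /ideal_predP Sv]; apply/ideal_predP.
- exact: Ideal0.
- exact: IdealB.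
Qed.

HB.instance Definition _ := GRing.isZmodClosed.Build A ideal_pred
  ideal_zmod_closed.

Lemma ideal_mull a u : u \in ideal_pred -> a * u \in ideal_pred.
Proof. by move=> /ideal_predP Su; apply/ideal_predP/ideal_genMl. Qed.

Lemma ideal_mulr a u : u \in ideal_pred -> u * a \in ideal_pred.
Proof. by move=> /ideal_predP Su; apply/ideal_predP/ideal_genMr. Qed.

Lemma ideal_scale c u : u \in ideal_pred -> c *: u \in ideal_pred.
Proof. by rewrite -[u]mul1r scalerAl => Su; rewrite ideal_mull // -[u]mul1r. Qed.

Definition quotalg : Type := Quotient.quot ideal_pred.
HB.instance Definition _ := Choice.on quotalg.
HB.instance Definition _ := GRing.Zmodule.on quotalg.
HB.instance Definition _ := EqQuotient.on quotalg.
HB.instance Definition _ := ZmodQuotient.on quotalg.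

Let one : quotalg := lift_cst quotalg 1.
Let mul := lift_op2 quotalg *%R.
Let scale c := lift_op1 quotalg (fun u => c *: u).

Let piP (u v : A) : reflect (\pi_quotalg u = \pi_quotalg v) (u - v \in ideal_pred).
Proof. by rewrite Quotient.idealrBE; apply: eqP. Qed.

Let repr_pi u : u - repr (\pi_quotalg u) \in ideal_pred.
Proof. by apply/piP/esym; rewrite reprK. Qed.

Let pi_mul : {morph \pi_quotalg : u v / u * v >-> mul u v}.
Proof.
move=> u v; unlock mul; apply/piP.
rewrite -(subrKA (repr (\pi_quotalg u) * v)) -mulrBl -mulrBr.
by apply: rpredD; [apply: ideal_mulr | apply: ideal_mull].
Qed.

Let pi_scale c : {morph \pi_quotalg : u / c *: u >-> scale c u}.
Proof.
by move=> u; unlock scale; apply/piP; rewrite -scalerBr ideal_scale.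
Qed.

Let mulA : associative mul.
Proof.
by elim/quotW=> u; elim/quotW=> v; elim/quotW=> w; rewrite -!pi_mul mulrA.
Qed.
Let mul1 : left_id one mul.
Proof. by elim/quotW=> u; unlock one; rewrite -pi_mul mul1r. Qed.
Let mulr1 : right_id one mul.
Proof. by elim/quotW=> u; unlock one; rewrite -pi_mul mulr1. Qed.
Let mulDl : left_distributive mul +%R.
Proof.
elim/quotW=> u; elim/quotW=> v; elim/quotW=> w.
by rewrite -raddfD -!pi_mul -raddfD mulrDl.
Qed.
Let mulDr : right_distributive mul +%R.
Proof.
elim/quotW=> u; elim/quotW=> v; elim/quotW=> w.
by rewrite -raddfD -!pi_mul -raddfD mulrDr.
Qed.
HB.instance Definition _ := GRing.Zmodule_isPzRing.Build quotalg
  mulA mul1 mulr1 mulDl mulDr.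

Let scaleA a b u : scale a (scale b u) = scale (a * b) u.
Proof. by elim/quotW: u => u; rewrite -!pi_scale scalerA. Qed.
Let scale1 : left_id 1 scale.
Proof. by elim/quotW=> u; rewrite -pi_scale scale1r. Qed.
Let scaleDr : right_distributive scale +%R.
Proof.
move=> c; elim/quotW=> u; elim/quotW=> v.
by rewrite -raddfD -!pi_scale -raddfD scalerDr.
Qed.
Let scaleDl u : {morph scale^~ u : a b / a + b}.
Proof. by elim/quotW: u => u a b; rewrite -!pi_scale -raddfD scalerDl. Qed.
HB.instance Definition _ := GRing.Zmodule_isLmodule.Build k quotalg
  scaleA scale1 scaleDr scaleDl.

Definition quot_pi (u : A) : quotalg := \pi_quotalg u.

Lemma quot_pi_eq0 u : quot_pi u = 0 <-> ideal_gen S u.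
Proof.
have -> : 0 = quot_pi 0 by rewrite /quot_pi raddf0.
split=> [/piP|Su]; last by apply/piP; rewrite subr0; apply/ideal_predP.
by rewrite subr0 => /ideal_predP.
Qed.

Lemma quot_piD u v : quot_pi (u + v) = quot_pi u + quot_pi v.
Proof. exact: raddfD. Qed.
Lemma quot_piM u v : quot_pi (u * v) = quot_pi u * quot_pi v.
Proof. exact: pi_mul. Qed.
Lemma quot_pi1 : quot_pi 1 = 1.
Proof. by rewrite {2}/GRing.one /= /one; unlock. Qed.
Lemma quot_piZ c u : quot_pi (c *: u) = c *: quot_pi u.
Proof. exact: pi_scale. Qed.
Lemma quot_pi_surj (y : quotalg) : exists u, quot_pi u = y.
Proof. by exists (repr y); rewrite /quot_pi reprK. Qed.

End QuotientAlgebra.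

Definition arel (k : nzRingType) (X : choiceType) : Type :=
  (freealg k X * freealg k X)%type.

Definition palg (k : nzRingType) (X : finType) (R : seq (arel k X)) : Type :=
  quotalg (fun u : freealg k X => exists2 r, r \in R & u = r.1 - r.2).

HB.instance Definition _ k X R := GRing.PzRing.on (@palg k X R).
HB.instance Definition _ k X R := GRing.Lmodule.on (@palg k X R).

Definition pgen (k : nzRingType) (X : finType) (R : seq (arel k X)) (x : X) :
  palg R := quot_pi _ (fword k [:: x]).

Definition mrel (X : choiceType) : Type := (word X * word X)%type.

Inductive mcong (X : choiceType) (R : seq (mrel X)) : word X -> word X -> Prop :=
| McongRel u v a b : (a, b) \in R -> mcong R (u ++ a ++ v) (u ++ b ++ v)
| McongRefl u : mcong R u u
| McongSym u v : mcong R u v -> mcong R v u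
| McongTrans v u w : mcong R u v -> mcong R v w -> mcong R u w.

Section PresentedMonoid.
Context (X : finType) (R : seq (mrel X)).

Definition mcongb (u v : word X) : bool := `[< mcong R u v >].

Lemma mcongb_equiv : equiv_class_of mcongb.
Proof.
split=> [u|u v|v u w].
- exact/asboolP/McongRefl.
- by apply/asboolP/asboolP; apply: McongSym.
- by move=> /asboolP uv /asboolP vw; apply/asboolP/McongTrans/vw.
Qed.
Canonical mcongb_equiv_rel := EquivRelPack mcongb_equiv.
Canonical mcongb_encModRel := defaultEncModRel mcongb.

Definition pmonoid : Type := {eq_quot mcongb}.
HB.instance Definition _ := Choice.on pmonoid.
HB.instance Definition _ := EqQuotient.on pmonoid.

Definition pmon_word (w : word X) : pmonoid := \pi_pmonoid w.

Lemma pmon_wordP u v : pmon_word u = pmon_word v <-> mcong R u v.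
Proof.
split=> [/eqP|uv]; first by rewrite /pmon_word piE => /asboolP.
by apply/eqP; rewrite /pmon_word piE; apply/asboolP.
Qed.

Lemma mcong_cat u u' v v' :
  mcong R u u' -> mcong R v v' -> mcong R (u ++ v) (u' ++ v').
Proof.
move=> uu' vv'; apply: (@McongTrans _ _ (u' ++ v)).
  elim: uu' => [p q a b ab|w|w w' _ IH|w w' w'' _ IH _ IH'].
  - by rewrite -!catA; apply: McongRel.
  - exact: McongRefl.
  - exact: McongSym.
  - exact: McongTrans IH IH'.
elim: vv' => [p q a b ab|w|w w' _ IH|w w' w'' _ IH _ IH'].
- by rewrite !(catA u'); apply: McongRel.
- exact: McongRefl.
- exact: McongSym.
- exact: McongTrans IH IH'.
Qed.

Let one : pmonoid := pmon_word [::].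
Let mul (a b : pmonoid) : pmonoid := pmon_word (repr a ++ repr b).

Let mulE u v : mul (pmon_word u) (pmon_word v) = pmon_word (u ++ v).
Proof.
by apply/pmon_wordP/mcong_cat; apply/pmon_wordP; rewrite /pmon_word reprK.
Qed.

Let mulA : associative mul.
Proof.
elim/quotW=> u; elim/quotW=> v; elim/quotW=> w.
by rewrite -!/(pmon_word _) !mulE catA.
Qed.
Let mul1 : left_id one mul.
Proof. by elim/quotW=> u; rewrite -!/(pmon_word _) mulE. Qed.
Let mulr1 : right_id one mul.
Proof. by elim/quotW=> u; rewrite -!/(pmon_word _) mulE cats0. Qed.
HB.instance Definition _ := isMonoid.Build pmonoid mulA mul1 mulr1.

Lemma pmon_wordM u v : pmon_word (u ++ v) = (pmon_word u * pmon_word v)%g.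
Proof. by rewrite -mulE. Qed.

Definition mgen (x : X) : pmonoid := pmon_word [:: x].

End PresentedMonoid.

(* The presentation of the monoid algebra of <X | R>. *)
Definition linearize (k : nzRingType) (X : choiceType) (R : seq (mrel X)) :
    seq (arel k X) :=
  [seq (fword k r.1, fword k r.2) | r <- R].

Definition prel (k : nzRingType) (m : nat) (X : choiceType) : Type :=
  arel {mpoly k[m]} X.

Definition specialize (k k' : nzRingType) (X : choiceType) (phi : k -> k')
    (R : seq (arel k X)) : seq (arel k' X) :=
  [seq (fcoeff phi r.1, fcoeff phi r.2) | r <- R].

Definition rels_at1 (k : nzRingType) m (X : choiceType)
    (R : seq (prel k m X)) : seq (arel k X) :=
  specialize (meval (fun=> 1)) R.

Definition rels_laurent (k : comNzRingType) m (X : choiceType)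
    (R : seq (prel k m X)) : seq (arel (laurent k m) X) :=
  specialize (@laurent_of_mpoly k m) R.

Definition rels_frac (k : idomainType) m (X : choiceType)
    (R : seq (prel k m X)) : seq (arel {fraction {mpoly k[m]}} X) :=
  specialize (@FracField.tofrac {mpoly k[m]}) R.

(* Relations are compared as sets: the order and repetitions are irrelevant. *)
Definition deforms (k : nzRingType) m (X : choiceType)
    (R : seq (prel k m X)) (RM : seq (mrel X)) : Prop :=
  rels_at1 R =i linearize k RM.

(* The kernel of specializing scalars along [s] and killing [J]: the base
   change along a surjective [s] is the quotient by (ker s)A. *)
Definition spec_ideal (k k' : nzRingType) (s : k -> k') (X : finType)
    (R : seq (arel k X)) (J : palg R -> Prop) : palg R -> Prop :=
  ideal_gen (fun v : palg R => (exists2 c, s c = 0 & v = c *: (1 : palg R)) \/ J v).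

Section Framization.
Context (k : comNzRingType) (X : finType) (n m m' : nat).
Context (iota : 'I_m -> 'I_m').
(* The monoid M, its framization, with framing generators z_i = inr i, the
   algebra A in F_k[M] and its candidate framization. *)
Context (RM : seq (mrel X)) (RF : seq (mrel (X + 'I_n)%type)).
Context (RA : seq (prel k m X)) (RfA : seq (prel k m' (X + 'I_n)%type)).

Let A := palg (rels_laurent RA).
Let fA := palg (rels_laurent RfA).

Definition is_framization : Prop :=
  [/\ injective iota, deforms RA RM, deforms RfA RF &
    exists f : {rmorphism fA -> A},
      [/\ forall c u, f (c *: u) = laurent_keep iota c *: f u,
          forall x : X, f (pgen _ (inl x)) = pgen _ x,
          forall i : 'I_n, f (pgen _ (inr i)) = 1,
          forall v, exists u, f u = v &
          forall u, f u = 0 <->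
            spec_ideal (laurent_keep iota)
              (fun v => exists i : 'I_n, v = pgen _ (inr i) - 1) u]].

End Framization.

Definition specializes_to_monoid_algebra (k : comNzRingType) (X : finType)
    (m : nat) (R : seq (prel k m X)) (RM : seq (mrel X)) : Prop :=
  exists f : {rmorphism palg (rels_laurent R) -> monring k (pmonoid RM)},
    [/\ forall c u, f (c *: u) = laurent_at1 c *: f u,
        forall x : X, f (pgen _ x) = mon (mgen RM x),
        forall v, exists u, f u = v &
        forall u, f u = 0 <->
          spec_ideal (@laurent_at1 k m) (fun=> False) u].

(* Indices start at 0: [t_i] is indexed by 'I_n.-1 and [z_i] by 'I_n. *)

Definition lo_strand n (i : 'I_n.-1) : 'I_n := widen_ord (leq_pred n) i.
Lemma hi_strand_subproof n (i : 'I_n.-1) : (i.+1 < n)%N.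
Proof. by rewrite -ltn_predRL. Qed.
Definition hi_strand n (i : 'I_n.-1) : 'I_n := Ordinal (hi_strand_subproof i).

Section Presentations.
Context (n d : nat).

Definition framed_gen : finType := ('I_n.-1 + 'I_n)%type.
Definition gen_t (i : 'I_n.-1) : framed_gen := inl i.
Definition gen_z (i : 'I_n) : framed_gen := inr i.

(* The relations between the t_i other than the one for t_i^2. *)
Definition tl_rels (X : choiceType) (t : 'I_n.-1 -> X) : seq (mrel X) :=
  [seq ([:: t p.1; t p.2], [:: t p.2; t p.1])
     | p : 'I_n.-1 * 'I_n.-1 <- enum {: 'I_n.-1 * 'I_n.-1} & (1 < `|p.1 - p.2|)%N] ++
  [seq ([:: t p.1; t p.2; t p.1], [:: t p.1])
     | p : 'I_n.-1 * 'I_n.-1 <- enum {: 'I_n.-1 * 'I_n.-1} & `|p.1 - p.2|%N == 1%N].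

Definition square_rels (X : choiceType) (t : 'I_n.-1 -> X) : seq (mrel X) :=
  [seq ([:: t i; t i], [:: t i]) | i <- enum 'I_n.-1].

(* The relations involving the z_i other than those for t_i z_i^k t_i. *)
Definition framing_rels : seq (mrel framed_gen) :=
  [seq (nseq d (gen_z i), [::]) | i <- enum 'I_n] ++
  [seq ([:: gen_z p.1; gen_z p.2], [:: gen_z p.2; gen_z p.1])
     | p <- enum {: 'I_n * 'I_n}] ++
  [seq ([:: gen_t i; gen_z (lo_strand i)], [:: gen_t i; gen_z (hi_strand i)]) | i <- enum 'I_n.-1] ++
  [seq ([:: gen_z (lo_strand i); gen_t i], [:: gen_z (hi_strand i); gen_t i]) | i <- enum 'I_n.-1] ++
  [seq ([:: gen_z p.1; gen_t p.2], [:: gen_t p.2; gen_z p.1])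
     | p : 'I_n * 'I_n.-1 <- enum {: 'I_n * 'I_n.-1} & (p.1 != lo_strand p.2) && (p.1 != hi_strand p.2)].

Definition tzt (i : 'I_n.-1) (k : nat) : word framed_gen :=
  gen_t i :: rcons (nseq k (gen_z (lo_strand i))) (gen_t i).

Definition jones_rels : seq (mrel 'I_n.-1) := square_rels id ++ tl_rels id.

Definition framed_jones_rels : seq (mrel framed_gen) :=
  square_rels gen_t ++ tl_rels gen_t ++ framing_rels ++
  [seq (tzt p.1 p.2, [:: gen_t p.1]) | p : 'I_n.-1 * 'I_d <- enum {: 'I_n.-1 * 'I_d}].

Section Deformations.
Context (k : nzRingType).

(* The single parameter x is variable number 0. *)
Definition TL_rels : seq (prel k 1 'I_n.-1) :=
  [seq (fword _ [:: i; i], 'X_ord0 *: fword _ [:: i]) | i <- enum 'I_n.-1] ++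
  linearize _ (tl_rels id).

(* The parameters x, y_1, ..., y_{d-1} are the variables number 0, ..., d-1;
   [par_y 0] is y_0 = 1. *)
Definition npar : nat := d.-1.+1.
Definition par_x : {mpoly k[npar]} := 'X_ord0.
Definition par_y (j : 'I_d) : {mpoly k[npar]} :=
  if val j == 0%N then 1 else 'X_(inord j).

Definition framed_TL_rels : seq (prel k npar framed_gen) :=
  linearize _ (tl_rels gen_t) ++ linearize _ framing_rels ++
  [seq (fword _ (tzt p.1 p.2), (par_x * par_y p.2) *: fword _ [:: gen_t p.1])
     | p : 'I_n.-1 * 'I_d <- enum {: 'I_n.-1 * 'I_d}].

End Deformations.

End Presentations.

Definition framed_TL_frac (k : idomainType) (n d : nat) : Type :=
  palg (rels_frac (framed_TL_rels n d k)).

Definition Catalan (n : nat) : nat := 'C(n.*2, n) %/ n.+1.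

(* Main.v *)
(* Put T^m_k = t_{m-1} ... t_k. The products, over 0 <= m < n, of the T^m_{k_m} z_{k_m}^{a_m}
   with k_m <= m, in which the k_m < m increase strictly, span TL_{d,n}: right
   multiplication by a generator keeps the span, because T^{m'}_l T^m_k =
   T^{m'}_k T^m_{l+2} for k <= l < m' < m restores the order. They are counted by
   ballot numbers, Cat_n d^n in all. They are independent because the algebra acts
   on labelled perfect matchings of 2n points, where they send the identity matching
   to scalar-free and pairwise distinct matchings.

   The two specializations come from the universal property of the presentations;
   their kernels are the expected ideals because each specialization of scalars has a
   section that lifts to the algebras. *)

From HB Require Import structures.
Require Import Defs.
From mathcomp Require Import all_boot all_order all_algebra.
From mathcomp Require Import finmap boolp reals complex zify.
From mathcomp.multinomials Require monalg.
From mathcomp.multinomials Require Import mpoly.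

Set Implicit Arguments.
Unset Strict Implicit.
Unset Printing Implicit Defensive.

Import GRing.Theory Num.Theory MonoidRing.
Local Open Scope ring_scope.

(** * Presented algebras and their universal property *)

(** Both halves of the dimension argument handle one layer T^m_k z_k^a at a time. In the spanning
    half, a generator that meets the last layer is absorbed by it or leaves it, on the left, as an
    element on the strands below m, which the earlier layers absorb by induction. The one
    obstruction is a new k not above the last nontrivial l; the exchange relation turns it into l+2
    in the new layer, so m - k drops and the process stops. For independence a single row of the
    matrices suffices, that of the identity matching. Along it a normal form only joins bottom
    points not yet joined, so no loop closes and all scalars are 1. The last layer is visible in the
    resulting picture: k as the position of the last arc between neighbouring bottom points, a as
    its label; the gluings can then be undone. All matchings are allowed, planar or not, so that
    only local conditions must be preserved. No step divides, hence the basis exists over any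
    commutative ring of parameters. In the framization, y_0 = 1 is what makes TL_n map back: the
    loop relation for k = 0 is t_i^2 = x t_i. *)

(* Stated for an abstract algebra: on [freealg] and [palg] themselves, rewriting
   with the ring axioms makes unification unfold the quotients. *)
Lemma lalg_scaleAr (k : comNzRingType) (A : lalgType k) (W : Type) (e : W -> A) :
    (forall P : A -> Prop, P 0 -> (forall u v, P u -> P v -> P (u + v)) ->
       (forall c w, P (c *: e w)) -> forall u, P u) ->
    (forall c w1 w2, c *: (e w1 * e w2) = e w1 * (c *: e w2)) ->
  forall c (u v : A), c *: (u * v) = u * (c *: v).
Proof.
move=> ind eZ c u v; elim/ind: v => [|v1 v2 IH1 IH2|b w2].
- by rewrite scaler0 mulr0 scaler0.
- by rewrite mulrDr !scalerDr IH1 IH2 -mulrDr.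
elim/ind: u => [|u1 u2 IH1 IH2|a w1].
- by rewrite !mul0r scaler0.
- by rewrite mulrDl scalerDr IH1 IH2 -mulrDl.
by rewrite scalerA -!scalerAl -!eZ !scalerA mulrCA mulrA.
Qed.

(** By bilinearity it is enough to compare products of spanning elements. The target is a mere ring
    with central scalars [phi c], because the scalars are often changed along a specialization on
    the way. *)
Lemma lalg_evalM (k : comNzRingType) (A : lalgType k) (W : Type) (e : W -> A)
    (B : pzRingType) (phi : {rmorphism k -> B}) (ev : A -> B) :
    (forall P : A -> Prop, P 0 -> (forall u v, P u -> P v -> P (u + v)) ->
       (forall c w, P (c *: e w)) -> forall u, P u) ->
    (forall c (u v : A), c *: (u * v) = u * (c *: v)) ->
    (forall c u v, ev (c *: u + v) = phi c * ev u + ev v) ->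
    (forall c b, phi c * b = b * phi c) ->
    (forall w1 w2, ev (e w1 * e w2) = ev (e w1) * ev (e w2)) ->
  {morph ev : u v / u * v}.
Proof.
move=> ind AC evL phiC eM.
have evD u v : ev (u + v) = ev u + ev v.
  by rewrite -{1}[u]scale1r evL rmorph1 mul1r.
have ev0 : ev 0 = 0 by apply: (addrI (ev 0)); rewrite -evD !addr0.
have evZ c u : ev (c *: u) = phi c * ev u.
  by rewrite -[_ *: _]addr0 evL ev0 addr0.
move=> u v; elim/ind: v => [|v1 v2 IH1 IH2|b w2].
- by rewrite mulr0 ev0 mulr0.
- by rewrite mulrDr !evD mulrDr IH1 IH2.
elim/ind: u => [|u1 u2 IH1 IH2|a w1].
- by rewrite mul0r ev0 mul0r.
- by rewrite mulrDl !evD mulrDl IH1 IH2.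
by rewrite -AC !evZ -scalerAl evZ eM phiC -!mulrA -phiC.
Qed.

(** * Free algebras: evaluation and change of coefficients *)

Section FreeAlgebra.
Import monalg.
Local Notation "u @_ m" := (monalg.mcoeff m u) : ring_scope.
Context (k : comNzRingType) (X : choiceType).
Implicit Types (u v : freealg k X) (w : word X) (c : k).

Lemma scale_fword c w : c *: fword k w = << c *g FMonom w >>.
Proof. by apply/malgP=> m; rewrite [LHS]mcoeffZ !mcoeffU mulrnAr mulr1. Qed.

Lemma freealg_ind (P : freealg k X -> Prop) :
    P 0 -> (forall u v, P u -> P v -> P (u + v)) ->
    (forall c w, P (c *: fword k w)) -> forall u, P u.
Proof.
move=> P0 PD PZ u; rewrite (monalgE u); apply: big_ind => // m _.
by have := PZ u@_m (fmonom_val m); rewrite scale_fword fmK.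
Qed.

Lemma fwordM c1 c2 w1 w2 :
  (c1 *: fword k w1) * (c2 *: fword k w2) = (c1 * c2) *: fword k (w1 ++ w2).
Proof.
rewrite !scale_fword [LHS]malgM_def fgmulUU; congr (mkmalgU _ _).
by apply/val_inj; rewrite /= fmM.
Qed.

Lemma fword_cat w1 w2 : fword k (w1 ++ w2) = fword k w1 * fword k w2.
Proof. by have := fwordM 1 1 w1 w2; rewrite mulr1 !scale1r. Qed.

Lemma fword_nil : fword k [::] = 1 :> freealg k X.
Proof. by congr (mkmalgU _ _); apply/val_inj; rewrite /= fm1. Qed.

Lemma freealg_scaleAr c u v : c *: (u * v) = u * (c *: v).
Proof.
apply: (lalg_scaleAr freealg_ind) => {u v}c w1 w2.
by have := fwordM 1 c w1 w2; rewrite mul1r scale1r fword_cat.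
Qed.

End FreeAlgebra.

Section Eval.
Import monalg.
Local Notation "u @_ m" := (monalg.mcoeff m u) : ring_scope.
Context (k : comNzRingType) (X : choiceType).
Implicit Types (u v : freealg k X) (w : word X) (c : k).
Context (B : pzRingType) (phi : {rmorphism k -> B}) (h : X -> B).

Definition wordval w : B := \prod_(x <- w) h x.

Definition freeval u : B := \sum_(m <- msupp u) phi u@_m * wordval (fmonom_val m).

Lemma freevalEw (E : {fset {fmonom X}}) u : (msupp u `<=` E)%fset ->
  freeval u = \sum_(m <- E) phi u@_m * wordval (fmonom_val m).
Proof.
move=> le; rewrite [LHS](big_fset_incl _ le) => //= x xd /mcoeff_outdom ->.
by rewrite rmorph0 mul0r.
Qed.

Lemma freevalD u v : freeval (u + v) = freeval u + freeval v.
Proof.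
rewrite (freevalEw (msuppD_le u v)) (freevalEw (fsubsetUl (msupp u) (msupp v))).
rewrite (freevalEw (fsubsetUr (msupp u) (msupp v))) -big_split /=.
by apply: eq_bigr => m _; rewrite mcoeffD rmorphD mulrDl.
Qed.

Lemma freevalZ c u : freeval (c *: u) = phi c * freeval u.
Proof.
rewrite (freevalEw (msuppZ_le c u)) /freeval big_distrr /=.
by apply: eq_bigr => m _; rewrite mcoeffZ rmorphM mulrA.
Qed.

Lemma freeval_word w : freeval (fword k w) = wordval w.
Proof.
rewrite (freevalEw (msuppU_le (x := 1) (k := FMonom w))).
by rewrite big_seq_fset1 mcoeffUU rmorph1 mul1r.
Qed.

Lemma freeval0 : freeval 0 = 0.
Proof. by rewrite /freeval msupp0 big_seq_fset0. Qed.

Lemma freevalN u : freeval (- u) = - freeval u.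
Proof. by rewrite -scaleN1r freevalZ rmorphN1 mulN1r. Qed.

Lemma freevalM : (forall c b, phi c * b = b * phi c) ->
  {morph freeval : u v / u * v}.
Proof.
move=> phiC u v.
apply: (lalg_evalM (@freealg_ind _ _) (@freealg_scaleAr _ _) _ phiC) => {u v} [c u v|w1 w2].
  by rewrite freevalD freevalZ.
by rewrite -fword_cat !freeval_word /wordval big_cat.
Qed.

End Eval.

Section Coeff.
Import monalg.
Local Notation "u @_ m" := (monalg.mcoeff m u) : ring_scope.
Context (k : comNzRingType) (X : choiceType).
Implicit Types (u v : freealg k X) (w : word X) (c : k).
Context (k' : comNzRingType) (s : {rmorphism k -> k'}).

Lemma fcoeffEw (E : {fset {fmonom X}}) u : (msupp u `<=` E)%fset ->
  fcoeff s u = \sum_(m <- E) << s u@_m *g m >>.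
Proof.
move=> le; rewrite [LHS](big_fset_incl _ le) => //= x xd /mcoeff_outdom ->.
by rewrite rmorph0 monalgU0.
Qed.

Lemma fcoeffD u v : fcoeff s (u + v) = fcoeff s u + fcoeff s v.
Proof.
rewrite (fcoeffEw (msuppD_le u v)) (fcoeffEw (fsubsetUl (msupp u) (msupp v))).
rewrite (fcoeffEw (fsubsetUr (msupp u) (msupp v))) -big_split /=.
by apply: eq_bigr => m _; rewrite mcoeffD rmorphD monalgUD.
Qed.

Lemma fcoeff_scale_word c w : fcoeff s (c *: fword k w) = s c *: fword k' w.
Proof.
rewrite !scale_fword (fcoeffEw (msuppU_le (k := FMonom w))).
by rewrite big_seq_fset1 mcoeffUU.
Qed.

Lemma fcoeff_word w : fcoeff s (fword k w) = fword k' w.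
Proof. by rewrite -[fword k w]scale1r fcoeff_scale_word rmorph1 scale1r. Qed.

Lemma fcoeff0 : fcoeff s 0 = 0 :> freealg k' X.
Proof. by rewrite /fcoeff msupp0 big_seq_fset0. Qed.

End Coeff.

(** Both sides evaluate [u] along the same composite from [k0] to [B]. This carries a relation with
    polynomial coefficients from its Laurent form to its form at 1. *)
Lemma freeval_fcoeff (k0 k k' : comNzRingType) (X : choiceType)
    (s : {rmorphism k0 -> k}) (s' : {rmorphism k0 -> k'}) (B : pzRingType)
    (phi : {rmorphism k -> B}) (psi : {rmorphism k' -> B}) (h : X -> B) :
  (forall c, phi (s c) = psi (s' c)) ->
  forall u, freeval phi h (fcoeff s u) = freeval psi h (fcoeff s' u).
Proof.
move=> e u; elim/freealg_ind: u => [|u v IHu IHv|c w].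
- rewrite [fcoeff s 0]fcoeff0 [fcoeff s' 0]fcoeff0.
  by rewrite [LHS]freeval0 [RHS]freeval0.
- rewrite [fcoeff s _]fcoeffD [fcoeff s' _]fcoeffD.
  apply: (etrans (freevalD phi h (fcoeff s u) (fcoeff s v))).
  apply: (etrans _ (esym (freevalD psi h (fcoeff s' u) (fcoeff s' v)))).
  exact: (f_equal2 +%R IHu IHv).
- rewrite [fcoeff s _]fcoeff_scale_word [fcoeff s' _]fcoeff_scale_word.
  by rewrite [LHS]freevalZ [RHS]freevalZ freeval_word [in RHS]freeval_word e.
Qed.

Opaque freeval fcoeff fword.

(** * Quotients by relations *)

Section PresentedAlgebra.
Context (k : comNzRingType) (X : finType) (R : seq (arel k X)).
Implicit Types (u v : palg R).

Definition pquot (U : freealg k X) : palg R := quot_pi _ U.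

Lemma pquotD U V : pquot (U + V) = pquot U + pquot V.
Proof. exact: quot_piD. Qed.

Lemma pquotM U V : pquot (U * V) = pquot U * pquot V.
Proof. exact: quot_piM. Qed.

Lemma pquotZ c U : pquot (c *: U) = c *: pquot U.
Proof. exact: quot_piZ. Qed.

Lemma pquot0 : pquot 0 = 0.
Proof. by rewrite -[0](scale0r 0) pquotZ scale0r. Qed.

Lemma pquotB U V : pquot (U - V) = pquot U - pquot V.
Proof. by rewrite -scaleN1r pquotD pquotZ scaleN1r. Qed.

Lemma pquot1 : pquot 1 = 1.
Proof. exact: quot_pi1. Qed.

Lemma pquot_surj u : exists U, pquot U = u.
Proof. exact: quot_pi_surj. Qed.

Definition pword (w : word X) : palg R := pquot (fword k w).

Lemma palg_scaleAl c u v : c *: (u * v) = (c *: u) * v.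
Proof.
have [U <-] := pquot_surj u; have [V <-] := pquot_surj v.
by rewrite -pquotM -!pquotZ -pquotM scalerAl.
Qed.

Lemma palg_scaleAr c u v : c *: (u * v) = u * (c *: v).
Proof.
have [U <-] := pquot_surj u; have [V <-] := pquot_surj v.
by rewrite -pquotM -!pquotZ -pquotM freealg_scaleAr.
Qed.

(** The structure map of the algebra, as a ring morphism with central image: it plays the role of
    [phi] whenever a presented algebra is the target of the universal property. *)
Definition palg_const (c : k) : palg R := c *: (1 : palg R).

Lemma palg_const_zmod : zmod_morphism palg_const.
Proof. by move=> a b; rewrite /palg_const scalerBl. Qed.

Lemma palg_const_monoid : monoid_morphism palg_const.
Proof.
split=> [|a b]; first exact: scale1r.
by rewrite /palg_const -palg_scaleAl mul1r scalerA.
Qed.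

HB.instance Definition _ :=
  GRing.isZmodMorphism.Build k (palg R) palg_const palg_const_zmod.
HB.instance Definition _ :=
  GRing.isMonoidMorphism.Build k (palg R) palg_const palg_const_monoid.

Lemma palg_constM c u : palg_const c * u = c *: u.
Proof. by rewrite /palg_const -palg_scaleAl mul1r. Qed.

Lemma palg_constC c u : palg_const c * u = u * palg_const c.
Proof. by rewrite palg_constM /palg_const -palg_scaleAr mulr1. Qed.

Lemma pword_nil : pword [::] = 1.
Proof. by rewrite /pword fword_nil pquot1. Qed.

Lemma pword_cat w1 w2 : pword (w1 ++ w2) = pword w1 * pword w2.
Proof. by rewrite /pword fword_cat pquotM. Qed.

Lemma pword_cons x w : pword (x :: w) = pgen R x * pword w.
Proof. by rewrite -cat1s pword_cat. Qed.

Lemma pwordE w : pword w = \prod_(x <- w) pgen R x.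
Proof.
elim: w => [|x w IH]; first by rewrite big_nil pword_nil.
by rewrite big_cons -IH pword_cons.
Qed.

Lemma palg_ind (P : palg R -> Prop) :
    P 0 -> (forall u v, P u -> P v -> P (u + v)) ->
    (forall c w, P (c *: pword w)) -> forall u, P u.
Proof.
move=> P0 PD PZ u; have [U <-] := pquot_surj u.
elim/freealg_ind: U => [|U V IHU IHV|c w].
- by rewrite pquot0.
- by rewrite pquotD; apply: PD.
- by rewrite pquotZ; apply: PZ.
Qed.

Lemma palg_rel r : r \in R -> pquot r.1 = pquot r.2.
Proof.
move=> rR; apply/eqP; rewrite -subr_eq0 -pquotB; apply/eqP/quot_pi_eq0.
rewrite -[_ - _]mul1r -[1 * _]mulr1; apply: IdealM.
by exists r.
Qed.

Section Universal.
Context (B : pzRingType) (phi : {rmorphism k -> B}) (h : X -> B).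
Hypothesis phiC : forall c b, phi c * b = b * phi c.
Hypothesis relB : forall r, r \in R -> freeval phi h r.1 = freeval phi h r.2.

Definition palg_lift u : B := freeval phi h (repr u).

(** Since scalars are central, evaluation is multiplicative and kills the two-sided ideal of the
    relations; the choice of representative in [palg_lift] is therefore harmless. *)
Lemma palg_lift_pi U : palg_lift (pquot U) = freeval phi h U.
Proof.
apply/eqP; rewrite -subr_eq0 -freevalN -freevalD; apply/eqP.
have : ideal_gen (fun V : freealg k X => exists2 r, r \in R & V = r.1 - r.2)
         (repr (pquot U) - U).
  by apply/quot_pi_eq0; rewrite -/(pquot _) pquotB /pquot /quot_pi reprK subrr.
elim=> [|a s b [r rR ->]|V W _ IHV _ IHW]; first exact: freeval0.
- rewrite !freevalM // freevalD freevalN relB // subrr.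
  by rewrite mulr0 mul0r.
- by rewrite freevalD freevalN IHV IHW subrr.
Qed.

Lemma palg_lift_zmod : zmod_morphism palg_lift.
Proof.
move=> u v; have [U <-] := pquot_surj u; have [V <-] := pquot_surj v.
by rewrite -pquotB !palg_lift_pi freevalD freevalN.
Qed.

Lemma palg_lift_monoid : monoid_morphism palg_lift.
Proof.
split.
  by rewrite -[X in palg_lift X]pquot1 palg_lift_pi -fword_nil freeval_word /wordval big_nil.
move=> u v; have [U <-] := pquot_surj u; have [V <-] := pquot_surj v.
by rewrite -pquotM !palg_lift_pi freevalM.
Qed.

HB.instance Definition _ := GRing.isZmodMorphism.Build _ _ palg_lift palg_lift_zmod.
HB.instance Definition _ := GRing.isMonoidMorphism.Build _ _ palg_lift palg_lift_monoid.

Lemma palg_universal : exists f : {rmorphism palg R -> B},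
  [/\ forall c u, f (c *: u) = phi c * f u,
      forall x, f (pgen R x) = h x &
      forall U, f (pquot U) = freeval phi h U].
Proof.
exists (palg_lift : {rmorphism _ -> _}); split=> [c u|x|U] /=.
- by have [U <-] := pquot_surj u; rewrite -pquotZ !palg_lift_pi freevalZ.
- by rewrite palg_lift_pi freeval_word /wordval big_seq1.
- exact: palg_lift_pi.
Qed.

End Universal.
End PresentedAlgebra.

(** * Monoid rings, Laurent polynomials and specialization *)

Section MonoidRingEval.
Import monalg.
Local Notation "u @_ m" := (monalg.mcoeff m u) : ring_scope.
Context (k : comNzRingType) (M : monoidType).
Implicit Types (u v : monring k M) (a b : M) (c : k).

Lemma scale_mon c a : c *: mon a = << c *g a >> :> monring k M.
Proof. by rewrite [LHS]mscaleU mulr1. Qed.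

Lemma monring_ind (P : monring k M -> Prop) :
    P 0 -> (forall u v, P u -> P v -> P (u + v)) ->
    (forall c a, P (c *: mon a)) -> forall u, P u.
Proof.
move=> P0 PD PZ u; rewrite (monalgE u); apply: big_ind => // m _.
by rewrite -scale_mon; apply: PZ.
Qed.

Lemma monM a b : mon a * mon b = mon (a * b)%g :> monring k M.
Proof. by rewrite [LHS]mmulUU mulr1. Qed.

Lemma mon1 : mon 1%g = 1 :> monring k M.
Proof. by []. Qed.

Lemma monring_scaleAr c u v : c *: (u * v) = u * (c *: v).
Proof.
apply: (lalg_scaleAr monring_ind) => {u v}c a b.
rewrite [in RHS]scale_mon monM scale_mon.
by rewrite [RHS]mmulUU mul1r.
Qed.

Section Eval.
Context (B : pzRingType) (phi : {rmorphism k -> B}) (h : M -> B).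

Definition moneval u : B := \sum_(a <- msupp u) phi u@_a * h a.

Lemma monevalEw (E : {fset M}) u : (msupp u `<=` E)%fset ->
  moneval u = \sum_(a <- E) phi u@_a * h a.
Proof.
move=> le; rewrite [LHS](big_fset_incl _ le) => //= x xd /mcoeff_outdom ->.
by rewrite rmorph0 mul0r.
Qed.

Lemma monevalD u v : moneval (u + v) = moneval u + moneval v.
Proof.
rewrite (monevalEw (msuppD_le u v)) (monevalEw (fsubsetUl (msupp u) (msupp v))).
rewrite (monevalEw (fsubsetUr (msupp u) (msupp v))) -big_split /=.
by apply: eq_bigr => m _; rewrite mcoeffD rmorphD mulrDl.
Qed.

Lemma monevalZ c u : moneval (c *: u) = phi c * moneval u.
Proof.
rewrite (monevalEw (msuppZ_le c u)) /moneval big_distrr /=.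
by apply: eq_bigr => m _; rewrite mcoeffZ rmorphM mulrA.
Qed.

Lemma moneval_mon a : moneval (mon a) = h a.
Proof.
rewrite (monevalEw (msuppU_le (x := 1) (k := a))).
by rewrite big_seq_fset1 mcoeffUU rmorph1 mul1r.
Qed.

Lemma moneval0 : moneval 0 = 0.
Proof. by rewrite /moneval msupp0 big_seq_fset0. Qed.

Lemma moneval_zmod : zmod_morphism moneval.
Proof.
by move=> u v; rewrite -scaleN1r monevalD monevalZ rmorphN1 mulN1r.
Qed.

Lemma moneval_monoid :
    (forall c y, phi c * y = y * phi c) ->
    h 1%g = 1 -> (forall a b, h (a * b)%g = h a * h b) ->
  monoid_morphism moneval.
Proof.
move=> phiC h1 hM; split; first by rewrite -mon1 moneval_mon.
apply: (lalg_evalM monring_ind monring_scaleAr _ phiC) => [c u v|a b].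
  by rewrite monevalD monevalZ.
by rewrite monM !moneval_mon.
Qed.

End Eval.

End MonoidRingEval.

Lemma augmentE (k : comNzRingType) (M : monoidType) :
  augment (k := k) (M := M) =1 moneval idfun (fun=> 1).
Proof. by move=> u; apply: eq_bigr => a _; rewrite mulr1. Qed.

Lemma monpushE (k : comNzRingType) (M N : monoidType) (h : M -> N) :
  monpush (k := k) h =1 moneval (in_alg (monring k N)) (mon \o h).
Proof.
move=> u; apply: eq_bigr => a _ /=.
by rewrite mulr_algl; rewrite scale_mon.
Qed.

(** * Specialization and extension of Laurent parameters *)

Section Laurent.
Context (k : comNzRingType).

Lemma laurent_at1_zmod m : zmod_morphism (@laurent_at1 k m).
Proof. by move=> u v; rewrite /laurent_at1 !augmentE moneval_zmod. Qed.

Lemma laurent_at1_monoid m : monoid_morphism (@laurent_at1 k m).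
Proof.
have [|||e1 eM] := @moneval_monoid k (zpow m) k idfun (fun=> 1).
- by move=> c b; apply: mulrC.
- by [].
- by move=> *; rewrite mulr1.
by split=> [|u v]; rewrite /laurent_at1 !augmentE.
Qed.

HB.instance Definition _ m := GRing.isZmodMorphism.Build (laurent k m) k
  (@laurent_at1 k m) (@laurent_at1_zmod m).
HB.instance Definition _ m := GRing.isMonoidMorphism.Build (laurent k m) k
  (@laurent_at1 k m) (@laurent_at1_monoid m).

(** Functoriality of Laurent polynomials in the exponent group: keeping some parameters and its
    section [laurent_extend] are both of this form. *)
Definition laurent_push m m' (h : zpow m' -> zpow m) : laurent k m' -> laurent k m :=
  monpush h.

Lemma laurent_push_mon m m' (h : zpow m' -> zpow m) c a :
  laurent_push h (c *: mon a) = c *: mon (h a).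
Proof.
rewrite /laurent_push monpushE monevalZ moneval_mon /=.
by rewrite mulr_algl.
Qed.

Section Push.
Context (m m' : nat) (h : zpow m' -> zpow m).
Hypothesis h1 : h 1%g = 1%g.
Hypothesis hM : forall a b, h (a * b)%g = (h a * h b)%g.

Lemma laurent_push_zmod : zmod_morphism (laurent_push h).
Proof. by move=> u v; rewrite /laurent_push !monpushE moneval_zmod. Qed.

Lemma laurent_push_monoid : monoid_morphism (laurent_push h).
Proof.
have [|||e1 eM] := @moneval_monoid k (zpow m') (laurent k m) (in_alg (laurent k m)) (mon \o h).
- by move=> c b; apply: mulrC.
- by rewrite /= h1.
- by move=> a b; rewrite /= hM -monM.
by split=> [|u v]; rewrite /laurent_push !monpushE.
Qed.

End Push.
End Laurent.

Section LaurentKeep.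
Context (k : comNzRingType) (m m' : nat) (iota : 'I_m -> 'I_m').

Lemma laurent_keep_zmod : zmod_morphism (@laurent_keep k m m' iota).
Proof. exact: laurent_push_zmod. Qed.

Lemma laurent_keep_monoid : monoid_morphism (@laurent_keep k m m' iota).
Proof.
apply: laurent_push_monoid => [|a b].
  by apply/ffunP=> j; rewrite !ffunE.
by apply/ffunP=> j; rewrite !ffunE.
Qed.

HB.instance Definition _ := GRing.isZmodMorphism.Build (laurent k m') (laurent k m)
  (@laurent_keep k m m' iota) laurent_keep_zmod.
HB.instance Definition _ := GRing.isMonoidMorphism.Build (laurent k m') (laurent k m)
  (@laurent_keep k m m' iota) laurent_keep_monoid.

(** For injective [iota] this is extension of exponents by 0. The sum over the fibre avoids
    inverting [iota] and is visibly additive. *)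
Definition zpow_extend (e : zpow m) : zpow m' :=
  [ffun i => \sum_(j | iota j == i) e j].

Definition laurent_extend : laurent k m -> laurent k m' := laurent_push zpow_extend.

Lemma laurent_extend_zmod : zmod_morphism laurent_extend.
Proof. exact: laurent_push_zmod. Qed.

Lemma laurent_extend_monoid : monoid_morphism laurent_extend.
Proof.
apply: laurent_push_monoid => [|a b].
  by apply/ffunP=> j; rewrite !ffunE big1 // => i _; rewrite ffunE.
by apply/ffunP=> j; rewrite !ffunE -big_split; apply: eq_bigr => i _; rewrite ffunE.
Qed.

HB.instance Definition _ := GRing.isZmodMorphism.Build (laurent k m) (laurent k m')
  laurent_extend laurent_extend_zmod.
HB.instance Definition _ := GRing.isMonoidMorphism.Build (laurent k m) (laurent k m')
  laurent_extend laurent_extend_monoid.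

Lemma laurent_keep_mon c (a : zpow m') :
  laurent_keep iota (c *: mon a : laurent k m') =
  c *: mon ([ffun j => a (iota j)] : zpow m) :> laurent k m.
Proof.
exact: (laurent_push_mon (fun e : zpow m' => [ffun j => e (iota j)] : zpow m)).
Qed.

Lemma laurent_extendK : injective iota -> cancel laurent_extend (laurent_keep iota).
Proof.
move=> inj u; elim/monring_ind: u => [|u v IHu IHv|c a].
- by rewrite !rmorph0.
- by rewrite !rmorphD /= IHu IHv.
have -> : laurent_extend (c *: mon a) = c *: mon (zpow_extend a).
  exact: laurent_push_mon.
rewrite laurent_keep_mon; congr (_ *: mon _); apply/ffunP=> j; rewrite !ffunE.
by rewrite (bigD1 j) //= big1 ?addr0 // => i /andP[/eqP/inj-> /eqP].
Qed.

Lemma laurent_extend_var (j : 'I_m) : injective iota ->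
  laurent_extend (laurent_var k j) = laurent_var k (iota j).
Proof.
move=> inj; rewrite /laurent_var -[mon _]scale1r.
have -> : forall a, laurent_extend (1 *: mon a) = 1 *: mon (zpow_extend a).
  by move=> a; apply: laurent_push_mon.
rewrite scale1r; congr mon; apply/ffunP=> i; rewrite !ffunE.
under eq_bigr do rewrite ffunE; case: eqP => [<-|ne].
  rewrite (bigD1 j) //= eqxx big1 ?addr0 // => i' /andP[/eqP/inj-> /eqP //].
by rewrite big1 // => i' /eqP e; case: eqP => // ej; rewrite ej e in ne.
Qed.

Lemma laurent_keep_var_in (j : 'I_m) : injective iota ->
  laurent_keep iota (laurent_var k (iota j)) = laurent_var k j.
Proof. by move=> inj; rewrite -laurent_extend_var // laurent_extendK. Qed.

Lemma laurent_keep_var_out (i : 'I_m') : (forall j, iota j != i) ->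
  laurent_keep iota (laurent_var k i) = 1.
Proof.
move=> ne; rewrite /laurent_var -[mon _]scale1r.
rewrite laurent_keep_mon scale1r -mon1; congr mon; apply/ffunP=> j; rewrite !ffunE.
by rewrite eq_sym (negbTE (ne j)).
Qed.

End LaurentKeep.

Lemma mpoly_rmorph_ext (k : comNzRingType) m (B : nzRingType)
    (f g : {rmorphism {mpoly k[m]} -> B}) :
  (forall c, f c%:MP = g c%:MP) -> (forall i, f 'X_i = g 'X_i) -> f =1 g.
Proof.
move=> fC fX p; rewrite (mpolyE p) !rmorph_sum; apply: eq_bigr => e _.
rewrite -mul_mpolyC !rmorphM /= fC mpolyXE_id !rmorph_prod; congr (_ * _).
by apply: eq_bigr => i _; rewrite !rmorphXn /= fX.
Qed.

Section LaurentOfMpoly.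
Context (k : comNzRingType) (m : nat).

Lemma laurent_of_mpoly_zmod : zmod_morphism (@laurent_of_mpoly k m).
Proof. exact: mmap_is_additive. Qed.

Lemma laurent_of_mpoly_monoid : monoid_morphism (@laurent_of_mpoly k m).
Proof.
by have [eM e1] := @mmap_is_multiplicative m k (laurent k m) (@laurent_var k m)
  (in_alg (laurent k m)).
Qed.

HB.instance Definition _ := GRing.isZmodMorphism.Build {mpoly k[m]} (laurent k m)
  (@laurent_of_mpoly k m) laurent_of_mpoly_zmod.
HB.instance Definition _ := GRing.isMonoidMorphism.Build {mpoly k[m]} (laurent k m)
  (@laurent_of_mpoly k m) laurent_of_mpoly_monoid.

Lemma laurent_of_mpolyX (i : 'I_m) : laurent_of_mpoly 'X_i = laurent_var k i.
Proof. by rewrite /laurent_of_mpoly mmapX mmap1U. Qed.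

Lemma laurent_at1_of_mpoly (p : {mpoly k[m]}) :
  laurent_at1 (laurent_of_mpoly p) = p.@[fun=> 1].
Proof.
pose f : {rmorphism {mpoly k[m]} -> k} := @laurent_at1 k m \o @laurent_of_mpoly k m.
pose g : {rmorphism {mpoly k[m]} -> k} := meval (fun _ : 'I_m => 1 : k).
suff: f p = g p by [].
have fX i : f 'X_i = g 'X_i.
  rewrite /f /g /= mevalXU laurent_of_mpolyX.
  by rewrite /laurent_at1 augmentE moneval_mon.
have fC c : f c%:MP = g c%:MP.
  rewrite /f /g /= mevalC /laurent_of_mpoly mmapC /=.
  by rewrite /laurent_at1 augmentE monevalZ -mon1 moneval_mon mulr1.
exact: (mpoly_rmorph_ext fC fX).
Qed.

End LaurentOfMpoly.

Section IdealGen.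
Context (A : pzRingType) (S : A -> Prop).

Lemma ideal_gen_sub s : S s -> ideal_gen S s.
Proof. by move=> Ss; rewrite -[s]mulr1 -[s]mul1r; apply: IdealM. Qed.

Lemma ideal_genN u : ideal_gen S u -> ideal_gen S (- u).
Proof. by move=> Su; rewrite -sub0r; apply: IdealB => //; apply: Ideal0. Qed.

Lemma ideal_genD u v : ideal_gen S u -> ideal_gen S v -> ideal_gen S (u + v).
Proof. by move=> Su Sv; rewrite -[v]opprK; apply: IdealB => //; apply: ideal_genN. Qed.

Lemma ideal_gen_trans v u w :
  ideal_gen S (u - v) -> ideal_gen S (v - w) -> ideal_gen S (u - w).
Proof. by move=> uv vw; rewrite -(subrKA v); apply: ideal_genD. Qed.

Lemma ideal_gen_mul u u' v v' : ideal_gen S (u - u') -> ideal_gen S (v - v') ->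
  ideal_gen S (u * v - u' * v').
Proof.
move=> Su Sv; apply: (@ideal_gen_trans (u' * v)); rewrite -?mulrBl -?mulrBr.
  exact: ideal_genMr.
exact: ideal_genMl.
Qed.

Lemma ideal_gen_sub0 u v : u = 0 -> v = 0 -> ideal_gen S (u - v).
Proof. by move=> -> ->; rewrite subrr; apply: Ideal0. Qed.

Lemma ideal_gen_subD u u1 u2 v v1 v2 : u = u1 + u2 -> v = v1 + v2 ->
  ideal_gen S (u1 - v1) -> ideal_gen S (u2 - v2) -> ideal_gen S (u - v).
Proof. by move=> -> -> S1 S2; rewrite opprD addrACA; apply: ideal_genD. Qed.

Lemma ideal_gen_ker (B : pzRingType) (f : {rmorphism A -> B}) :
  (forall s, S s -> f s = 0) -> forall u, ideal_gen S u -> f u = 0.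
Proof.
move=> fS u; elim=> [|a s b /fS fs|v w _ fv _ fw]; first exact: rmorph0.
  by rewrite !rmorphM fs mulr0 mul0r.
by rewrite rmorphB fv fw subrr.
Qed.

End IdealGen.

Section PquotFcoeff.
Context (k k' : comNzRingType) (X : finType) (R : seq (arel k' X)).
Context (s : {rmorphism k -> k'}).

Lemma pquot_fcoeffD (u v : freealg k X) :
  pquot R (fcoeff s (u + v)) = pquot R (fcoeff s u) + pquot R (fcoeff s v).
Proof. exact: (etrans (congr1 (pquot R) (fcoeffD s u v)) (pquotD R _ _)). Qed.

Lemma pquot_fcoeffZ c w : pquot R (fcoeff s (c *: fword k w)) = s c *: pword R w.
Proof.
exact: (etrans (congr1 (pquot R) (fcoeff_scale_word s c w)) (pquotZ R _ _)).
Qed.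

Lemma pquot_fcoeff_word w : pquot R (fcoeff s (fword k w)) = pword R w.
Proof. exact: (congr1 (pquot R) (fcoeff_word s w)). Qed.

End PquotFcoeff.

Lemma laurent_at1K (k : comNzRingType) m (c : k) :
  laurent_at1 (c%:A : laurent k m) = c.
Proof. by rewrite /laurent_at1 augmentE monevalZ -mon1 moneval_mon mulr1. Qed.

Lemma spec_idealZ (k k' : comNzRingType) (s : {rmorphism k -> k'}) (X : finType)
    (R : seq (arel k X)) (J : palg R -> Prop) c u :
  s c = 0 -> spec_ideal s J (c *: u).
Proof.
move=> sc; rewrite -[u]mul1r palg_scaleAl; apply/ideal_genMr/ideal_gen_sub.
by left; exists c.
Qed.

(** * Specializing a presented algebra to a monoid algebra *)

Section Specialization.
Context (k0 L k : comNzRingType) (X : finType).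
Context (l : {rmorphism k0 -> L}) (ev : {rmorphism k0 -> k}).
Context (at1 : {rmorphism L -> k}) (ic : {rmorphism k -> L}).
Hypothesis at1K : cancel ic at1.
Hypothesis at1l : forall p, at1 (l p) = ev p.
Context (R : seq (arel k0 X)) (RM : seq (mrel X)).
Hypothesis RRM : specialize ev R =i linearize k RM.

Let R' := specialize l R.
Let B := monring k (pmonoid RM).
Let phi : {rmorphism L -> B} := in_alg B \o at1.
Let h (x : X) : B := mon (mgen RM x).

Lemma wordval_mon w : wordval h w = mon (pmon_word RM w).
Proof.
elim: w => [|x w IH]; first by rewrite /wordval big_nil -mon1.
rewrite /wordval big_cons [X in _ * X]IH monM; congr mon.
by rewrite -pmon_wordM.
Qed.

Lemma specialize_phiC c y : phi c * y = y * phi c.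
Proof. by rewrite /= mulr_algl /GRing.in_alg -monring_scaleAr mulr1. Qed.

Lemma specialize_rel r : r \in R' -> freeval phi h r.1 = freeval phi h r.2.
Proof.
case/mapP => r0 r0R -> /=.
have E U : freeval phi h (fcoeff l U) = freeval (in_alg B) h (fcoeff ev U).
  apply: freeval_fcoeff => p.
  exact: (congr1 (in_alg B) (at1l p)).
have : (fcoeff ev r0.1, fcoeff ev r0.2) \in linearize k RM.
  by rewrite -RRM; apply/mapP; exists r0.
case/mapP => -[a b] abRM [e1 e2].
have Ew U w : fcoeff ev U = fword k w -> freeval phi h (fcoeff l U) = mon (pmon_word RM w).
  by move=> eU; rewrite -wordval_mon -(freeval_word (in_alg B)) -eU E.
apply: (etrans (Ew _ _ e1)); apply: (etrans _ (esym (Ew _ _ e2))).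
congr mon; apply/pmon_wordP; rewrite -[a]cats0 -[b]cats0.
exact: (McongRel [::] [::]).
Qed.

Let I : palg R' -> Prop := spec_ideal at1 (fun=> False).

(** A coefficient [l p] may be replaced by the constant [ic (ev p)] modulo the ideal, because [at1]
    does not distinguish them. *)
Lemma spec_ideal_fcoeff U :
  I (pquot _ (fcoeff l U) - pquot _ (fcoeff ic (fcoeff ev U))).
Proof.
elim/freealg_ind: U => [|u v Iu Iv|c w].
- apply: ideal_gen_sub0; first by rewrite [fcoeff l 0]fcoeff0 pquot0.
  by rewrite [fcoeff ev 0]fcoeff0 [fcoeff ic 0]fcoeff0 pquot0.
- apply: ideal_gen_subD Iu Iv; first exact: pquot_fcoeffD.
  apply: etrans (pquot_fcoeffD _ _ (fcoeff ev u) (fcoeff ev v)).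
  exact: (congr1 (fun V => pquot R' (fcoeff ic V)) (fcoeffD ev u v)).
- have e1 := pquot_fcoeffZ R' l c w.
  have e2 : pquot R' (fcoeff ic (fcoeff ev (c *: fword k0 w))) = ic (ev c) *: pword R' w.
    apply: etrans (pquot_fcoeffZ _ _ (ev c) w).
    exact: (congr1 (fun V => pquot R' (fcoeff ic V)) (fcoeff_scale_word ev c w)).
  apply: (eq_ind_r (fun x => I (x - _)) _ e1).
  apply: (eq_ind_r (fun x => I (_ - x)) _ e2).
  by rewrite -scalerBl; apply: spec_idealZ; rewrite raddfB /= at1K at1l subrr.
Qed.

(** A relation (a, b) of the monoid is the specialization of some [r] in [R]; its lift holds in the
    algebra, and each side of the lift agrees with the corresponding word modulo the ideal by
    [spec_ideal_fcoeff]. *)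
Lemma spec_ideal_mcong a b : mcong RM a b -> I (pword _ a - pword _ b).
Proof.
elim=> {a b} [u v a b abRM|u|u v _|u v w _].
- rewrite !pword_cat; apply: ideal_gen_mul; first by rewrite subrr; apply: Ideal0.
  apply: ideal_gen_mul; last by rewrite subrr; apply: Ideal0.
  have : (fword k a, fword k b) \in specialize ev R.
    by rewrite RRM; apply/mapP; exists (a, b).
  case/mapP => r rR [ea eb].
  have e := palg_rel (map_f _ rR : (fcoeff l r.1, fcoeff l r.2) \in R').
  have ew w U : fword k w = fcoeff ev U ->
      pword R' w = pquot _ (fcoeff ic (fcoeff ev U)).
    by move=> <-; rewrite [fcoeff _ _]fcoeff_word.
  apply: (eq_ind_r (fun x => I (x - _)) _ (ew _ _ ea)).
  apply: (eq_ind_r (fun x => I (_ - x)) _ (ew _ _ eb)).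
  apply: (ideal_gen_trans (v := pquot _ (fcoeff l r.1))).
    by rewrite -opprB; apply/ideal_genN/spec_ideal_fcoeff.
  apply: (eq_ind_r (fun x => I (x - _)) _ e).
  exact: spec_ideal_fcoeff.
- by rewrite subrr; apply: Ideal0.
- by move=> /ideal_genN; rewrite opprB.
- by move=> uv _ vw; apply: ideal_gen_trans vw.
Qed.

Lemma monoid_specialization :
  exists f : {rmorphism palg R' -> monring k (pmonoid RM)},
    [/\ forall c u, f (c *: u) = at1 c *: f u,
        forall x : X, f (pgen _ x) = mon (mgen RM x),
        forall v, exists u, f u = v &
        forall u, f u = 0 <-> spec_ideal at1 (fun=> False) u].
Proof.
have [f [fZ fg fpi]] := palg_universal specialize_phiC specialize_rel.
have fw w : f (pword _ w) = mon (pmon_word RM w).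
  by rewrite fpi freeval_word wordval_mon.
have fcw c w : f (c *: pword _ w) = at1 c *: mon (pmon_word RM w).
  by rewrite fZ fw mulr_algl.
exists f; split=> [c u|x|v|u].
- by rewrite fZ mulr_algl.
- exact: fg.
- elim/monring_ind: v => [|v w [u fu] [u' fu']|c a].
  + by exists 0; rewrite rmorph0.
  + by exists (u + u'); rewrite rmorphD fu fu'.
  + elim/quotW: a => w; exists (ic c *: pword _ w).
    by rewrite fcw /= at1K.
split; last first.
  apply: ideal_gen_ker => _ [[c sc ->]|//].
  by rewrite fZ /= sc scale0r mul0r.
(* An additive section of [f]: a class goes to a chosen word, a scalar to its image under [ic].
   Every u is congruent to G (f u) modulo the ideal, so the kernel of [f] lies in the ideal. *)
pose G : B -> palg R' := moneval (@palg_const _ _ R' \o ic)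
  (fun a : pmonoid RM => pword _ (repr a)).
suff IG : I (u - G (f u)).
  by move=> fu; move: IG; rewrite fu /G moneval0 subr0.
elim/palg_ind: u => [|u v Iu Iv|c w].
- by rewrite rmorph0 /G moneval0 subrr; apply: Ideal0.
- have GD x y : G (x + y) = G x + G y by apply: monevalD.
  exact: (ideal_gen_subD erefl (etrans (congr1 G (rmorphD f u v)) (GD _ _)) Iu Iv).
have -> : G (f (c *: pword _ w)) = ic (at1 c) *: pword _ (repr (pmon_word RM w)).
  by rewrite fcw /G monevalZ moneval_mon palg_constM.
apply: (ideal_gen_trans (v := ic (at1 c) *: pword _ w)).
  by rewrite -scalerBl; apply: spec_idealZ; rewrite raddfB /= at1K subrr.
rewrite -scalerBr -palg_constM; apply/ideal_genMl/spec_ideal_mcong.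
by apply/pmon_wordP; rewrite /pmon_word reprK.
Qed.

End Specialization.

(** The section of evaluation at 1 is the inclusion of the constants. *)
Lemma deforms_specializes (k : comNzRingType) (X : finType) m
    (R : seq (prel k m X)) (RM : seq (mrel X)) :
  deforms R RM -> specializes_to_monoid_algebra R RM.
Proof.
exact: (@monoid_specialization {mpoly k[m]} (laurent k m) k X
  (@laurent_of_mpoly k m) (meval (fun _ : 'I_m => 1 : k)) (@laurent_at1 k m)
  (in_alg (laurent k m)) (@laurent_at1K k m) (@laurent_at1_of_mpoly k m)).
Qed.

(** * Framization *)

(** The relations as equations in a ring, the form in which they are used in both directions: the
    generators of a presented algebra satisfy them, and any family satisfying them receives a
    morphism from that algebra. *)
Definition tl_axioms (B : pzRingType) n (t : 'I_n.-1 -> B) : Prop :=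
  (forall i j : 'I_n.-1, (1 < `|i - j|)%N -> t i * t j = t j * t i) /\
  (forall i j : 'I_n.-1, `|i - j|%N = 1%N -> t i * t j * t i = t i).

Definition framing_axioms (B : pzRingType) n d (t : 'I_n.-1 -> B) (z : 'I_n -> B) : Prop :=
  [/\ forall i, z i ^+ d = 1,
      forall i j, z i * z j = z j * z i,
      forall i, t i * z (lo_strand i) = t i * z (hi_strand i),
      forall i, z (lo_strand i) * t i = z (hi_strand i) * t i &
      forall i j, i != lo_strand j -> i != hi_strand j -> z i * t j = t j * z i].

Definition loop_axioms (B : pzRingType) n d (t : 'I_n.-1 -> B) (z : 'I_n -> B)
    (lam : 'I_d -> B) : Prop :=
  forall i (k : 'I_d), t i * z (lo_strand i) ^+ k * t i = lam k * t i.

Lemma wordval_tzt n (B : pzRingType) (h : framed_gen n -> B) i j :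
  wordval h (tzt i j) = h (gen_t i) * h (gen_z (lo_strand i)) ^+ j * h (gen_t i).
Proof.
rewrite /tzt /wordval big_cons -cats1 big_cat big_seq1 /= mulrA.
by congr (_ * _ * _); elim: j => [|j IH]; rewrite ?big_nil // big_cons IH exprS.
Qed.

Section Sound.
Context (k0 k : comNzRingType) (B : pzRingType) (X : choiceType).
Context (s : {rmorphism k0 -> k}) (phi : {rmorphism k -> B}) (h : X -> B).

Definition rel_holds (r : arel k0 X) : Prop :=
  freeval phi h (fcoeff s r.1) = freeval phi h (fcoeff s r.2).

Lemma freeval_fcoeff_word w : freeval phi h (fcoeff s (fword k0 w)) = wordval h w.
Proof. exact: (etrans (congr1 _ (fcoeff_word s w)) (freeval_word _ _ _)). Qed.

Lemma freeval_fcoeff_scale c w :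
  freeval phi h (fcoeff s (c *: fword k0 w)) = phi (s c) * wordval h w.
Proof.
apply: (etrans (congr1 (freeval phi h) (fcoeff_scale_word s c w))).
by apply: (etrans (freevalZ _ _ _ _)); rewrite freeval_word.
Qed.

Lemma linearize_holds (RM : seq (mrel X)) :
  (forall r, r \in RM -> wordval h r.1 = wordval h r.2) ->
  forall r, r \in linearize k0 RM -> rel_holds r.
Proof.
move=> H _ /mapP[r /H e ->]; rewrite /rel_holds.
by apply: (etrans (freeval_fcoeff_word _)); rewrite e freeval_fcoeff_word.
Qed.

Lemma tl_rels_hold n (t : 'I_n.-1 -> X) : tl_axioms (h \o t) ->
  forall r, r \in tl_rels t -> wordval h r.1 = wordval h r.2.
Proof.
move=> [tt ttt] r; rewrite mem_cat => /orP[] /mapP[[i j]].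
  rewrite mem_filter => /andP[ij _] -> /=.
  by rewrite /wordval !big_cons !big_nil !mulr1; apply: tt.
rewrite mem_filter => /andP[/eqP ij _] -> /=.
by rewrite /wordval !big_cons !big_nil !mulr1 mulrA; apply: ttt.
Qed.

End Sound.

Lemma framing_rels_hold n d (B : pzRingType) (h : framed_gen n -> B) :
  framing_axioms d (h \o @gen_t n) (h \o @gen_z n) ->
  forall r, r \in framing_rels n d -> wordval h r.1 = wordval h r.2.
Proof.
move=> [zd zz tz zt ztc] r; rewrite !mem_cat.
case/or3P=> [||/or3P[]] /mapP.
- move=> [i _ ->] /=; rewrite /wordval big_nil -[RHS](zd i).
  by rewrite big_nseq -Monoid.iteropE.
- move=> [[i j] _ ->] /=; rewrite /wordval !big_cons !big_nil !mulr1.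
  exact: zz.
- by move=> [i _ ->] /=; rewrite /wordval !big_cons !big_nil !mulr1; apply: tz.
- by move=> [i _ ->] /=; rewrite /wordval !big_cons !big_nil !mulr1; apply: zt.
- move=> [[i j]]; rewrite mem_filter => /andP[/andP[/= ne1 ne2] _] ->.
  by rewrite /wordval !big_cons !big_nil !mulr1; apply: ztc.
Qed.

Lemma tl_rels_axioms n (X : choiceType) (B : pzRingType) (h : X -> B) (t : 'I_n.-1 -> X) :
  (forall a b, (a, b) \in tl_rels t -> wordval h a = wordval h b) -> tl_axioms (h \o t).
Proof.
move=> H; split=> i j ij.
  have := H [:: t i; t j] [:: t j; t i].
  rewrite /wordval !big_cons !big_nil !mulr1; apply.
  rewrite mem_cat; apply/orP; left; apply/mapP; exists (i, j) => //.
  by rewrite mem_filter ij mem_enum.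
have := H [:: t i; t j; t i] [:: t i].
rewrite /wordval !big_cons !big_nil !mulr1 mulrA; apply.
rewrite mem_cat; apply/orP; right; apply/mapP; exists (i, j) => //.
by rewrite mem_filter /= ij mem_enum.
Qed.

Lemma framing_rels_axioms n d (B : pzRingType) (h : framed_gen n -> B) :
  (forall a b, (a, b) \in framing_rels n d -> wordval h a = wordval h b) ->
  framing_axioms d (h \o @gen_t n) (h \o @gen_z n).
Proof.
move=> H; split=> [i|i j|i|i|i j ne1 ne2].
- have := H (nseq d (gen_z i)) [::]; rewrite /wordval big_nil => <-.
    by rewrite big_nseq -Monoid.iteropE.
  rewrite mem_cat; apply/orP; left; apply/mapP; exists i => //.
  by rewrite mem_enum.
- have := H [:: gen_z i; gen_z j] [:: gen_z j; gen_z i].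
  rewrite /wordval !big_cons !big_nil !mulr1; apply.
  rewrite mem_cat; apply/orP; right; rewrite mem_cat; apply/orP; left.
  by apply/mapP; exists (i, j); rewrite ?mem_enum.
- have := H [:: gen_t i; gen_z (lo_strand i)] [:: gen_t i; gen_z (hi_strand i)].
  rewrite /wordval !big_cons !big_nil !mulr1; apply.
  do 2![rewrite mem_cat; apply/orP; right]; rewrite mem_cat; apply/orP; left.
  by apply/mapP; exists i; rewrite ?mem_enum.
- have := H [:: gen_z (lo_strand i); gen_t i] [:: gen_z (hi_strand i); gen_t i].
  rewrite /wordval !big_cons !big_nil !mulr1; apply.
  do 3![rewrite mem_cat; apply/orP; right]; rewrite mem_cat; apply/orP; left.
  by apply/mapP; exists i; rewrite ?mem_enum.
- have := H [:: gen_z i; gen_t j] [:: gen_t j; gen_z i].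
  rewrite /wordval !big_cons !big_nil !mulr1; apply.
  do 4![rewrite mem_cat; apply/orP; right].
  by apply/mapP; exists (i, j) => //; rewrite mem_filter ne1 ne2 mem_enum.
Qed.

Lemma tzt_loop_axioms n d (B : pzRingType) (h : framed_gen n -> B) (lam : 'I_d -> B) :
  (forall i (j : 'I_d), wordval h (tzt i j) = lam j * wordval h [:: gen_t i]) ->
  loop_axioms (h \o @gen_t n) (h \o @gen_z n) lam.
Proof.
by move=> H i j; have := H i j; rewrite wordval_tzt /wordval big_seq1.
Qed.

Section PalgRel.
Context (k0 k : comNzRingType) (X : finType) (R0 : seq (arel k0 X)).
Context (s : {rmorphism k0 -> k}).
Let R := specialize s R0.

Lemma palg_rel_word (a b : word X) : (fword _ a, fword _ b) \in R0 ->
  wordval (pgen R) a = wordval (pgen R) b.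
Proof.
move=> ab; have e := palg_rel (map_f (fun r => (fcoeff s r.1, fcoeff s r.2)) ab).
apply: (etrans (esym (pwordE R a)) (etrans _ (pwordE R b))).
apply: (etrans (esym (pquot_fcoeff_word _ s a))).
exact: (etrans e (pquot_fcoeff_word _ s b)).
Qed.

Lemma palg_rel_scale (a b : word X) c : (fword _ a, c *: fword _ b) \in R0 ->
  wordval (pgen R) a = palg_const R (s c) * wordval (pgen R) b.
Proof.
move=> ab; have e := palg_rel (map_f (fun r => (fcoeff s r.1, fcoeff s r.2)) ab).
apply: (etrans (esym (pwordE R a))).
apply: (etrans (esym (pquot_fcoeff_word _ s a))).
apply: (etrans (etrans e (pquot_fcoeffZ _ s c b))).
by rewrite -[wordval _ _]pwordE palg_constM.
Qed.

End PalgRel.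

Section TL.
Context (k0 k : comNzRingType) (n : nat).
Context (s : {rmorphism {mpoly k0[1]} -> k}).
Let R := specialize s (TL_rels n k0).

Lemma TL_rels_hold (B : pzRingType) (phi : {rmorphism k -> B}) (t : 'I_n.-1 -> B) :
    tl_axioms t -> (forall i, t i * t i = phi (s 'X_ord0) * t i) ->
  forall r, r \in R -> freeval phi t r.1 = freeval phi t r.2.
Proof.
move=> tl sq _ /mapP[r0 + ->]; rewrite -/(rel_holds s phi t r0) mem_cat.
case/orP; last by apply: linearize_holds; apply: tl_rels_hold.
case/mapP => i _ -> /=; rewrite /rel_holds.
apply: (etrans (freeval_fcoeff_word _ _ _ _)).
apply: (etrans _ (esym (freeval_fcoeff_scale _ _ _ _ _))).
by rewrite /wordval !big_cons !big_nil !mulr1; apply: sq.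
Qed.

Lemma palg_TL_axioms : tl_axioms (pgen R).
Proof.
apply: (@tl_rels_axioms n _ _ (pgen R) id) => a b ab; apply: palg_rel_word.
by rewrite mem_cat; apply/orP; right; apply/mapP; exists (a, b).
Qed.

Lemma palg_TL_square i : pgen R i * pgen R i = palg_const R (s 'X_ord0) * pgen R i.
Proof.
have := @palg_rel_scale _ _ _ (TL_rels n k0) s [:: i; i] [:: i] 'X_ord0.
rewrite /wordval !big_cons !big_nil !mulr1; apply.
by rewrite mem_cat; apply/orP; left; apply/mapP; exists i; rewrite ?mem_enum.
Qed.

End TL.

Section Framed.
Context (k0 k : comNzRingType) (n d : nat).
Context (s : {rmorphism {mpoly k0[npar d]} -> k}).

Lemma framed_TL_rels_hold (B : pzRingType) (phi : {rmorphism k -> B})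
    (h : framed_gen n -> B) :
    tl_axioms (h \o @gen_t n) -> framing_axioms d (h \o @gen_t n) (h \o @gen_z n) ->
    loop_axioms (h \o @gen_t n) (h \o @gen_z n)
      (fun j => phi (s (par_x d k0 * par_y k0 j))) ->
  forall r, r \in specialize s (framed_TL_rels n d k0) ->
    freeval phi h r.1 = freeval phi h r.2.
Proof.
move=> tl fr lo _ /mapP[r0 + ->]; rewrite -/(rel_holds s phi h r0) !mem_cat.
case/or3P.
- by apply: linearize_holds; apply: tl_rels_hold.
- by apply: linearize_holds; apply: framing_rels_hold.
case/mapP => -[i j] _ -> /=; rewrite /rel_holds.
apply: (etrans (freeval_fcoeff_word _ _ _ _)).
apply: (etrans _ (esym (freeval_fcoeff_scale _ _ _ _ _))).
by rewrite wordval_tzt // /wordval big_seq1; apply: lo.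
Qed.

Let R := specialize s (framed_TL_rels n d k0).

Lemma palg_tl_axioms : tl_axioms (pgen R \o @gen_t n).
Proof.
apply: tl_rels_axioms => a b ab; apply: palg_rel_word.
by rewrite mem_cat; apply/orP; left; apply/mapP; exists (a, b).
Qed.

Lemma palg_framing_axioms : framing_axioms d (pgen R \o @gen_t n) (pgen R \o @gen_z n).
Proof.
apply: framing_rels_axioms => a b ab; apply: palg_rel_word.
rewrite mem_cat; apply/orP; right; rewrite mem_cat; apply/orP; left.
by apply/mapP; exists (a, b).
Qed.

Lemma palg_loop_axioms :
  loop_axioms (pgen R \o @gen_t n) (pgen R \o @gen_z n)
    (fun j => palg_const R (s (par_x d k0 * par_y k0 j))).
Proof.
apply: tzt_loop_axioms => i j; apply: palg_rel_scale.
do 2![rewrite mem_cat; apply/orP; right].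
by apply/mapP; exists (i, j); rewrite ?mem_enum.
Qed.

End Framed.

(* Stated over [nzRingType] so that its instances at Laurent rings are
   syntactically those of [is_framization]. *)
Definition forgets_framing (L L' : nzRingType) (s : L' -> L) (X Y : finType)
    (R : seq (arel L X)) (R' : seq (arel L' (X + Y)%type)) : Prop :=
  exists f : {rmorphism palg R' -> palg R},
  [/\ forall c u, f (c *: u) = s c *: f u,
      forall x : X, f (pgen _ (inl x)) = pgen _ x,
      forall y : Y, f (pgen _ (inr y)) = 1,
      forall v, exists u, f u = v &
      forall u, f u = 0 <->
        spec_ideal s (fun v => exists y : Y, v = pgen _ (inr y) - 1) u].

(** * Sending the framing generators to 1 *)

Section Forget.
Context (L L' : comNzRingType) (s : {rmorphism L' -> L}) (sec : {rmorphism L -> L'}).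
Hypothesis secK : cancel sec s.
Context (X Y : finType) (R : seq (arel L X)) (R' : seq (arel L' (X + Y)%type)).

Definition forget_gen (g : X + Y) : palg R := if g is inl x then pgen R x else 1.

Section Kernel.
Context (f : {rmorphism palg R' -> palg R}) (g : {rmorphism palg R -> palg R'}).
Hypothesis fZ : forall c u, f (c *: u) = s c *: f u.
Hypothesis gZ : forall c u, g (c *: u) = sec c *: g u.
Hypothesis fg : forall x, f (pgen R' x) = forget_gen x.
Hypothesis gg : forall x, g (pgen R x) = pgen R' (inl x).

Lemma forget_word w : f (pword R' w) = \prod_(x <- w) forget_gen x.
Proof. by rewrite pwordE rmorph_prod; apply: eq_bigr. Qed.

Lemma forgetK : cancel g f.
Proof.
move=> v; elim/palg_ind: v => [|u v IHu IHv|c w].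
- by rewrite rmorph0 rmorph0.
- exact: (etrans (congr1 f (rmorphD g u v)) (etrans (rmorphD f _ _) (f_equal2 +%R IHu IHv))).
- rewrite gZ fZ secK; congr (_ *: _).
  by rewrite pwordE !rmorph_prod; apply: eq_bigr => x _; rewrite /= gg fg.
Qed.

Let J (v : palg R') := exists y : Y, v = pgen _ (inr y) - 1.

(** Passing from u to g (f u) replaces each scalar c by [sec (s c)] and each z in a word by 1. The
    first change is killed by [s], the second lies in the ideal of the z - 1, one letter at a
    time. *)
Lemma forget_embed u : spec_ideal s J (u - g (f u)).
Proof.
elim/palg_ind: u => [|u v Iu Iv|c w].
- by rewrite !rmorph0 subrr; apply: Ideal0.
- exact: (ideal_gen_subD erefl (etrans (congr1 g (rmorphD f u v)) (rmorphD g _ _)) Iu Iv).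
rewrite fZ gZ; apply: (ideal_gen_trans (v := sec (s c) *: pword _ w)).
  by rewrite -scalerBl; apply: spec_idealZ; rewrite raddfB /= secK subrr.
rewrite -scalerBr -palg_constM; apply: ideal_genMl.
rewrite forget_word pwordE rmorph_prod.
elim: w => [|x w IH]; first by rewrite !big_nil subrr; apply: Ideal0.
rewrite !big_cons; apply: ideal_gen_mul => //.
case: x => [x|y]; first by rewrite [g _]gg subrr; apply: Ideal0.
by rewrite [g _]rmorph1; apply: ideal_gen_sub; right; exists y.
Qed.

Lemma forget_ker u : f u = 0 <-> spec_ideal s J u.
Proof.
split=> [fu|]; last first.
  apply: ideal_gen_ker => _ [[c sc ->]|[y ->]].
    by rewrite fZ /= sc scale0r.
  by rewrite rmorphB rmorph1 fg subrr.
by have := forget_embed u; rewrite fu rmorph0 subr0.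
Qed.

End Kernel.

Let phi : {rmorphism L' -> palg R} := @palg_const _ _ R \o s.
Let psi : {rmorphism L -> palg R'} := @palg_const _ _ R' \o sec.

Definition forget_sound := forall r, r \in R' ->
  freeval phi forget_gen r.1 = freeval phi forget_gen r.2.
Definition embed_sound := forall r, r \in R ->
  freeval psi (pgen R' \o inl) r.1 = freeval psi (pgen R' \o inl) r.2.
Hypothesis forgetR : forget_sound.
Hypothesis embedR : embed_sound.

Lemma forget_framing : forgets_framing s R R'.
Proof.
have phiC c y : phi c * y = y * phi c by apply: palg_constC.
have psiC c y : psi c * y = y * psi c by apply: palg_constC.
have [f [fZ fg]] : exists f : {rmorphism palg R' -> palg R},
    (forall c u, f (c *: u) = s c *: f u) /\
    (forall x, f (pgen R' x) = forget_gen x).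
  have [f [fZ fg _]] := palg_universal phiC forgetR.
  by exists f; split=> // c u; apply: etrans (fZ c u) (palg_constM _ _).
have [g [gZ gg]] : exists g : {rmorphism palg R -> palg R'},
    (forall c u, g (c *: u) = sec c *: g u) /\
    (forall x, g (pgen R x) = pgen R' (inl x)).
  have [g [gZ gg _]] := palg_universal psiC embedR.
  by exists g; split=> // c u; apply: etrans (gZ c u) (palg_constM _ _).
exists f; split.
- exact: fZ.
- by move=> x; apply: fg.
- by move=> y; apply: fg.
- by move=> v; exists (g v); apply: (forgetK fZ gZ fg gg).
- exact: (forget_ker fZ gZ fg gg).
Qed.

End Forget.

Lemma specialize_linearize (k k' : comNzRingType) (s : {rmorphism k -> k'})
    (X : choiceType) (RM : seq (mrel X)) :
  specialize s (linearize k RM) = linearize k' RM.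
Proof.
rewrite /specialize /linearize -map_comp; apply: eq_map => r.
by congr (_, _); apply: fcoeff_word.
Qed.

Lemma specialize_cat (k k' : comNzRingType) (s : k -> k') (X : choiceType)
    (R1 R2 : seq (arel k X)) :
  specialize s (R1 ++ R2) = specialize s R1 ++ specialize s R2.
Proof. exact: map_cat. Qed.

Lemma linearize_cat (k : comNzRingType) (X : choiceType) (R1 R2 : seq (mrel X)) :
  linearize k (R1 ++ R2) = linearize k R1 ++ linearize k R2.
Proof. exact: map_cat. Qed.

Section Main.
Context (k : comNzRingType) (n d : nat) (hd : (0 < d)%N).

Let iota := fun _ : 'I_1 => ord0 : 'I_(npar d).

Lemma iota_inj : injective iota.
Proof. by move=> i j _; rewrite (ord1 i) (ord1 j). Qed.

Let L := laurent k 1.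
Let L' := laurent k (npar d).
Let R := rels_laurent (TL_rels n k).
Let R' := rels_laurent (framed_TL_rels n d k).

Lemma laurent_of_par (j : 'I_d) :
  laurent_of_mpoly (par_x d k * par_y k j) =
  laurent_var k ord0 * (if val j == 0%N then 1 else laurent_var k (inord j)).
Proof.
rewrite [LHS]rmorphM; congr (_ * _); first exact: laurent_of_mpolyX.
rewrite /par_y; case: ifP => _; [exact: rmorph1 | exact: laurent_of_mpolyX].
Qed.

Lemma keep_par (j : 'I_d) :
  laurent_keep iota (laurent_of_mpoly (par_x d k * par_y k j)) = laurent_var k ord0.
Proof.
rewrite laurent_of_par rmorphM /=.
rewrite (laurent_keep_var_in _ ord0 iota_inj).
case: ifP => [_|j0]; first by rewrite rmorph1 mulr1.
rewrite [X in _ * X]laurent_keep_var_out ?mulr1 // => i.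
(* As d > 0, [npar d] equals d and [inord j] keeps the value j; for j nonzero it is a variable other
   than x. *)
rewrite /iota -val_eqE /= eq_sym inordK ?j0 // /npar prednK //.
Qed.

Lemma forget_rels : forget_sound (laurent_keep iota) R R'.
Proof.
have [tt ttt] := palg_TL_axioms n (@laurent_of_mpoly k 1).
apply: framed_TL_rels_hold.
- by split=> i j; [apply: tt | apply: ttt].
- split=> *; rewrite /= ?expr1n ?mulr1 ?mul1r //.
- move=> i j; rewrite /= expr1n mulr1 keep_par.
  by have := palg_TL_square (@laurent_of_mpoly k 1) i; rewrite /= laurent_of_mpolyX.
Qed.

Lemma embed_rels : embed_sound (laurent_extend iota) R R'.
Proof.
apply: TL_rels_hold; first exact: palg_tl_axioms.
(* Index 0 is available in ['I_d] since d > 0: there z^0 = 1 and y_0 = 1, and the loop relation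
   becomes the square relation of TL_n. *)
move=> i; have lo := palg_loop_axioms (@laurent_of_mpoly k (npar d)) i (Ordinal hd).
have e : laurent_of_mpoly (par_x d k * par_y k (Ordinal hd)) =
         laurent_extend iota (laurent_of_mpoly 'X_ord0).
  by rewrite laurent_of_par mulr1 laurent_of_mpolyX laurent_extend_var //; apply: iota_inj.
apply: etrans (etrans lo _); first by rewrite expr0 mulr1.
exact: (congr1 (fun c => palg_const R' c * pgen R' (inl i)) e).
Qed.

Lemma TL_deforms : deforms (TL_rels n k) (jones_rels n).
Proof.
move=> r; rewrite /rels_at1 specialize_cat (linearize_cat k (square_rels id)) !mem_cat.
congr (_ || _); congr (_ \in _); last exact: (specialize_linearize (meval _)).
rewrite /specialize /linearize -!map_comp; apply: eq_map => i /=.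
congr (_, _); first exact: fcoeff_word.
apply: (etrans (fcoeff_scale_word _ _ _)).
by rewrite /= mevalXU scale1r.
Qed.

Lemma meval_par (j : 'I_d) : (par_x d k * par_y k j).@[fun=> 1] = 1.
Proof.
rewrite mevalM mevalXU mul1r /par_y.
by case: ifP => _; [exact: meval1 | exact: mevalXU].
Qed.

Lemma framed_TL_deforms : deforms (framed_TL_rels n d k) (framed_jones_rels n d).
Proof.
(* The framed Jones list has a separate block [sq] of square relations. At 1 they already occur
   among the loop relations, as the words [tzt i 0], so the two lists have the same members. *)
have orE (a b c a' b' c' sq : bool) : a = a' -> b = b' -> c = c' -> (sq -> c') ->
    [|| a, b | c] = [|| sq, a', b' | c'].
  by move=> -> -> ->; case: sq => // ->; rewrite ?orbT.
move=> r; rewrite /rels_at1 !specialize_cat (linearize_cat k (square_rels _)).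
rewrite (linearize_cat k (tl_rels _)) (linearize_cat k (framing_rels _ _)) !mem_cat.
apply: orE.
- by congr (_ \in _); apply: (specialize_linearize (meval _)).
- by congr (_ \in _); apply: (specialize_linearize (meval _)).
- congr (_ \in _); rewrite /specialize /linearize -!map_comp.
  apply: eq_map => -[i j] /=; congr (_, _); first exact: fcoeff_word.
  apply: (etrans (fcoeff_scale_word _ _ _)).
  by rewrite /= meval_par scale1r.
- case/mapP => r0 /mapP[i _ ->] -> /=; apply/mapP.
  exists (tzt i 0, [:: gen_t i]) => //; apply/mapP.
  by exists (i, Ordinal hd); rewrite ?mem_enum.
Qed.

Lemma framed_TL_framization : is_framization iota (jones_rels n)
  (framed_jones_rels n d) (TL_rels n k) (framed_TL_rels n d k).
Proof.
split.
- exact: iota_inj.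
- exact: TL_deforms.
- exact: framed_TL_deforms.
- change (forgets_framing (laurent_keep iota) (rels_laurent (TL_rels n k))
    (rels_laurent (framed_TL_rels n d k))).
  exact (forget_framing (laurent_extendK iota_inj) forget_rels embed_rels).
Qed.
End Main.

(** * Normal forms span *)

(* [s \in nf d m b] codes the product of the layers T^i_{k_i} z_{k_i}^{a_i}, i < m,
   with T^i_k = t_{i-1} ... t_k, as the list of the (k_i, a_i). The trivial factor
   T^i_i = 1 is coded by k_i = i; the k_i < i increase strictly and stay below b. *)
Fixpoint nf (d m b : nat) : seq (seq (nat * nat)) :=
  if m is m'.+1 then
    [seq rcons s (m', a) | s <- nf d m' b, a <- iota 0 d] ++
    flatten [seq [seq rcons s (k, a) | s <- nf d m' k, a <- iota 0 d] | k <- iota 0 (minn b m')]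
  else [:: [::]].

Lemma nfS d m b s : reflect
  ((exists s' a, [/\ s = rcons s' (m, a), s' \in nf d m b & a < d]) \/
   (exists k s' a, [/\ s = rcons s' (k, a), k < minn b m, s' \in nf d m k & a < d]))%N
  (s \in nf d m.+1 b).
Proof.
rewrite /= mem_cat; apply: (iffP orP) => -[].
- case/allpairsP => -[s' a] /= [s'_nf]; rewrite mem_iota => /andP[_ ad] ->.
  by left; exists s', a.
- case/flatten_mapP => k; rewrite mem_iota add0n => /andP[_ kb].
  case/allpairsP => -[s' a] /= [s'_nf]; rewrite mem_iota => /andP[_ ad] ->.
  by right; exists k, s', a.
- move=> [s' [a [-> s'_nf ad]]]; left.
  by apply/allpairsP; exists (s', a); rewrite mem_iota.
- move=> [k [s' [a [-> kb s'_nf ad]]]]; right.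
  apply/flatten_mapP; exists k; first by rewrite mem_iota.
  by apply/allpairsP; exists (s', a); rewrite mem_iota.
Qed.

Lemma size_nf_word d m b s : s \in nf d m b -> size s = m.
Proof.
elim: m b s => [|m IH] b s; first by rewrite inE => /eqP->.
by case/nfS => [[s' [a [-> /IH <- _]]]|[k [s' [a [-> _ /IH <- _]]]]]; rewrite size_rcons.
Qed.

Lemma nf_mono d m b b' s : (b <= b')%N -> s \in nf d m b -> s \in nf d m b'.
Proof.
elim: m s => [|m IH] s bb' //; case/nfS => [[s' [a [-> s'_nf ad]]]|[k [s' [a [-> kb s'_nf ad]]]]].
  by apply/nfS; left; exists s', a; split => //; apply: IH.
by apply/nfS; right; exists k, s', a; split => //; lia.
Qed.

Lemma nf_max d m b s : s \in nf d m b -> s \in nf d m m.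
Proof.
elim: m s => [|m IH] s //; case/nfS => [[s' [a [-> s'_nf ad]]]|[k [s' [a [-> kb s'_nf ad]]]]].
  by apply/nfS; left; exists s', a; split => //; apply: nf_mono (IH _ s'_nf).
by apply/nfS; right; exists k, s', a; split => //; lia.
Qed.

Section Span.
Context (K : comNzRingType) (B : pzRingType) (sc : {rmorphism K -> B}).
Hypothesis scC : forall c u, sc c * u = u * sc c.
Context (n d : nat) (t z : nat -> B) (lam : nat -> K).

Hypothesis tt_far : forall i j, (i.+1 < j)%N -> (j.+1 < n)%N -> t i * t j = t j * t i.
Hypothesis ttt_up : forall i, (i.+2 < n)%N -> t i * t i.+1 * t i = t i.
Hypothesis ttt_dn : forall i, (i.+2 < n)%N -> t i.+1 * t i * t i.+1 = t i.+1.
Hypothesis zd : forall i, (i < n)%N -> z i ^+ d = 1.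
Hypothesis zz : forall i j, (i < n)%N -> (j < n)%N -> z i * z j = z j * z i.
Hypothesis tz : forall i, (i.+1 < n)%N -> t i * z i = t i * z i.+1.
Hypothesis zt : forall i, (i.+1 < n)%N -> z i * t i = z i.+1 * t i.
Hypothesis zt_far : forall i j, (i < n)%N -> (j.+1 < n)%N -> i != j -> i != j.+1 ->
  z i * t j = t j * z i.
Hypothesis tzt : forall i k, (i.+1 < n)%N -> (k < d)%N ->
  t i * z i ^+ k * t i = sc (lam k) * t i.

(** This is T^{k+l}_k. Recording the length instead of the upper end keeps truncated subtraction out
    of the recursion. *)
Fixpoint Td k l : B := if l is l'.+1 then t (k + l') * Td k l' else 1.

Lemma Td_cat k l1 l2 : Td k (l1 + l2) = Td (k + l1) l2 * Td k l1.
Proof.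
elim: l2 => [|l2 IH]; first by rewrite addn0 mul1r.
by rewrite addnS /= IH mulrA addnA.
Qed.

Lemma Td1 k : Td k 1 = t k.
Proof. by rewrite /= addn0 mulr1. Qed.

Lemma Td2 k : Td k 2 = t k.+1 * t k.
Proof. by rewrite /= addn0 addn1 mulr1. Qed.

Lemma TdS k l : Td k l.+1 = Td k.+1 l * t k.
Proof. by rewrite -add1n Td_cat Td1 addn1. Qed.

Lemma t_Td k l j : (k + l < n)%N -> (j.+1 < k)%N || (k + l < j)%N -> (j.+1 < n)%N ->
  t j * Td k l = Td k l * t j.
Proof.
elim: l => [|l IH] kln jk jn; first by rewrite mulr1 mul1r.
rewrite /= -mulrA -IH; try lia; rewrite !mulrA; congr (_ * _).
by case/orP: jk => ?; [apply: tt_far | apply/esym/tt_far]; lia.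
Qed.

Lemma z_Td k l j : (k + l < n)%N -> (j < k)%N || (k + l < j)%N -> (j < n)%N ->
  z j * Td k l = Td k l * z j.
Proof.
elim: l => [|l IH] kln jk jn; first by rewrite mulr1 mul1r.
by rewrite /= -mulrA -IH ?mulrA ?zt_far //; lia.
Qed.

Lemma Td_Td k l k' l' : (k + l < k')%N -> (k' + l' < n)%N ->
  Td k l * Td k' l' = Td k' l' * Td k l.
Proof.
move=> lt kn; elim: l lt => [|l IH] lt; first by rewrite mulr1 mul1r.
by rewrite /= -mulrA IH ?mulrA ?t_Td //; lia.
Qed.

Lemma Td_z_next k l : (k + l.+1 < n)%N -> Td k l.+1 * z k.+1 = Td k l.+1 * z k.
Proof. by move=> kn; rewrite TdS -!mulrA tz //; lia. Qed.

(** The strand at j on the left of T is at j+2 on its right: t_{j+1} t_j z_{j+2} = t_{j+1} z_{j+2}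
    t_j = t_{j+1} z_{j+1} t_j = t_{j+1} z_j t_j = z_j t_{j+1} t_j. The other factors commute with
    the framing. *)
Lemma Td_z_shift k l j : (k + l < n)%N -> (k <= j)%N -> (j.+2 <= k + l)%N ->
  Td k l * z j.+2 = z j * Td k l.
Proof.
move=> kn kj jl; have [i ?] : exists i, j = (k + i)%N by exists (j - k)%N; lia.
have [r ?] : exists r, l = (i + (2 + r))%N by exists (k + l - j - 2)%N; lia.
subst j l.
rewrite !Td_cat /= addn0 mulr1 addn1 !mulrA.
rewrite -!mulrA -z_Td; try lia.
rewrite [t (k + i)%N * (z _ * _)]mulrA -[t (k + i)%N * z _]zt_far; try lia.
rewrite -[z (k + i).+2 * _ * _]mulrA [t (k + i).+1 * (z _ * _)]mulrA -tz; try lia.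
rewrite -[t (k + i).+1 * z _ * _]mulrA [z (k + i).+1 * (_ * _)]mulrA -zt; try lia.
rewrite -[z (k + i) * _ * _]mulrA [t (k + i).+1 * (z _ * _)]mulrA -zt_far; try lia.
by rewrite !mulrA z_Td //; lia.
Qed.

(** The factor t_j t_{j-1} inside T meets the new t_j, which commutes with everything to the right
    of t_{j-1}; then t_j t_{j-1} t_j = t_j cuts T in two. *)
Lemma Td_t k l j : (k + l < n)%N -> (k < j)%N -> (j < k + l)%N ->
  Td k l * t j = Td k (j.-1 - k) * Td j (k + l - j).
Proof.
move=> kn kj jl; have [i ?] : exists i, j = (k + i).+1 by exists (j - k.+1)%N; lia.
have [r ?] : exists r, l = (i + (2 + r))%N by exists (k + l - j - 1)%N; lia.
subst j l.
have -> : ((k + i).+1.-1 - k)%N = i by lia.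
have -> : (k + (i + (2 + r)) - (k + i).+1)%N = r.+1 by lia.
rewrite Td_Td; try lia.
rewrite !Td_cat Td2 TdS addn2 -!mulrA -t_Td; try lia.
by congr (_ * _); rewrite !mulrA ttt_dn //; lia.
Qed.

(** The mirror cut, from t_j t_{j+1} t_j = t_j. *)
Lemma t_Td_in k l j : (k + l < n)%N -> (k <= j)%N -> (j.+1 < k + l)%N ->
  t j * Td k l = Td j.+2 (k + l - j.+2) * Td k (j.+1 - k).
Proof.
move=> kn kj jl; have [i ?] : exists i, j = (k + i)%N by exists (j - k)%N; lia.
have [r ?] : exists r, l = (i + (2 + r))%N by exists (k + l - j - 2)%N; lia.
subst j l.
have -> : ((k + i).+1 - k)%N = i.+1 by lia.
have -> : (k + (i + (2 + r)) - (k + i).+2)%N = r by lia.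
rewrite !Td_cat Td2 addn2 !mulrA t_Td; try lia.
rewrite -!mulrA; congr (_ * _).
by rewrite !mulrA ttt_up //; lia.
Qed.

(** The last factor t_l of T^{m'}_l cuts T^m_k into T^m_{l+2} T^{l+1}_k. These two pieces commute,
    and T^{m'}_{l+1} T^{l+1}_k = T^{m'}_k. *)
Lemma Td_exchange k l m m' : (k <= l)%N -> (l < m')%N -> (m' < m)%N -> (m < n)%N ->
  Td l (m' - l) * Td k (m - k) = Td k (m' - k) * Td l.+2 (m - l.+2).
Proof.
move=> kl lm' m'm mn.
have -> : (m' - l)%N = (m' - l.+1).+1 by lia.
rewrite TdS -mulrA t_Td_in; try lia.
have -> : (k + (m - k) - l.+2)%N = (m - l.+2)%N by lia.
rewrite -[Td l.+2 _ * _]Td_Td; try lia.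
rewrite mulrA; congr (_ * _).
have -> : (m' - k)%N = (l.+1 - k + (m' - l.+1))%N by lia.
by rewrite Td_cat; congr (Td _ _ * _); lia.
Qed.

Definition layer m (p : nat * nat) : B := Td p.1 (m - p.1) * z p.1 ^+ p.2.

Definition nfval (s : seq (nat * nat)) : B :=
  \prod_(0 <= i < size s) layer i (nth (0, 0)%N s i).

Lemma mulr_swap (x y y' w w' c : B) : c * y = y * c -> c * y' = y' * c ->
  y * w = y' * w' -> x * y * c * w = x * y' * c * w'.
Proof. by move=> cy cy' yw; rewrite -!mulrA; congr (_ * _); rewrite !mulrA -cy -cy' -!mulrA yw. Qed.

Lemma nfval_rcons s p : nfval (rcons s p) = nfval s * layer (size s) p.
Proof.
rewrite /nfval size_rcons big_nat_recr //= nth_rcons ltnn eqxx; congr (_ * _).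
by apply: eq_big_nat => i /andP[_ ilt]; rewrite nth_rcons ilt.
Qed.

Lemma layer_top m a : layer m (m, a) = z m ^+ a.
Proof. by rewrite /layer /= subnn mul1r. Qed.

Lemma commXr (x y : B) a : x * y = y * x -> x ^+ a * y = y * x ^+ a.
Proof. by move=> e; apply/esym; apply: (commrX a (esym e : GRing.comm y x)). Qed.

Lemma zX_far i j a : (i < n)%N -> (j.+1 < n)%N -> i != j -> i != j.+1 ->
  z i ^+ a * t j = t j * z i ^+ a.
Proof. by move=> *; apply: commXr; apply: zt_far. Qed.

Lemma zzX i j a b : (i < n)%N -> (j < n)%N -> z i ^+ a * z j ^+ b = z j ^+ b * z i ^+ a.
Proof. by move=> ? ?; apply: commXr; apply/esym/commXr; apply: zz. Qed.

Lemma zXt a i : (i.+1 < n)%N -> z i ^+ a * t i = z i.+1 ^+ a * t i.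
Proof.
move=> ii; elim: a => [|a IH] //.
rewrite exprSr -mulrA zt // mulrA -{1}[z i.+1]expr1 zzX; try lia.
by rewrite -mulrA IH mulrA expr1 -exprS.
Qed.

Lemma zX_Td a k l j : (k + l < n)%N -> (j < k)%N || (k + l < j)%N -> (j < n)%N ->
  z j ^+ a * Td k l = Td k l * z j ^+ a.
Proof. by move=> *; apply: commXr; apply: z_Td. Qed.

Lemma zX_layer c m k a j : (k <= m < n)%N -> (j < k)%N || (m < j)%N -> (j < n)%N ->
  z j ^+ c * layer m (k, a) = layer m (k, a) * z j ^+ c.
Proof.
move=> km jk jn; rewrite /layer /= mulrA zX_Td; try lia.
by rewrite -!mulrA zzX; try lia.
Qed.

Lemma Td_zX_shift a k l j : (k + l < n)%N -> (k <= j)%N -> (j.+2 <= k + l)%N ->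
  Td k l * z j.+2 ^+ a = z j ^+ a * Td k l.
Proof.
move=> kn kj jl; elim: a => [|a IH]; first by rewrite !expr0 mulr1 mul1r.
by rewrite exprSr mulrA IH -mulrA Td_z_shift // mulrA -exprSr.
Qed.

(** Framings follow the exchange: z_l^a becomes z_{l+2}^a on crossing T^m_k, and z_k^b commutes with
    T^m_{l+2}, which starts beyond strand k. *)
Lemma layer_exchange k l m m' a b : (k <= l)%N -> (l < m')%N -> (m' < m)%N -> (m < n)%N ->
  layer m' (l, a) * layer m (k, b) = layer m' (k, b) * layer m (l.+2, a).
Proof.
move=> kl lm' m'm mn; rewrite /layer /= !mulrA -[Td l _ * _ * Td k _]mulrA.
rewrite -Td_zX_shift; try lia.
rewrite mulrA Td_exchange // -!mulrA; congr (_ * _).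
by rewrite [RHS]mulrA zX_Td; try lia; rewrite -mulrA zzX; try lia.
Qed.

Inductive lin_span (P : B -> Prop) : B -> Prop :=
| lin_span0 : lin_span P 0
| lin_spanD u v : lin_span P u -> lin_span P v -> lin_span P (u + v)
| lin_spanZ c u : P u -> lin_span P (sc c * u).

Lemma lin_span_gen (P : B -> Prop) u : P u -> lin_span P u.
Proof. by move=> Pu; rewrite -[u]mul1r -(rmorph1 sc); apply: lin_spanZ. Qed.

Lemma lin_span_scale P c u : lin_span P u -> lin_span P (sc c * u).
Proof.
elim=> [|v w _ IHv _ IHw|c' v Pv]; first by rewrite mulr0; apply: lin_span0.
  by rewrite mulrDr; apply: lin_spanD.
by rewrite mulrA -rmorphM; apply: lin_spanZ.
Qed.

Lemma lin_span_mulr (P Q : B -> Prop) b : (forall u, P u -> lin_span Q (u * b)) ->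
  forall u, lin_span P u -> lin_span Q (u * b).
Proof.
move=> PQ u; elim=> [|v w _ IHv _ IHw|c v Pv]; first by rewrite mul0r; apply: lin_span0.
  by rewrite mulrDl; apply: lin_spanD.
by rewrite -mulrA; apply/lin_span_scale/PQ.
Qed.

Definition nf_span m : B -> Prop := lin_span (fun u => exists2 s, s \in nf d m m & u = nfval s).

Hypothesis d_gt0 : (0 < d)%N.

Lemma layer_mod m k a : (k < n)%N -> layer m (k, a) = layer m (k, a %% d)%N.
Proof.
move=> kn; rewrite /layer /= {1}(divn_eq a d) exprD mulnC exprM zd // expr1n.
by rewrite mul1r.
Qed.

(** The nontrivial starting points increase, so the last of them is the largest and alone decides
    whether a layer starting at k can be appended. If it cannot, only the framings of trivial
    layers, the z_i^{c_i}, stand after the offending layer. *)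
Lemma nf_decomp m k s : s \in nf d m m -> s \in nf d m k \/
  exists m' l a s' c, [/\ (m' < m)%N, (k <= l < m')%N, s' \in nf d m' m' &
    nfval s = nfval s' * layer m' (l, a) * \prod_(m'.+1 <= i < m) z i ^+ c i].
Proof.
elim: m s => [|m IH] s; first by left.
case/nfS => [[s' [a [-> s'_nf ad]]]|[l [s' [a [-> kb s'_nf ad]]]]].
  case: (IH s' (nf_max s'_nf)) => [s'k|[m' [l [a' [s2 [c [m'm kl s2nf e]]]]]]].
    by left; apply/nfS; left; exists s', a.
  right; exists m', l, a', s2, (fun i => if i == m then a else c i); split=> //.
    exact: ltnW.
  rewrite nfval_rcons (size_nf_word s'_nf) layer_top e big_nat_recr //= eqxx mulrA.
  congr (_ * _ * _); apply: eq_big_nat => i /andP[_ im].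
  by rewrite (ltn_eqF im).
case: (ltnP l k) => lk.
  by left; apply/nfS; right; exists l, s', a; split=> //; lia.
right; exists m, l, a, s', (fun=> 0%N); split=> //.
- lia.
- exact: nf_max s'_nf.
- by rewrite nfval_rcons (size_nf_word s'_nf) big_geq ?mulr1.
Qed.

Lemma nf_span_layers m r c u :
    (forall j v, (m <= j < m + r)%N -> nf_span j v -> nf_span j.+1 (v * z j ^+ c j)) ->
  nf_span m u -> nf_span (m + r) (u * \prod_(m <= i < m + r) z i ^+ c i).
Proof.
elim: r => [|r IH] H Su; first by rewrite addn0 big_geq // mulr1.
rewrite addnS big_nat_recr ?leq_addr //= mulrA.
by apply: (H); [lia | apply: IH => // j v jr; apply: H; lia].
Qed.

(* If s ends, up to framings, with a layer (m', l) such that k <= l, exchange it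
   with the new layer (m, k) into (m', k) and (m, l+2), and induct on m - k. *)
Lemma nf_span_layer m k a u : (m < n)%N -> (k <= m)%N -> nf_span m u ->
  nf_span m.+1 (u * layer m (k, a)).
Proof.
elim/ltn_ind: m k a u => m IHm k a u mn.
have [r] := ubnP (m - k); elim: r k a u => // r IHr k a u mkr km.
apply: lin_span_mulr => {}u [s s_nf ->].
have [sk|[m' [l [a' [s' [c [m'm kl s'_nf ->]]]]]]] := nf_decomp k s_nf.
  rewrite layer_mod; last by lia.
  rewrite -(size_nf_word s_nf) -nfval_rcons (size_nf_word s_nf); apply: lin_span_gen.
  exists (rcons s (k, (a %% d)%N)) => //; apply/nfS.
  case: (ltnP k m) => km'.
    by right; exists k, s, (a %% d)%N; rewrite ltn_mod; split=> //; lia.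
  left; exists s, (a %% d)%N; rewrite ltn_mod; have -> : k = m by lia.
  by split=> //; apply: nf_mono s_nf; lia.
set Z := \prod_(_ <= i < _) _.
(* The framings in [Z] sit on strands m'+1, ..., m-1, beyond the reach of T^{m'}_p. *)
have ZC p b : (p <= m')%N -> Z * layer m' (p, b) = layer m' (p, b) * Z.
  move=> pm; rewrite /Z big_nat; elim/big_ind: _ => [|x y Hx Hy|i /andP[m'i im]].
  - by rewrite mul1r mulr1.
  - by rewrite -mulrA Hy mulrA Hx -mulrA.
  - by apply: zX_layer; lia.
have -> : nfval s' * layer m' (l, a') * Z * layer m (k, a) =
          nfval s' * layer m' (k, a) * Z * layer m (l.+2, a').
  apply: mulr_swap; [apply: ZC; lia.. | apply: layer_exchange; lia].
apply: IHr; [lia | lia |].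
(* The shortened prefix lies at level m'+1 by the outer induction, which also restores the framings
   of [Z], as trivial layers m'+1, ..., m-1. *)
have : nf_span m'.+1 (nfval s' * layer m' (k, a)).
  by apply: IHm; [lia.. | apply: lin_span_gen; exists s'].
move: (nfval s' * _) => v; rewrite {ZC}/Z.
rewrite -(subnKC m'm); apply: nf_span_layers => j v' jm; rewrite -layer_top.
by apply: IHm; lia.
Qed.

Definition nf_span_stable m b := forall u, nf_span m u -> nf_span m (u * b).

Lemma nf_span_stable1 m : nf_span_stable m 1. Proof. by move=> u; rewrite mulr1. Qed.

Lemma nf_span_stableM m b c : nf_span_stable m b -> nf_span_stable m c -> nf_span_stable m (b * c).
Proof. by move=> Sb Sc u Su; rewrite mulrA; apply/Sc/Sb. Qed.

Lemma nf_span_stableX m b k : nf_span_stable m b -> nf_span_stable m (b ^+ k).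
Proof.
by move=> Sb; elim: k => [|k IH]; [exact: nf_span_stable1 | rewrite exprS; apply: nf_span_stableM].
Qed.

Lemma nf_span_stable_Td m k l :
  (forall j, (j.+1 < m)%N -> nf_span_stable m (t j)) -> (k + l < m)%N ->
  nf_span_stable m (Td k l).
Proof.
move=> st; elim: l => [|l IH] kl; first exact: nf_span_stable1.
by apply: nf_span_stableM; [apply: st; lia | apply: IH; lia].
Qed.

(** Once the generator has crossed the last layer, the factor b that comes out on the left is
    absorbed by the prefix, and [nf_span_layer] puts the modified layer back. *)
Lemma nf_span_step m b c k a k' a' g : (m < n)%N -> (k' <= m)%N -> nf_span_stable m b ->
  layer m (k, a) * g = sc c * (b * layer m (k', a')) ->
  forall u, nf_span m u -> nf_span m.+1 (u * layer m (k, a) * g).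
Proof.
move=> mn km Sb e u Su; rewrite -mulrA e mulrA -scC -mulrA mulrA -[X in nf_span _ X]mulrA.
by apply: lin_span_scale; rewrite mulrA; apply: nf_span_layer => //; apply: Sb.
Qed.

Lemma nf_span_succ m g :
  (forall k a u, (k <= m)%N -> (a < d)%N -> nf_span m u -> nf_span m.+1 (u * layer m (k, a) * g)) ->
  nf_span_stable m.+1 g.
Proof.
move=> H; rewrite /nf_span_stable; apply: lin_span_mulr => _ [s s_nf ->].
case/nfS: s_nf => [[s' [a [-> s'_nf ad]]]|[k [s' [a [-> kb s'_nf ad]]]]];
  rewrite nfval_rcons (size_nf_word s'_nf); apply: H => //; try lia;
  by apply: lin_span_gen; exists s' => //; apply: nf_max s'_nf.
Qed.

(** The generator only has to be moved across the last layer T^m_k z_k^a. How it crosses depends on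
    its position relative to k, and what comes out on the left acts on the first m strands, where
    the induction hypothesis applies. *)
Lemma nf_span_gens m : (m <= n)%N ->
  (forall j, (j.+1 < m)%N -> nf_span_stable m (t j)) /\
  (forall j, (j < m)%N -> nf_span_stable m (z j)).
Proof.
elim: m => [|m IH] mn; first by split.
have [st sz] := IH (ltnW mn).
have step := nf_span_step mn.
split=> j jm; apply: nf_span_succ => k a u km ad.
- case: (ltngtP j.+1 k) => [jk|kj|jk].
  + apply: (step (t j) 1 k a k a) => //; first by apply: st; lia.
    rewrite rmorph1 mul1r /layer /= -mulrA zX_far; try lia.
    by rewrite !mulrA t_Td //; lia.
  + have {kj}kj : (k <= j)%N by [].
    case: (eqVneq k j) => [kj'|kj'].
      (* Here t_k z_k^a t_k closes a loop: the only case that yields a scalar. *)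
      subst k; apply: (step 1 (lam a) j a j 0%N) => //; first exact: nf_span_stable1.
      rewrite /layer /= expr0 mulr1 mul1r.
      have -> : (m - j)%N = (m - j.+1).+1 by lia.
      rewrite TdS; have -> : forall x : B, x * t j * z j ^+ a * t j = x * (t j * z j ^+ a * t j).
        by move=> x; rewrite !mulrA.
      rewrite tzt //; last by lia.
      by rewrite mulrA -scC -mulrA.
    (* The generator t_j cuts T^m_k into T^{j-1}_k and T^m_j; z_k^a commutes with the latter and
       leaves with the former. *)
    apply: (step (Td k (j.-1 - k) * z k ^+ a) 1 k a j 0%N) => //; first lia.
      apply: nf_span_stableM; first by apply: nf_span_stable_Td => //; lia.
      by apply/nf_span_stableX/sz; lia.
    rewrite rmorph1 mul1r /layer /= expr0 mulr1 -mulrA zX_far; try lia.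
    rewrite mulrA Td_t; try lia.
    rewrite -!mulrA zX_Td; try lia.
    by congr (_ * (Td _ _ * _)); lia.
  (* T^m_k grows to T^m_{k-1}, and the framing slides across t_{k-1} to strand k-1 and out to the
     left. *)
  + apply: (step (z j ^+ a) 1 k a j 0%N) => //; first lia.
      by apply/nf_span_stableX/sz; lia.
    subst k; rewrite rmorph1 mul1r /layer /= expr0 mulr1.
    have -> : (m - j)%N = (m - j.+1).+1 by lia.
    by rewrite TdS mulrA zX_Td; [rewrite -!mulrA zXt //; lia | lia..].
- case: (ltngtP j k) => [jk|kj|jk].
  + apply: (step (z j) 1 k a k a) => //; first by apply: sz; lia.
    have := @zX_layer 1 m k a j; rewrite !expr1 rmorph1 mul1r => -> //; lia.
  + case: (eqVneq j k.+1) => [jk|jk].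
      (* The strands k and k+1 are the two ends of one arc below T^m_k. The exponent may reach d; it
         is reduced modulo d when the layer is put back. *)
      subst j; apply: (step 1 1 k a k a.+1) => //; first exact: nf_span_stable1.
      rewrite rmorph1 !mul1r /layer /=.
      have -> : (m - k)%N = (m - k.+1).+1 by lia.
      rewrite exprS [RHS]mulrA -Td_z_next; last by lia.
      by rewrite -!mulrA -[z k.+1]expr1 zzX //; lia.
    (* A framing further right crosses T^m_k, two strands back. *)
    apply: (step (z j.-2) 1 k a k a) => //; first by apply: sz; lia.
    rewrite rmorph1 mul1r /layer /= mulrA.
    have {1}-> : j = j.-2.+2 by lia.
    rewrite -mulrA -[z j.-2.+2]expr1 zzX; try lia.
    by rewrite mulrA Td_zX_shift; [rewrite expr1 | lia..].
  + subst k; apply: (step 1 1 j a j a.+1) => //; first exact: nf_span_stable1.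
    by rewrite rmorph1 !mul1r /layer /= exprSr mulrA.
Qed.

Lemma nf_span_one : nf_span n 1.
Proof.
have -> : 1 = nfval (mkseq (fun i => (i, 0%N)) n).
  rewrite /nfval big_nat big1 // => i /andP[_]; rewrite size_mkseq => im.
  by rewrite nth_mkseq // layer_top expr0.
apply: lin_span_gen; exists (mkseq (fun i => (i, 0%N)) n) => //.
suff H m b : mkseq (fun i => (i, 0%N)) m \in nf d m b by apply: H.
elim: m => [|m IH] //; apply/nfS; left.
exists (mkseq (fun i => (i, 0%N)) m), 0%N; split=> //.
by rewrite /mkseq -addn1 iotaD map_cat /= cats1.
Qed.

End Span.

(** * Counting normal forms *)

Section Ballot.
Local Open Scope nat_scope.

(** The number of choices of the starting points k_i; each choice leaves d^m choices of
    exponents. *)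
Fixpoint ballot m b : nat :=
  if m is m'.+1 then ballot m' b + \sum_(k < minn b m') ballot m' k else 1.

Lemma size_nf d m b : size (nf d m b) = ballot m b * d ^ m.
Proof.
elim: m b => [|m IH] b //=.
rewrite size_cat size_allpairs size_iota IH mulnDl expnSr mulnA; congr (_ + _).
rewrite size_flatten /shape -map_comp sumnE big_map.
rewrite -[minn b m in LHS]subn0 -/(index_iota 0 _) big_mkord big_distrl /=.
by apply: eq_bigr => k _; rewrite size_allpairs size_iota IH mulnA.
Qed.

Lemma ballot_max m b : m <= b -> ballot m b = ballot m m.
Proof.
case: m => //= m mb.
have -> : minn b m = m by lia.
have -> : minn m.+1 m = m by lia.
congr (_ + _); elim: m b mb => //= m IH b mb.
have -> : minn b m = m by lia.
have -> : minn m.+2 m = m by lia.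
by congr (_ + _); rewrite (IH b) ?(IH m.+2) //; lia.
Qed.

Lemma ballotS m b : b < m -> ballot m.+1 b.+1 = ballot m.+1 b + ballot m b.+1.
Proof.
move=> bm /=; have -> : minn b.+1 m = b.+1 by lia.
have -> : minn b m = b by lia.
by rewrite big_ord_recr /=; lia.
Qed.

Lemma ballot_diag m : ballot m.+1 m.+1 = ballot m.+1 m.
Proof.
rewrite /= (@ballot_max _ m.+1) //.
by have -> : minn m.+1 m = minn m m by lia.
Qed.

(** The reflection formula C(m+b, b) - C(m+b, b-1), without subtraction. By [ballotS] and
    [ballot_diag] the numbers obey the recursion of lattice paths confined to b <= m, which Pascal's
    rule reproduces. *)
Lemma ballot_bin m b : b <= m ->
  ballot m b + (if b is b'.+1 then 'C(m + b, b') else 0) = 'C(m + b, b).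
Proof.
elim: m b => [|m IHm] b; first by rewrite leqn0 => /eqP->.
elim: b => [_|b IHb bm].
  by rewrite /= min0n big_ord0 !addn0 bin0; have := IHm 0 isT; rewrite !addn0 bin0.
have {}IHb := IHb (ltnW bm).
(* Pascal's rule, where the binomial of lower index -1 is read as 0. *)
have pas : 'C(m.+1 + b.+1, b) =
    'C(m.+1 + b, b) + (if b is b'.+1 then 'C(m.+1 + b, b') else 0).
  by case: (b) => [|b']; rewrite ?bin0 // addnS binS.
rewrite pas [in RHS]addnS binS; case: (ltnP b m) => bm'.
  have := IHm b.+1 bm'; rewrite ballotS // -addSnnS; lia.
(* On the diagonal the term C(2m+1, m+1) has no ballot counterpart; symmetry turns it into C(2m+1,
   m), which cancels. *)
have eb : b = m by lia.
subst b; rewrite ballot_diag; have -> : 'C(m.+1 + m, m.+1) = 'C(m.+1 + m, m).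
  by rewrite -bin_sub; [congr 'C(_, _); lia | lia].
lia.
Qed.

Lemma ballot_Catalan m : ballot m m = Catalan m.
Proof.
have := ballot_bin (leqnn m); rewrite addnn /Catalan => e.
suff <- : ballot m m * m.+1 = 'C(m.*2, m) by rewrite mulnK.
case: m e => [|m] e; first by rewrite bin0.
(* Neighbouring binomials satisfy (m+1) C(2m+2, m+1) = (m+2) C(2m+2, m), so the difference is
   C(2m+2, m+1) / (m+2). *)
have := mul_bin_left (m.+1).*2 m; nia.
Qed.

Lemma size_nf_Catalan d m : size (nf d m m) = Catalan m * d ^ m.
Proof. by rewrite size_nf ballot_Catalan. Qed.

End Ballot.

(** * Labelled perfect matchings *)

Section Matching.
Context (T : eqType) (G : zmodType) (K : comNzRingType) (lam : G -> K).
Implicit Types (m : T -> T) (l : T -> G) (p q r s : T).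

(* The action of t_i on a labelled matching (m, l) of the 2n boundary points, where
   p and q are the bottom points i and i+1: their partners are joined, the labels
   of the two arcs are added, and if p was already joined to q the closed loop is
   traded for the scalar [loop]. [bead] is the action of z_i^g. *)
Definition glue p q m r :=
  if r == p then q else if r == q then p else
  if m r == p then m q else if m r == q then m p else m r.

Definition glue_label p q m l r :=
  if (r == p) || (r == q) then 0 else
  if m r == p then l r + l q else if m r == q then l r + l p else l r.

Definition bead g p m l r := if (r == p) || (m r == p) then l r + g else l r.

Definition loop p q m l : K := if m p == q then lam (l p) else 1.

(** Identities between gluings concern finitely many points and their partners: comparing these
    pairwise leaves branches that congruence settles from the [instances] of the matching axioms. *)
Ltac cases :=
  repeat match goal with
  | |- context [?x == ?y] =>
      lazymatch x with context [if _ then _ else _] => fail | _ => idtac end;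
      lazymatch y with context [if _ then _ else _] => fail | _ => idtac end;
      case: (@eqP _ x y) => ? /=; try congruence
  end.

Section Glue.
Context (m : T -> T) (l : T -> G).
Hypothesis mK : involutive m.
Hypothesis m_neq : forall x, m x <> x.
Hypothesis lm : forall x, l (m x) = l x.

Ltac instances x :=
  move: (mK x) (@m_neq x) (lm x) => ? ? ?.

Lemma glueK p q : p <> q -> involutive (glue p q m).
Proof. by move=> ? r; instances p; instances q; instances r; rewrite /glue; cases. Qed.

Lemma glue_neq p q r : p <> q -> glue p q m r <> r.
Proof. by move=> ?; instances p; instances q; instances r; rewrite /glue; cases. Qed.

Lemma glue_label_glue p q r : p <> q ->
  glue_label p q m l (glue p q m r) = glue_label p q m l r.
Proof.
move=> ?; instances p; instances q; instances r.
by rewrite /glue /glue_label; cases; rewrite [LHS]addrC; congr (_ + _); congruence.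
Qed.

Lemma glue_sym p q r : glue p q m r = glue q p m r.
Proof. by instances p; instances q; instances r; rewrite /glue; cases. Qed.

Lemma glue_label_sym p q r : glue_label p q m l r = glue_label q p m l r.
Proof. by instances p; instances q; instances r; rewrite /glue_label; cases. Qed.

Lemma glueC p q p' q' r : p <> q -> p' <> q' -> p <> p' -> p <> q' -> q <> p' -> q <> q' ->
  glue p' q' (glue p q m) r = glue p q (glue p' q' m) r.
Proof.
move=> ? ? ? ? ? ?; instances p; instances q; instances p'; instances q'; instances r.
by rewrite /glue; cases.
Qed.

Lemma glue_labelC p q p' q' r :
  p <> q -> p' <> q' -> p <> p' -> p <> q' -> q <> p' -> q <> q' ->
  glue_label p' q' (glue p q m) (glue_label p q m l) r =
  glue_label p q (glue p' q' m) (glue_label p' q' m l) r.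
Proof.
move=> ? ? ? ? ? ?; instances p; instances q; instances p'; instances q'; instances r.
rewrite /glue /glue_label; cases; rewrite ?addrA //.
Qed.

Lemma glue_braid p q s r : p <> q -> q <> s -> p <> s ->
  glue p q (glue q s (glue p q m)) r = glue p q m r.
Proof.
move=> ? ? ?; instances p; instances q; instances s; instances r.
by rewrite /glue; cases.
Qed.

Lemma glue_label_braid p q s r : p <> q -> q <> s -> p <> s ->
  glue_label p q (glue q s (glue p q m))
    (glue_label q s (glue p q m) (glue_label p q m l)) r =
  glue_label p q m l r.
Proof.
move=> ? ? ?; instances p; instances q; instances s; instances r.
by rewrite /glue /glue_label; cases; rewrite ?addr0 ?add0r; congruence.
Qed.

(** Two separate loops give commuting scalars. If two arcs join the pair p, q to the pair p', q',
    whichever gluing comes second closes one loop, labelled by the sum of both labels. *)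
Lemma loopC p q p' q' :
  p <> q -> p' <> q' -> p <> p' -> p <> q' -> q <> p' -> q <> q' ->
  loop p q m l * loop p' q' (glue p q m) (glue_label p q m l) =
  loop p' q' m l * loop p q (glue p' q' m) (glue_label p' q' m l).
Proof.
move=> ? ? ? ? ? ?; instances p; instances q; instances p'; instances q'.
rewrite /loop /glue /glue_label; cases; rewrite ?mul1r ?mulr1 //.
  exact: mulrC.
by rewrite addrC.
Qed.

Lemma loop_sym p q : loop p q m l = loop q p m l.
Proof. by instances p; instances q; rewrite /loop; cases. Qed.

Lemma loop_braid p q s : p <> q -> q <> s -> p <> s ->
  loop p q m l * loop q s (glue p q m) (glue_label p q m l) *
    loop p q (glue q s (glue p q m))
      (glue_label q s (glue p q m) (glue_label p q m l)) =
  loop p q m l.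
Proof.
move=> ? ? ?; instances p; instances q; instances s.
by rewrite /loop /glue /glue_label; cases; rewrite ?mulr1.
Qed.

Lemma bead_inv g p r : bead g p m l (m r) = bead g p m l r.
Proof. by instances p; instances r; rewrite /bead; cases. Qed.

Lemma beadD g h p r : bead g p m (bead h p m l) r = bead (h + g) p m l r.
Proof. by rewrite /bead; case: (_ || _); rewrite ?addrA. Qed.

Lemma bead0 p r : bead 0 p m l r = l r.
Proof. by rewrite /bead addr0 if_same. Qed.

Lemma beadC g h p q r : bead g p m (bead h q m l) r = bead h q m (bead g p m l) r.
Proof. by rewrite /bead; case: (_ || _); case: (_ || _); rewrite // addrAC. Qed.

Lemma bead_glue g p q r : p <> q ->
  bead g p (glue p q m) (glue_label p q m l) r =
  bead g q (glue p q m) (glue_label p q m l) r.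
Proof.
by move=> ?; instances p; instances q; instances r; rewrite /bead /glue /glue_label; cases.
Qed.

Lemma glue_label_bead g p q r : p <> q ->
  glue_label p q m (bead g p m l) r = glue_label p q m (bead g q m l) r.
Proof.
move=> ?; instances p; instances q; instances r.
rewrite /bead /glue_label; cases; by rewrite addrA addrAC.
Qed.

Lemma loop_bead g p q : p <> q -> loop p q m (bead g p m l) = loop p q m (bead g q m l).
Proof. by move=> ?; instances p; instances q; rewrite /loop /bead; cases. Qed.

Lemma glue_label_bead_far g s p q r : p <> q -> s <> p -> s <> q ->
  glue_label p q m (bead g s m l) r = bead g s (glue p q m) (glue_label p q m l) r.
Proof.
move=> ? ? ?; instances p; instances q; instances r; instances s.
rewrite /bead /glue /glue_label; cases; by rewrite ?addrA // addrAC.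
Qed.

Lemma loop_bead_far g s p q : s <> p -> s <> q -> loop p q m (bead g s m l) = loop p q m l.
Proof.
by move=> ? ?; instances p; instances q; instances s; rewrite /loop /bead; cases.
Qed.

Lemma glue_idem p q r : p <> q -> glue p q (glue p q m) r = glue p q m r.
Proof. by move=> ?; instances p; instances q; instances r; rewrite /glue; cases. Qed.

Lemma glue_label_bead_glue g p q r : p <> q ->
  glue_label p q (glue p q m) (bead g p (glue p q m) (glue_label p q m l)) r =
  glue_label p q m l r.
Proof.
move=> ?; instances p; instances q; instances r.
by rewrite /bead /glue /glue_label; cases.
Qed.

Lemma loop_bead_glue g p q : p <> q ->
  loop p q (glue p q m) (bead g p (glue p q m) (glue_label p q m l)) = lam g.
Proof.
move=> ?; instances p; instances q.
by rewrite /loop /bead /glue /glue_label; cases; rewrite add0r.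
Qed.

Lemma glue_new p q : glue p q m p = q.
Proof. by rewrite /glue eqxx. Qed.

Lemma glue_label_new p q : glue_label p q m l p = 0.
Proof. by rewrite /glue_label eqxx. Qed.

Lemma glue_out p q r : r <> p -> r <> q -> m r <> p -> m r <> q -> glue p q m r = m r.
Proof. by rewrite /glue; cases. Qed.

Lemma glue_label_out p q r : r <> p -> r <> q -> m r <> p -> m r <> q ->
  glue_label p q m l r = l r.
Proof. by rewrite /glue_label; cases. Qed.

(* When q is linked to w, the only effect of gluing p to q is to transport
   the end p of an arc to w. *)
Lemma glue_transport p q w x y : p <> q -> w <> p -> m q = w ->
    x <> q -> x <> w -> y <> q -> y <> w ->
  glue p q m (if x == p then w else x) = (if y == p then w else y) -> m x = y.
Proof.
move=> ? ? ? ? ? ? ?; instances p; instances q; instances w; instances x; instances y.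
by rewrite /glue; cases.
Qed.

Lemma loop1 p q : m p <> q -> loop p q m l = 1.
Proof. by rewrite /loop; cases. Qed.

End Glue.

(** Gluing replaces the arcs p-x and q-w by p-q and x-w, and the label of x-w is that of p-x because
    q-w carries 0. Knowing w, everything can be recovered. *)
Lemma glue_inj (m1 m2 : T -> T) (l1 l2 : T -> G) p q w :
    involutive m1 -> (forall x, m1 x <> x) -> (forall x, l1 (m1 x) = l1 x) ->
    involutive m2 -> (forall x, m2 x <> x) -> (forall x, l2 (m2 x) = l2 x) ->
    p <> q -> w <> p -> m1 q = w -> m2 q = w -> l1 q = 0 -> l2 q = 0 ->
    glue p q m1 =1 glue p q m2 -> glue_label p q m1 l1 =1 glue_label p q m2 l2 ->
  m1 =1 m2 /\ l1 =1 l2.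
Proof.
move=> m1K m1n lm1 m2K m2n lm2 ? ? ? ? ? ? eg el.
have em : m1 =1 m2.
  move=> r; move: (m1K r) (m1K p) (m1K q) (m1K w) (m2K r) (m2K p) (m2K q) (m2K w).
  move: (m1n r) (m1n p) (m1n q) (m1n w) (m2n r) (m2n p) (m2n q) (m2n w).
  do 16!move=> ?; move: (eg r) (eg w).
  by rewrite /glue; cases.
split=> // r; have label m l s : involutive m -> (forall x, m x <> x) ->
    (forall x, l (m x) = l x) -> m q = w -> l q = 0 ->
    l s = if s == q then 0 else if s == w then 0 else if s == p then glue_label p q m l w
          else glue_label p q m l s.
  move=> mK mn lm mq lq; move: (mK s) (mK p) (mK q) (mn s) (mn p) (mn q) (lm q) => ? ? ? ? ? ? ?.
  by rewrite /glue_label; cases; rewrite ?lq ?addr0 //; rewrite -mq lm lq add0r; congruence.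
by rewrite (label m1 l1) // (label m2 l2) // !el.
Qed.

End Matching.

(** * Monomial matrices *)

Section Monomial.
Context (S : finType) (K : comNzRingType).

(** Matrices act on row vectors from the right, so a product applies its left factor first, in the
    order in which the words act on diagrams. *)
Definition mono (c : S -> K) (f : S -> S) : 'M[K]_#|S| :=
  \matrix_(i, j) (c (enum_val i) *+ (f (enum_val i) == enum_val j)).

Definition state (s : S) : 'rV[K]_#|S| := delta_mx 0 (enum_rank s).

Lemma state_mono s c f : state s *m mono c f = c s *: state (f s).
Proof.
rewrite -rowE; apply/rowP => j; rewrite !mxE enum_rankK eqxx /=.
by rewrite -[j == _](inj_eq enum_val_inj) enum_rankK eq_sym mulr_natr.
Qed.

Lemma state_inj (A B : 'M[K]_#|S|) : (forall s, state s *m A = state s *m B) -> A = B.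
Proof.
move=> e; apply/row_matrixP => i; rewrite !rowE.
by have := e (enum_val i); rewrite /state enum_valK.
Qed.

Lemma monoM c f c' f' :
  mono c f * mono c' f' = mono (fun s => c s * c' (f s)) (f' \o f).
Proof.
apply: state_inj => s; rewrite mulmxA !state_mono -scalemxAl state_mono scalerA.
by [].
Qed.

Lemma eq_mono c f c' f' : c =1 c' -> f =1 f' -> mono c f = mono c' f'.
Proof. by move=> ec ef; apply/matrixP => i j; rewrite !mxE ec ef. Qed.

Lemma mono1 : mono (fun=> 1) id = 1.
Proof. by apply: state_inj => s; rewrite state_mono scale1r mulmx1. Qed.

Lemma eq_monoM c f c' f' c1 f1 c1' f1' :
    (forall s, c s * c' (f s) = c1 s * c1' (f1 s)) ->
    (forall s, f' (f s) = f1' (f1 s)) ->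
  mono c f * mono c' f' = mono c1 f1 * mono c1' f1'.
Proof. by move=> ec ef; rewrite [LHS]monoM [RHS]monoM; apply: eq_mono. Qed.

Lemma monoM3 c f c' f' c2 f2 c3 f3 :
    (forall s, c s * c' (f s) * c2 (f' (f s)) = c3 s) ->
    (forall s, f2 (f' (f s)) = f3 s) ->
  mono c f * mono c' f' * mono c2 f2 = mono c3 f3.
Proof. by move=> ec ef; rewrite monoM [LHS]monoM; apply: eq_mono. Qed.

Lemma monoX f a : mono (fun=> 1) f ^+ a = mono (fun=> 1) (iter a f).
Proof.
elim: a => [|a IH]; first by rewrite expr0 mono1.
by rewrite exprSr IH monoM; apply: eq_mono => // s; rewrite mulr1.
Qed.

Lemma scalar_mono a c f : a%:M * mono c f = mono (fun s => a * c s) f.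
Proof.
apply: state_inj => s; rewrite mulmxA mul_mx_scalar -scalemxAl !state_mono scalerA.
by [].
Qed.

End Monomial.

(** * The representation on labelled matchings *)

Section Diagrams.
Context (n' d' : nat).
Let n := n'.+1.
Let d := d'.+1.
Definition pt : finType := (bool * 'I_n)%type.
Let G := 'I_d.

(** A fixed-point-free involution with labels constant along arcs. Points with first component
    [true] form the bottom row. *)
Definition diag_valid (D : {ffun pt -> pt} * {ffun pt -> G}) : bool :=
  [forall x, [&& D.1 (D.1 x) == x, D.1 x != x & D.2 (D.1 x) == D.2 x]].

Definition diag := {D | diag_valid D}.
Implicit Types (D : diag) (p q r x : pt) (g : G).

Definition link D x := (val D).1 x.
Definition label D x := (val D).2 x.

Lemma linkK D : involutive (link D).
Proof. by move=> x; have /forallP/(_ x)/and3P[/eqP] := valP D. Qed.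

Lemma link_neq D x : link D x <> x.
Proof. by have /forallP/(_ x)/and3P[_ /eqP] := valP D. Qed.

Lemma label_link D x : label D (link D x) = label D x.
Proof. by have /forallP/(_ x)/and3P[_ _ /eqP] := valP D. Qed.

Lemma diag_eq D D' : link D =1 link D' -> label D =1 label D' -> D = D'.
Proof.
move=> e1 e2; apply: val_inj; rewrite [LHS]surjective_pairing [RHS]surjective_pairing.
by congr (_, _); apply/ffunP.
Qed.

Lemma id_valid : diag_valid ([ffun x : pt => (~~ x.1, x.2)], [ffun=> 0]).
Proof.
apply/forallP => -[u i]; rewrite !ffunE /= negbK !eqxx /= andbT.
by rewrite xpair_eqE eqxx andbT; case: u.
Qed.

Definition id_diag : diag := Sub ([ffun x : pt => (~~ x.1, x.2)], [ffun=> 0]) id_valid.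

Definition mkdiag (m : pt -> pt) (l : pt -> G) : diag :=
  insubd id_diag ([ffun x => m x], [ffun x => l x]).

Section Mk.
Context (m : pt -> pt) (l : pt -> G).
Hypothesis mK : involutive m.
Hypothesis mn : forall x, m x <> x.
Hypothesis lm : forall x, l (m x) = l x.

Lemma mkdiag_valid : diag_valid ([ffun x => m x], [ffun x => l x]).
Proof. by apply/forallP => x; rewrite !ffunE mK lm !eqxx andbT /=; apply/eqP. Qed.

Lemma link_mk : link (mkdiag m l) = m.
Proof. by apply: funext => x; rewrite /link val_insubd mkdiag_valid ffunE. Qed.

Lemma label_mk : label (mkdiag m l) = l.
Proof. by apply: funext => x; rewrite /label val_insubd mkdiag_valid ffunE. Qed.
End Mk.

(* [Qed] seals the two constructions, so that no conversion test unfolds them. *)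
Lemma dglue_subproof p q D : {D' : diag | p <> q ->
  link D' = glue p q (link D) /\ label D' = glue_label p q (link D) (label D)}.
Proof.
exists (mkdiag (glue p q (link D)) (glue_label p q (link D) (label D))) => pq.
have gK := glueK (@linkK D) (@link_neq D) (@label_link D) pq.
have gn x : glue p q (link D) x <> x.
  exact (glue_neq (@linkK D) (@link_neq D) (@label_link D) pq).
have gl x := glue_label_glue (@linkK D) (@link_neq D) (@label_link D) x pq.
by split; [apply: link_mk | apply: label_mk].
Qed.

Lemma dbead_subproof g p D : {D' : diag |
  link D' = link D /\ label D' = bead g p (link D) (label D)}.
Proof.
exists (mkdiag (link D) (bead g p (link D) (label D))).
have bl x : bead g p (link D) (label D) (link D x) = bead g p (link D) (label D) x.
  exact (bead_inv (@linkK D) (@link_neq D) (@label_link D) _ _ _).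
split; first exact (link_mk (@linkK D) (@link_neq D) bl).
exact (label_mk (@linkK D) (@link_neq D) bl).
Qed.

Definition dglue p q D : diag := sval (dglue_subproof p q D).
Definition dbead g p D : diag := sval (dbead_subproof g p D).

Lemma link_glue p q D : p <> q -> link (dglue p q D) = glue p q (link D).
Proof. by move=> pq; case: (svalP (dglue_subproof p q D) pq). Qed.

Lemma label_glue p q D : p <> q ->
  label (dglue p q D) = glue_label p q (link D) (label D).
Proof. by move=> pq; case: (svalP (dglue_subproof p q D) pq). Qed.

Lemma link_bead g p D : link (dbead g p D) = link D.
Proof. by case: (svalP (dbead_subproof g p D)). Qed.

Lemma label_bead g p D : label (dbead g p D) = bead g p (link D) (label D).
Proof. by case: (svalP (dbead_subproof g p D)). Qed.

Definition bot (i : nat) : pt := (true, inord i).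
Definition top (i : nat) : pt := (false, inord i).

Lemma bot_inj i j : (i < n)%N -> (j < n)%N -> bot i = bot j -> i = j.
Proof. by move=> ? ? [] /(congr1 val); rewrite /= !inordK. Qed.

Lemma bot_neq i j : (i < n)%N -> (j < n)%N -> i != j -> bot i <> bot j.
Proof. by move=> ? ? /eqP ij /bot_inj; auto. Qed.

(** The generator 1 of Z/d, which is 0 when d = 1. *)
Definition bead_unit : G := inZp 1.

Definition act_t i D := dglue (bot i) (bot i.+1) D.
Definition act_z i D := dbead bead_unit (bot i) D.

Lemma act_zX a i D : iter a (act_z i) D = dbead (inZp a) (bot i) D.
Proof.
elim: a => [|a IH].
  apply: diag_eq => x; first by rewrite link_bead.
  rewrite label_bead; have -> : inZp 0 = 0 :> G by apply: val_inj; rewrite /= mod0n.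
  by rewrite bead0.
rewrite iterS IH /act_z; apply: diag_eq => x; first by rewrite !link_bead.
rewrite !label_bead link_bead beadD; congr (bead _ _ _ _ _).
by apply: val_inj; rewrite /= modnDml modnDmr addn1.
Qed.

Context (K : comNzRingType) (lam : G -> K).

Lemma dglueC p q p' q' D :
  p <> q -> p' <> q' -> p <> p' -> p <> q' -> q <> p' -> q <> q' ->
  dglue p' q' (dglue p q D) = dglue p q (dglue p' q' D).
Proof.
move=> pq pq' *; apply: diag_eq => x.
  rewrite !link_glue //.
  by apply (glueC (@linkK D) (@link_neq D) (@label_link D)); assumption.
rewrite !label_glue // !link_glue //.
by apply (glue_labelC (@linkK D) (@link_neq D) (@label_link D)); assumption.
Qed.

Lemma dglue_braid p q s D : p <> q -> q <> s -> p <> s ->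
  dglue p q (dglue q s (dglue p q D)) = dglue p q D.
Proof.
move=> pq qs ps; apply: diag_eq => x.
  rewrite !link_glue //.
  by apply (glue_braid (@linkK D) (@link_neq D) (@label_link D)); assumption.
rewrite !label_glue // !link_glue //.
by apply (glue_label_braid (@linkK D) (@link_neq D) (@label_link D)); assumption.
Qed.

Lemma dglue_sym p q D : p <> q -> dglue p q D = dglue q p D.
Proof.
move=> pq; have qp : q <> p by move/esym.
apply: diag_eq => x.
  rewrite !link_glue //.
  by apply (glue_sym (@linkK D) (@link_neq D) (@label_link D)); assumption.
rewrite !label_glue //.
by apply (glue_label_sym (@linkK D) (@link_neq D) (@label_link D)); assumption.
Qed.

Lemma dbeadC g h p q D : dbead g p (dbead h q D) = dbead h q (dbead g p D).
Proof.
apply: diag_eq => x; first by rewrite !link_bead.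
by rewrite !label_bead !link_bead beadC.
Qed.

Lemma dbead_glue g p q D : p <> q -> dbead g p (dglue p q D) = dbead g q (dglue p q D).
Proof.
move=> pq; apply: diag_eq => x; first by rewrite !link_bead.
rewrite !label_bead link_glue // label_glue //.
by apply (bead_glue (@linkK D) (@link_neq D) (@label_link D)); assumption.
Qed.

Lemma dglue_bead g p q D : p <> q -> dglue p q (dbead g p D) = dglue p q (dbead g q D).
Proof.
move=> pq; apply: diag_eq => x; first by rewrite !link_glue // !link_bead.
rewrite !label_glue // !link_bead !label_bead.
by apply (glue_label_bead (@linkK D) (@link_neq D) (@label_link D)); assumption.
Qed.

Lemma dglue_bead_far g s p q D : p <> q -> s <> p -> s <> q ->
  dglue p q (dbead g s D) = dbead g s (dglue p q D).
Proof.
move=> pq *; apply: diag_eq => x; first by rewrite link_bead !link_glue // link_bead.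
rewrite label_bead !label_glue // !link_glue // link_bead !label_bead.
by apply (glue_label_bead_far (@linkK D) (@link_neq D) (@label_link D)); assumption.
Qed.

Lemma dglue_bead_glue g p q D : p <> q -> dglue p q (dbead g p (dglue p q D)) = dglue p q D.
Proof.
move=> pq; apply: diag_eq => x.
  rewrite link_glue // link_bead !link_glue //.
  by apply (glue_idem (@linkK D) (@link_neq D) (@label_link D)); assumption.
rewrite label_glue // link_bead label_bead !link_glue // !label_glue //.
by apply (glue_label_bead_glue (@linkK D) (@link_neq D) (@label_link D)); assumption.
Qed.

Definition dloop p q D : K := loop lam p q (link D) (label D).

Definition rep_t i : 'M[K]_#|{: diag}| := mono (dloop (bot i) (bot i.+1)) (act_t i).
Definition rep_z i : 'M[K]_#|{: diag}| := mono (fun=> 1) (act_z i).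

Lemma rep_t_far i j : (i.+1 < j)%N -> (j.+1 < n)%N -> rep_t i * rep_t j = rep_t j * rep_t i.
Proof.
move=> ij jn.
have [b1 b2 b3] : [/\ bot i <> bot i.+1, bot j <> bot j.+1 & bot i <> bot j].
  by split; apply: bot_neq; lia.
have [b4 b5 b6] : [/\ bot i <> bot j.+1, bot i.+1 <> bot j & bot i.+1 <> bot j.+1].
  by split; apply: bot_neq; lia.
apply: eq_monoM => D; last by rewrite /act_t dglueC.
rewrite /dloop /act_t !link_glue // !label_glue //.
by apply (loopC _ (@linkK D) (@link_neq D) (@label_link D)); assumption.
Qed.

Lemma rep_braid_up i : (i.+2 < n)%N -> rep_t i * rep_t i.+1 * rep_t i = rep_t i.
Proof.
move=> jn.
have [b1 b2 b3] : [/\ bot i <> bot i.+1, bot i.+1 <> bot i.+2 & bot i <> bot i.+2].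
  by split; apply: bot_neq; lia.
apply: monoM3 => D; last by rewrite /act_t dglue_braid.
rewrite /dloop /act_t !link_glue // !label_glue // !link_glue //.
by apply (loop_braid _ (@linkK D) (@link_neq D) (@label_link D)); assumption.
Qed.

Lemma rep_braid_dn i : (i.+2 < n)%N -> rep_t i.+1 * rep_t i * rep_t i.+1 = rep_t i.+1.
Proof.
move=> jn.
have [b1 b2 b3] : [/\ bot i.+2 <> bot i.+1, bot i.+1 <> bot i & bot i.+2 <> bot i].
  by split; apply: bot_neq; lia.
(* Gluing is symmetric in its two points, so this is the other braid identity read with the three
   points in reverse order. *)
have symE (D : diag) : act_t i.+1 D = dglue (bot i.+2) (bot i.+1) D.
  by rewrite /act_t dglue_sym //; apply: bot_neq; lia.
have symE' (D : diag) : act_t i D = dglue (bot i.+1) (bot i) D.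
  by rewrite /act_t dglue_sym //; apply: bot_neq; lia.
have loopE p q D : dloop p q D = dloop q p D.
  exact (loop_sym _ (@linkK D) (@link_neq D) (@label_link D) p q).
apply: monoM3 => D; last by rewrite !symE symE' dglue_braid.
rewrite !symE symE' ![dloop (bot i.+1) (bot i.+2) _]loopE [dloop (bot i) _ _]loopE.
rewrite /dloop !link_glue // !label_glue // !link_glue //.
by apply (loop_braid _ (@linkK D) (@link_neq D) (@label_link D)); assumption.
Qed.

Lemma rep_zX i a : rep_z i ^+ a = mono (fun=> 1) (dbead (inZp a) (bot i)).
Proof. by rewrite monoX; apply: eq_mono => // D; apply: act_zX. Qed.

Lemma rep_zd i : rep_z i ^+ d = 1.
Proof.
rewrite rep_zX -mono1; apply: eq_mono => // D.
apply: diag_eq => x; first by rewrite link_bead.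
rewrite label_bead; have -> : inZp d = 0 :> G by apply: val_inj; rewrite /= modnn.
by rewrite bead0.
Qed.

Lemma rep_zz i j : rep_z i * rep_z j = rep_z j * rep_z i.
Proof. by apply: eq_monoM => // D; apply: dbeadC. Qed.

Lemma rep_tz i : (i.+1 < n)%N -> rep_t i * rep_z i = rep_t i * rep_z i.+1.
Proof.
move=> ii; apply: eq_monoM => // D.
by apply: dbead_glue; apply: bot_neq; lia.
Qed.

Lemma rep_zt i : (i.+1 < n)%N -> rep_z i * rep_t i = rep_z i.+1 * rep_t i.
Proof.
move=> ii; have b1 : bot i <> bot i.+1 by apply: bot_neq; lia.
apply: eq_monoM => D; last exact: dglue_bead.
rewrite !mul1r /dloop !link_bead !label_bead.
exact (loop_bead _ (@linkK D) (@link_neq D) (@label_link D) _ b1).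
Qed.

Lemma rep_zt_far i j : (i < n)%N -> (j.+1 < n)%N -> i != j -> i != j.+1 ->
  rep_z i * rep_t j = rep_t j * rep_z i.
Proof.
move=> ? ? ? ?; have [b1 b2 b3] : [/\ bot j <> bot j.+1, bot i <> bot j & bot i <> bot j.+1].
  by split; apply: bot_neq; lia.
apply: eq_monoM => D; last exact: dglue_bead_far.
rewrite mul1r mulr1 /dloop !link_bead !label_bead.
exact (loop_bead_far _ (@linkK D) (@link_neq D) (@label_link D) _ b2 b3).
Qed.

Lemma rep_tzt i (k : 'I_d) : (i.+1 < n)%N ->
  rep_t i * rep_z i ^+ k * rep_t i = (lam k)%:M * rep_t i.
Proof.
move=> ii; have b1 : bot i <> bot i.+1 by apply: bot_neq; lia.
rewrite rep_zX [RHS]scalar_mono valZpK; apply: monoM3 => D; last exact: dglue_bead_glue.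
rewrite mulr1 mulrC; congr (_ * _).
rewrite /dloop link_bead label_bead link_glue // label_glue //.
exact (loop_bead_glue _ (@linkK D) (@link_neq D) (@label_link D) _ b1).
Qed.

End Diagrams.

(** * Diagrams of normal forms *)

Section NormalDiagrams.
Context (n' d' : nat).
Let n := n'.+1.
Let d := d'.+1.
Implicit Types (D : diag n' d').
Local Notation bot := (bot n').
Local Notation top := (top n').

Fixpoint act_Td k l D := if l is l'.+1 then act_Td k l' (act_t (k + l') D) else D.

Lemma act_TdS k l D : act_Td k l.+1 D = act_t k (act_Td k.+1 l D).
Proof.
elim: l D => [|l IH] D; first by rewrite /= addn0.
by rewrite [LHS]IH /= addnS addSn.
Qed.

(** The invariant of the first m layers: the strands from m on are untouched. *)
Definition straight m D := forall j, (m <= j < n)%N ->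
  link D (bot j) = top j /\ label D (bot j) = 0.

Lemma act_Td_arc k l m D : (k + l = m)%N -> (m < n)%N -> straight m D ->
  link (act_Td k l D) (bot k) = (if l == 0 then top m else bot k.+1) /\
  label (act_Td k l D) (bot k) = 0.
Proof.
case: l => [|l] klm mn Dm; first by rewrite addn0 in klm; subst k; apply: Dm; lia.
have b1 : bot k <> bot k.+1 by apply: bot_neq; lia.
by rewrite act_TdS link_glue // label_glue // glue_new glue_label_new.
Qed.

Lemma act_Td_straight k l m D : (k + l = m)%N -> (m < n)%N -> straight m D ->
  straight m.+1 (act_Td k l D).
Proof.
elim: l k => [|l IH] k klm mn Dm j jn; first by apply: Dm; lia.
have b1 : bot k <> bot k.+1 by apply: bot_neq; lia.
have [e1 e2] := IH k.+1 ltac:(lia) mn Dm j jn.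
have b2 : bot j <> bot k by apply: bot_neq; lia.
have b3 : bot j <> bot k.+1 by apply: bot_neq; lia.
by rewrite act_TdS link_glue // label_glue // glue_out ?glue_label_out // e1.
Qed.

(* T^m_k shifts the ends i with k <= i of the arcs of a diagram by two strands. *)
Definition moved k m i := if (i < k)%N then bot i else if (i.+1 < m)%N then bot i.+2 else top m.

(** Each t_k moves the end at k to the former partner w of k+1, by [glue_transport]. For k < m the
    last end m-1 finally takes top m, released by the straight strand m. *)
Lemma act_Td_link k l m D i j : (k + l = m)%N -> (m < n)%N -> straight m D ->
  (i < m)%N -> (j < m)%N ->
  link (act_Td k l D) (moved k m i) = moved k m j -> link D (bot i) = bot j.
Proof.
move=> klm mn Dm im jm; elim: l k klm => [|l IH] k klm.
  by rewrite addn0 in klm; subst k; rewrite /moved im jm.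
have b1 : bot k <> bot k.+1 by apply: bot_neq; lia.
have kln : (k.+1 + l = m)%N by lia.
have [e1 e2] := act_Td_arc kln mn Dm.
set w := (if _ then _ else _) in e1.
have movedE u : (u < m)%N -> moved k m u = if moved k.+1 m u == bot k then w else moved k.+1 m u.
  move=> um; rewrite /moved /w; case: (ltngtP u k) => uk.
  - rewrite ltnS (ltnW uk); case: eqP => // e; have := bot_neq _ _ _ e; lia.
  - have -> : (u < k.+1)%N = false by lia.
    case: ifP => um1; case: eqP => // e.
    by have := bot_neq _ _ _ e; lia.
  - subst u; rewrite ltnSn eqxx; case: eqP => l0; case: ifP => //; lia.
have moved_q u : (u < m)%N -> moved k.+1 m u <> bot k.+1.
  by move=> um; rewrite /moved; case: ifP => ?; [|case: ifP => ? //]; apply: bot_neq; lia.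
have moved_w u : (u < m)%N -> moved k.+1 m u <> w.
  move=> um; rewrite /moved /w; case: eqP => l0; case: ifP => ? //; try lia.
    by apply: bot_neq; lia.
  by case: ifP => ? //; apply: bot_neq; lia.
have wp : w <> bot k by rewrite /w; case: eqP => ? //; apply: bot_neq; lia.
rewrite act_TdS link_glue // !movedE // => e; apply: (IH k.+1 kln).
move: e; apply (glue_transport (@linkK _ _ _) (@link_neq _ _ _) (@label_link _ _ _)) => //; auto.
Qed.

Lemma act_Td_inj k l m D1 D2 : (k + l = m)%N -> (m < n)%N ->
  straight m D1 -> straight m D2 -> act_Td k l D1 = act_Td k l D2 -> D1 = D2.
Proof.
move=> klm mn D1m D2m; elim: l k klm => [|l IH] k klm //.
have b1 : bot k <> bot k.+1 by apply: bot_neq; lia.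
have kln : (k.+1 + l = m)%N by lia.
have [e1 e2] := act_Td_arc kln mn D1m.
have [e1' e2'] := act_Td_arc kln mn D2m.
move: e1 e1'; set w := (if _ then _ else _) => e1 e1'.
have wp : w <> bot k by rewrite /w; case: eqP => ? //; apply: bot_neq; lia.
rewrite !act_TdS => e; apply: (IH k.+1 kln).
have el := congr1 (@link _ _) e; have eb := congr1 (@label _ _) e.
rewrite !link_glue // in el; rewrite !label_glue // in eb.
have [] := glue_inj (@linkK _ _ _) (@link_neq _ _ _) (@label_link _ _ _) (@linkK _ _ _)
  (@link_neq _ _ _) (@label_link _ _ _) b1 wp e1 e1' e2 e2' _ _; try by move=> x; rewrite ?el ?eb.
exact: diag_eq.
Qed.

Definition act_layer m (p : nat * nat) D := iter p.2 (act_z p.1) (act_Td p.1 (m - p.1) D).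

Fixpoint act_layers m s D := if s is p :: s' then act_layers m.+1 s' (act_layer m p D) else D.

Definition nfdiag s := act_layers 0 s (id_diag n' d').

Lemma nfdiag_rcons s p : nfdiag (rcons s p) = act_layer (size s) p (nfdiag s).
Proof.
rewrite /nfdiag -[size s]add0n; elim: s (0%N) (id_diag n' d') => [|q s IH] m D /=.
  by rewrite addn0.
by rewrite IH addnS.
Qed.

Lemma link_act_layer m p D : link (act_layer m p D) = link (act_Td p.1 (m - p.1) D).
Proof. by rewrite /act_layer act_zX link_bead. Qed.

Lemma label_act_layer m p D : label (act_layer m p D) =
  bead (inZp p.2) (bot p.1) (link (act_Td p.1 (m - p.1) D)) (label (act_Td p.1 (m - p.1) D)).
Proof. by rewrite /act_layer act_zX label_bead. Qed.

Lemma act_layer_straight k a m D : (k <= m < n)%N -> straight m D ->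
  straight m.+1 (act_layer m (k, a) D).
Proof.
move=> km Dm j jn.
have kmm : (k + (m - k) = m)%N by lia.
have mn : (m < n)%N by lia.
have [e1 e2] := act_Td_straight kmm mn Dm jn.
rewrite link_act_layer label_act_layer /bead /= e1 e2; split=> //.
have -> : (bot j == bot k) = false by apply/eqP/bot_neq; lia.
by [].
Qed.

Lemma act_layer_arc k a m D : (k <= m < n)%N -> straight m D ->
  link (act_layer m (k, a) D) (bot k) = (if k == m then top m else bot k.+1) /\
  label (act_layer m (k, a) D) (bot k) = inZp a.
Proof.
move=> km Dm; have kmm : (k + (m - k) = m)%N by lia.
have mn : (m < n)%N by lia.
have [e1 e2] := act_Td_arc kmm mn Dm.
rewrite link_act_layer label_act_layer /bead /= eqxx e1 e2 add0r; split=> //.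
by have -> : (m - k == 0)%N = (k == m) by lia.
Qed.

Lemma act_layer_inj k a m D1 D2 : (k <= m < n)%N -> straight m D1 -> straight m D2 ->
  act_layer m (k, a) D1 = act_layer m (k, a) D2 -> D1 = D2.
Proof.
move=> km D1m D2m e; have kmm : (k + (m - k) = m)%N by lia.
apply: (act_Td_inj kmm _ D1m D2m); first by lia.
have el := congr1 (@link _ _) e; have eb := congr1 (@label _ _) e.
rewrite !link_act_layer /= in el; rewrite !label_act_layer /= el in eb.
apply: diag_eq => x; first by rewrite el.
by have := congr1 (fun f => f x) eb; rewrite /bead /=; case: ifP => // _ /addIr.
Qed.

Definition capfree b D := forall i, (b <= i)%N -> (i.+1 < n)%N -> link D (bot i) <> bot i.+1.

(** The layer creates the arc k, k+1 and shifts later ends by two, so an arc between neighbours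
    further right would come from an arc between neighbours of [D] at or beyond k. *)
Lemma act_layer_capfree k a m D : (k < m < n)%N -> straight m D -> capfree k D ->
  capfree k.+1 (act_layer m (k, a) D) /\ link (act_layer m (k, a) D) (bot m) <> top m.
Proof.
move=> km Dm Dk; have kmm : (k + (m - k) = m)%N by lia.
have kmn : (k <= m < n)%N by lia.
have mn : (m < n)%N by lia.
have Lm := act_layer_straight a kmn Dm.
have [arc _] := act_layer_arc a kmn Dm.
have {}arc : link (act_layer m (k, a) D) (bot k) = bot k.+1.
  by rewrite arc; have -> : (k == m) = false by lia.
have arc' : link (act_layer m (k, a) D) (bot k.+1) = bot k by rewrite -arc linkK.
have lnk i j (im : (i < m)%N) (jm : (j < m)%N) :=
  act_Td_link kmm mn Dm im jm.
rewrite link_act_layer /= in arc arc' *; split=> [i ki iN|].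
  rewrite link_act_layer /=; case: (ltngtP i k.+1) ki iN => // [ik _ iN|-> _ iN]; last first.
    by rewrite arc'; apply: bot_neq; lia.
  case: (ltnP i m) => im.
    have := lnk i.-2 i.-1 (ltac:(lia) : (i.-2 < m)%N) (ltac:(lia) : (i.-1 < m)%N).
    rewrite /moved; have -> : (i.-2 < k)%N = false by lia.
    have -> : (i.-1 < k)%N = false by lia.
    have -> : (i.-2.+1 < m)%N by lia.
    have -> : (i.-1.+1 < m)%N by lia.
    have -> : i.-2.+2 = i by lia.
    have -> : i.-1.+2 = i.+1 by lia.
    have e : i.-2.+1 = i.-1 by lia.
    by move=> H /H; have := Dk i.-2; rewrite e; apply; lia.
  (* For i >= m the point i+1 is still joined to the top. *)
  move=> e; have [] := Lm i.+1 (ltac:(lia) : (m.+1 <= i.+1 < n)%N).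
  by rewrite link_act_layer /= -e linkK.
case: (ltnP k.+1 m) => k1m; last first.
  have -> : bot m = bot k.+1 by have -> : m = k.+1 by lia.
  by rewrite arc'.
(* Bottom m and top m are the images of the ends m-2 and m-1, neighbours in [D]. *)
have := lnk m.-2 m.-1 (ltac:(lia) : (m.-2 < m)%N) (ltac:(lia) : (m.-1 < m)%N).
rewrite /moved; have -> : (m.-2 < k)%N = false by lia.
have -> : (m.-1 < k)%N = false by lia.
have -> : (m.-2.+1 < m)%N by lia.
have -> : (m.-1.+1 < m)%N = false by lia.
have -> : m.-2.+2 = m by lia.
have e : m.-2.+1 = m.-1 by lia.
by move=> H /H; have := Dk m.-2; rewrite e; apply; lia.
Qed.

Lemma capfree_le b b' D : (b <= b')%N -> capfree b D -> capfree b' D.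
Proof. by move=> bb Db i bi; apply: Db; lia. Qed.

Lemma nfdiagP m b s : (m <= n)%N -> s \in nf d m b ->
  straight m (nfdiag s) /\ capfree b (nfdiag s).
Proof.
elim: m b s => [|m IH] b s mn.
  rewrite inE => /eqP->; split=> [j _|i _ _]; last by rewrite /link ffunE.
  by rewrite /link /label !ffunE.
case/nfS => [[s' [a [-> s'_nf ad]]]|[k [s' [a [-> kb s'_nf ad]]]]];
  have [Dm Db] := IH _ _ (ltnW mn) s'_nf; rewrite nfdiag_rcons (size_nf_word s'_nf).
  split; first by apply: act_layer_straight => //; lia.
  by move=> i bi iN; rewrite link_act_layer /= subnn; apply: Db.
split; first by apply: act_layer_straight => //; lia.
have [cf _] := act_layer_capfree a (ltac:(lia) : (k < m < n)%N) Dm Db.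
by apply: capfree_le cf; lia.
Qed.

Lemma inZp_inj a a' : (a < d)%N -> (a' < d)%N -> inZp a = inZp a' :> 'I_d -> a = a'.
Proof. by move=> ad ad' /(congr1 val); rewrite /= !modn_small. Qed.

(* The last k is read off the diagram of a normal form as the largest i such that
   the bottom points i and i+1 are joined. *)
Lemma nfdiag_inj m s1 s2 : (m <= n)%N -> s1 \in nf d m m -> s2 \in nf d m m ->
  nfdiag s1 = nfdiag s2 -> s1 = s2.
Proof.
elim: m s1 s2 => [|m IH] s1 s2 mn; first by rewrite !inE => /eqP-> /eqP->.
(* With equal k, the label at bottom k gives a, and undoing the layer leaves the shorter words. *)
have step b1 b2 t1 t2 k a1 a2 : (k <= m)%N -> t1 \in nf d m b1 -> t2 \in nf d m b2 ->
    (a1 < d)%N -> (a2 < d)%N ->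
    act_layer m (k, a1) (nfdiag t1) = act_layer m (k, a2) (nfdiag t2) ->
    rcons t1 (k, a1) = rcons t2 (k, a2).
  move=> km t1_nf t2_nf ad1 ad2 e.
  have [D1m _] := nfdiagP (ltnW mn) t1_nf; have [D2m _] := nfdiagP (ltnW mn) t2_nf.
  have kmn : (k <= m < n)%N by lia.
  have ea : a1 = a2.
    apply: inZp_inj => //.
    by rewrite -(act_layer_arc a1 kmn D1m).2 -(act_layer_arc a2 kmn D2m).2 e.
  subst a2; congr rcons; apply: IH; [exact: ltnW | exact: nf_max t1_nf | exact: nf_max t2_nf |].
  exact: act_layer_inj kmn D1m D2m e.
(* A trivial last layer leaves strand m joined to top m; a nontrivial one does not. *)
have mixed b t1 t2 k a1 a2 : (k < m)%N -> t1 \in nf d m b -> t2 \in nf d m k ->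
    act_layer m (m, a1) (nfdiag t1) <> act_layer m (k, a2) (nfdiag t2).
  move=> km t1_nf t2_nf e.
  have [D1m _] := nfdiagP (ltnW mn) t1_nf; have [D2m D2k] := nfdiagP (ltnW mn) t2_nf.
  have [_] := act_layer_capfree a2 (ltac:(lia) : (k < m < n)%N) D2m D2k.
  by rewrite -e (act_layer_arc a1 (ltac:(lia) : (m <= m < n)%N) D1m).1 eqxx.
have le_k t1 t2 k1 k2 a1 a2 : (k1 < m)%N -> (k2 < m)%N -> t1 \in nf d m k1 ->
    t2 \in nf d m k2 ->
    act_layer m (k1, a1) (nfdiag t1) = act_layer m (k2, a2) (nfdiag t2) -> (k2 <= k1)%N.
  move=> km1 km2 t1_nf t2_nf e; rewrite leqNgt; apply/negP => lt.
  have [D1m D1k] := nfdiagP (ltnW mn) t1_nf; have [D2m _] := nfdiagP (ltnW mn) t2_nf.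
  have [cf _] := act_layer_capfree a1 (ltac:(lia) : (k1 < m < n)%N) D1m D1k.
  apply: (cf k2 lt); first by lia.
  rewrite e (act_layer_arc a2 (ltac:(lia) : (k2 <= m < n)%N) D2m).1.
  by have -> : (k2 == m) = false by lia.
case/nfS => [[t1 [a1 [-> t1_nf ad1]]]|[k1 [t1 [a1 [-> kb1 t1_nf ad1]]]]];
case/nfS => [[t2 [a2 [-> t2_nf ad2]]]|[k2 [t2 [a2 [-> kb2 t2_nf ad2]]]]];
  rewrite !nfdiag_rcons (size_nf_word t1_nf) (size_nf_word t2_nf) => e.
- exact: (step _ _ _ _ _ _ _ _ t1_nf t2_nf).
- by case: (mixed _ _ _ k2 _ _ _ t1_nf t2_nf e); lia.
- by case: (mixed _ _ _ k1 _ _ _ t2_nf t1_nf (esym e)); lia.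
- have ek : k1 = k2.
    apply/eqP; rewrite eqn_leq (le_k _ _ _ _ _ _ _ _ t2_nf t1_nf (esym e)); try lia.
    by rewrite (le_k _ _ _ _ _ _ _ _ t1_nf t2_nf e); lia.
  by subst k2; apply: (step _ _ _ _ _ _ _ _ t1_nf t2_nf) => //; lia.
Qed.

End NormalDiagrams.

(** * Dimension *)

(** The function g reads from an element the index of its block, which makes the blocks disjoint. *)
Lemma uniq_flatten_map (I T : eqType) (r : seq I) (f : I -> seq T) (g : T -> I) :
  uniq r -> (forall i, uniq (f i)) -> (forall i x, x \in f i -> g x = i) ->
  uniq (flatten [seq f i | i <- r]).
Proof.
move=> + fu gf; elim: r => //= i r IH /andP[ir ur]; rewrite cat_uniq fu IH // andbT.
apply/hasPn => x /flatten_mapP[j jr /gf gx]; apply: contra ir => /gf.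
by rewrite gx => <-.
Qed.

Lemma nf_uniq d m b : uniq (nf d m b).
Proof.
elim: m b => //= m IH b.
have part c k : uniq [seq rcons s (c, a) | s <- nf d m k, a <- iota 0 d].
  apply: allpairs_uniq; rewrite ?iota_uniq //.
  by move=> [s a] [s' a'] _ _ /= /rcons_inj[-> ->].
have lastE c k s : s \in [seq rcons s (c, a) | s <- nf d m k, a <- iota 0 d] ->
    (last (0, 0) s).1 = c.
  by case/allpairsP => -[s' a] [_ _ ->]; rewrite last_rcons.
rewrite cat_uniq part /=; apply/andP; split; last first.
  apply: (uniq_flatten_map (g := fun s => (last (0, 0) s).1)); first exact: iota_uniq.
    by move=> k; apply: part.
  by move=> k s; apply: lastE.
apply/hasPn => s /flatten_mapP[k + /lastE sk]; rewrite mem_iota => /andP[_ km].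
by apply/negP => /lastE; rewrite sk; lia.
Qed.

(** * From ordinals to natural indices *)

Section NatIndex.
Context (B : pzRingType) (n d : nat) (ht : 'I_n.-1 -> B) (hz : 'I_n -> B).
Context (lam : 'I_d -> B).
Hypothesis tl : tl_axioms ht.
Hypothesis fr : framing_axioms d ht hz.
Hypothesis lo : loop_axioms ht hz lam.

(** The spanning argument indexes generators by naturals to compute with their indices; the value 0
    out of range is excluded by the bounds in its hypotheses. *)
Definition nat_t i : B := if insub i is Some j then ht j else 0.
Definition nat_z i : B := if insub i is Some j then hz j else 0.

Lemma nat_tE i (ij : (i < n.-1)%N) : nat_t i = ht (Ordinal ij).
Proof. by rewrite /nat_t insubT. Qed.

Lemma nat_zE i (ij : (i < n)%N) : nat_z i = hz (Ordinal ij).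
Proof. by rewrite /nat_z insubT. Qed.

Lemma nat_t_ord (i : 'I_n.-1) : nat_t i = ht i.
Proof. by rewrite /nat_t valK. Qed.

Lemma nat_z_ord (i : 'I_n) : nat_z i = hz i.
Proof. by rewrite /nat_z valK. Qed.

Lemma nat_z_lo (j : 'I_n.-1) : nat_z j = hz (lo_strand j).
Proof. by rewrite -nat_z_ord. Qed.

Lemma nat_z_hi (j : 'I_n.-1) : nat_z j.+1 = hz (hi_strand j).
Proof. by rewrite -nat_z_ord. Qed.

Lemma lt_pred i : (i.+1 < n)%N -> (i < n.-1)%N. Proof. lia. Qed.

Lemma nat_tt i j : (i.+1 < j)%N -> (j.+1 < n)%N -> nat_t i * nat_t j = nat_t j * nat_t i.
Proof.
move=> ij jn; have i1 : (i < n.-1)%N by lia.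
rewrite (nat_tE i1) (nat_tE (lt_pred jn)); apply: tl.1 => /=; lia.
Qed.

Lemma nat_ttt_up i : (i.+2 < n)%N -> nat_t i * nat_t i.+1 * nat_t i = nat_t i.
Proof.
move=> jn; have i1 : (i < n.-1)%N by lia.
rewrite (nat_tE i1) (nat_tE (lt_pred jn)); apply: tl.2 => /=; lia.
Qed.

Lemma nat_ttt_dn i : (i.+2 < n)%N -> nat_t i.+1 * nat_t i * nat_t i.+1 = nat_t i.+1.
Proof.
move=> jn; have i1 : (i < n.-1)%N by lia.
rewrite (nat_tE i1) (nat_tE (lt_pred jn)); apply: tl.2 => /=; lia.
Qed.

Lemma nat_zd i : (i < n)%N -> nat_z i ^+ d = 1.
Proof. by move=> ii; rewrite (nat_zE ii); case: fr. Qed.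

Lemma nat_zz i j : (i < n)%N -> (j < n)%N -> nat_z i * nat_z j = nat_z j * nat_z i.
Proof. by move=> ii jj; rewrite (nat_zE ii) (nat_zE jj); case: fr. Qed.

Lemma nat_tz i : (i.+1 < n)%N -> nat_t i * nat_z i = nat_t i * nat_z i.+1.
Proof.
move=> ii; have := nat_z_lo (Ordinal (lt_pred ii)); have := nat_z_hi (Ordinal (lt_pred ii)).
by rewrite /= (nat_tE (lt_pred ii)) => -> ->; case: fr.
Qed.

Lemma nat_zt i : (i.+1 < n)%N -> nat_z i * nat_t i = nat_z i.+1 * nat_t i.
Proof.
move=> ii; have := nat_z_lo (Ordinal (lt_pred ii)); have := nat_z_hi (Ordinal (lt_pred ii)).
by rewrite /= (nat_tE (lt_pred ii)) => -> ->; case: fr.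
Qed.

Lemma nat_zt_far i j : (i < n)%N -> (j.+1 < n)%N -> i != j -> i != j.+1 ->
  nat_z i * nat_t j = nat_t j * nat_z i.
Proof.
move=> ii jj ij ij'; rewrite (nat_zE ii) (nat_tE (lt_pred jj)).
by case: fr => _ _ _ _; apply.
Qed.

Lemma nat_tzt i (k : 'I_d) : (i.+1 < n)%N ->
  nat_t i * nat_z i ^+ k * nat_t i = lam k * nat_t i.
Proof.
move=> ii; have := nat_z_lo (Ordinal (lt_pred ii)).
by rewrite /= (nat_tE (lt_pred ii)) => ->; apply: lo.
Qed.

End NatIndex.

Section FramedSpan.
Context (K : comNzRingType) (B : pzRingType) (sc : {rmorphism K -> B}).
Hypothesis scC : forall c u, sc c * u = u * sc c.
Context (n d : nat) (ht : 'I_n.-1 -> B) (hz : 'I_n -> B) (lam : 'I_d -> K).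
Hypothesis d_gt0 : (0 < d)%N.
Hypothesis tl : tl_axioms ht.
Hypothesis fr : framing_axioms d ht hz.
Hypothesis lo : loop_axioms ht hz (sc \o lam).

Lemma framed_span : let S := nf_span sc d (nat_t ht) (nat_z hz) n in
  [/\ S 1, forall i u, S u -> S (u * ht i) & forall i u, S u -> S (u * hz i)].
Proof.
pose lamn j := if insub j is Some k then lam k else 0.
have tzt i k : (i.+1 < n)%N -> (k < d)%N ->
    nat_t ht i * nat_z hz i ^+ k * nat_t ht i = sc (lamn k) * nat_t ht i.
  by move=> ii kd; have := nat_tzt lo (Ordinal kd) ii; rewrite /lamn insubT.
have [st sz] := nf_span_gens scC (nat_tt tl) (nat_ttt_up tl) (nat_ttt_dn tl) (nat_zd fr)
  (nat_zz fr) (nat_tz fr) (nat_zt fr) (nat_zt_far fr) tzt d_gt0 (leqnn n).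
split=> [|i u Su|i u Su]; first exact: nf_span_one.
  by rewrite -(nat_t_ord ht); apply: st Su; apply: (ltn_ord (hi_strand i)).
by rewrite -(nat_z_ord hz); apply: sz.
Qed.

End FramedSpan.

Section Rep.
Context (K : comNzRingType) (n' d' : nat) (lam : 'I_d'.+1 -> K).
Let n := n'.+1.
Let d := d'.+1.
Local Notation M := 'M[K]_#|{: diag n' d'}|.
Let rt (i : 'I_n.-1) : M := rep_t n' lam i.
Let rz (i : 'I_n) : M := rep_z n' d' K i.

Lemma rep_tl : tl_axioms rt.
Proof.
split=> i j; have := ltn_ord i; have := ltn_ord j; rewrite /rt /=.
  move: (i : nat) (j : nat) => {}i {}j jn im ij.
  case: (ltngtP i j) => [lt|gt|e]; last by lia.
    by apply: rep_t_far; lia.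
  by apply/esym/rep_t_far; lia.
move: (i : nat) (j : nat) => {}i {}j jn im ij.
case: (ltngtP i j) => [lt|gt|e]; last by lia.
  have -> : j = i.+1 by lia.
  by apply: rep_braid_up; lia.
have -> : i = j.+1 by lia.
by apply: rep_braid_dn; lia.
Qed.

Lemma rep_framing : framing_axioms d rt rz.
Proof.
split=> [i|i j|i|i|i j ne1 ne2].
- exact: rep_zd.
- exact: rep_zz.
- exact: rep_tz (ltn_ord (hi_strand i)).
- exact: rep_zt (ltn_ord (hi_strand i)).
- by apply: rep_zt_far; rewrite ?ltn_ord //; apply: (ltn_ord (hi_strand j)).
Qed.

Lemma rep_loop : loop_axioms rt rz (fun j => (lam j)%:M).
Proof. by move=> i k; apply: rep_tzt (ltn_ord (hi_strand i)). Qed.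

Section Image.
Context (B : pzRingType) (f : {rmorphism B -> M}) (ht : 'I_n.-1 -> B) (hz : 'I_n -> B).
Hypothesis ft : forall i, f (ht i) = rt i.
Hypothesis fz : forall i, f (hz i) = rz i.
Local Notation t := (nat_t ht).
Local Notation z := (nat_z hz).

(** No loop closes: when t_k acts, bottom k+1 is joined to bottom k+2 or to top m, hence not to
    bottom k, and the scalar is 1. *)
Lemma state_Td k l m D : (k + l = m)%N -> (m < n)%N -> straight m D ->
  state K D *m f (Td t k l) = state K (act_Td k l D).
Proof.
move=> + mn Dm; elim: l k => [|l IH] k klm; first by rewrite rmorph1 mulmx1.
have kln : (k.+1 + l = m)%N by lia.
have kn : (k < n.-1)%N by rewrite /=; lia.
rewrite act_TdS TdS rmorphM mulmxA (IH _ kln) (nat_tE _ kn) ft /rt state_mono /=.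
rewrite /dloop loop1 ?scale1r //.
have [e _] := act_Td_arc kln mn Dm.
move=> /(congr1 (link (act_Td k.+1 l D))); rewrite linkK e.
by case: eqP => l0 //; apply: bot_neq; lia.
Qed.

Lemma state_z a k D : (k < n)%N -> state K D *m f (z k ^+ a) = state K (iter a (act_z k) D).
Proof.
move=> kn; elim: a => [|a IH]; first by rewrite expr0 rmorph1 mulmx1.
by rewrite exprSr rmorphM /= mulmxA IH (nat_zE _ kn) fz /rz state_mono scale1r.
Qed.

Lemma state_nfval m s : (m <= n)%N -> s \in nf d m m ->
  state K (id_diag n' d') *m f (nfval t z s) = state K (nfdiag n' d' s).
Proof.
elim: m s => [|m IH] s mn.
  by rewrite inE => /eqP->; rewrite /nfval big_geq // rmorph1 mulmx1.
have layerE s' k a : (k <= m)%N -> s' \in nf d m m ->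
    state K (id_diag n' d') *m f (nfval t z (rcons s' (k, a))) =
    state K (nfdiag n' d' (rcons s' (k, a))).
  move=> km s'_nf; have [Dm _] := nfdiagP (ltnW mn) s'_nf.
  rewrite nfval_rcons nfdiag_rcons (size_nf_word s'_nf) /layer /=.
  rewrite !rmorphM mulmxA IH // ?(ltnW mn) // mulmxA.
  have kmm : (k + (m - k) = m)%N by lia.
  by rewrite (state_Td kmm mn Dm) state_z //; lia.
case/nfS => [[s' [a [-> s'_nf ad]]]|[k [s' [a [-> kb s'_nf ad]]]]];
  by apply: layerE; [lia | apply: nf_max s'_nf].
Qed.

End Image.
End Rep.

Section Dimension.
Context (K : comNzRingType) (n' d' : nat).
Let n := n'.+1.
Let d := d'.+1.
Context (R : seq (arel K (framed_gen n))) (lam : 'I_d -> K).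
Local Notation M := 'M[K]_#|{: diag n' d'}|.
Let ht : 'I_n.-1 -> palg R := pgen R \o @gen_t n.
Let hz : 'I_n -> palg R := pgen R \o @gen_z n.

Section Span.
Hypothesis tl : tl_axioms ht.
Hypothesis fr : framing_axioms d ht hz.
Hypothesis lo : loop_axioms ht hz (@palg_const _ _ R \o lam).

Lemma palg_span (u : palg R) : nf_span (@palg_const _ _ R) d (nat_t ht) (nat_z hz) n u.
Proof.
have [S1 St Sz] := framed_span (@palg_constC _ _ R) (isT : 0 < d)%N tl fr lo.
elim/palg_ind: u => [|u v Su Sv|c w]; first exact: lin_span0.
  exact: lin_spanD.
rewrite -palg_constM; apply: lin_span_scale.
elim/last_ind: w => [|w x IH]; first by rewrite pword_nil.
rewrite -cats1 pword_cat; case: x => i; [exact: St | exact: Sz].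
Qed.

End Span.

Section Rep.
Hypothesis sound : forall (B : pzRingType) (phi : {rmorphism K -> B}) (h : framed_gen n -> B),
  tl_axioms (h \o @gen_t n) -> framing_axioms d (h \o @gen_t n) (h \o @gen_z n) ->
  loop_axioms (h \o @gen_t n) (h \o @gen_z n) (phi \o lam) ->
  forall r, r \in R -> freeval phi h r.1 = freeval phi h r.2.

Lemma palg_rep : exists f : {rmorphism palg R -> M},
  [/\ forall c u, f (c *: u) = c *: f u,
      forall i, f (ht i) = rep_t n' lam i & forall i, f (hz i) = rep_z n' d' K i].
Proof.
pose h (x : framed_gen n) : M :=
  match x with inl i => rep_t n' lam i | inr i => rep_z n' d' K i end.
pose phi : {rmorphism K -> M} := scalar_mx.
have phiC c y : phi c * y = y * phi c by exact: (comm_scalar_mx c y).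
have relM : forall r, r \in R -> freeval phi h r.1 = freeval phi h r.2.
  by apply: sound; [apply: rep_tl | apply: rep_framing | apply: rep_loop].
have [f [fZ fg _]] := palg_universal phiC relM.
exists f; split=> [c u|i|i]; [|exact: (fg (inl i)) | exact: (fg (inr i))].
by rewrite fZ -mul_scalar_mx.
Qed.

End Rep.

Section Coordinates.
Let N := (Catalan n * d ^ n)%N.
Let w (i : 'I_N) := nth [::] (nf d n n) i.

Lemma size_nfN : size (nf d n n) = N. Proof. exact: size_nf_Catalan. Qed.

Lemma w_nf i : w i \in nf d n n.
Proof. by apply: mem_nth; rewrite size_nfN. Qed.

Lemma w_inj : injective w.
Proof.
move=> i j /eqP; rewrite nth_uniq ?size_nfN ?nf_uniq //.
by move/eqP/val_inj.
Qed.

Let e (i : 'I_N) : palg R := nfval (nat_t ht) (nat_z hz) (w i).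
Hypothesis span_e : forall u, nf_span (@palg_const _ _ R) d (nat_t ht) (nat_z hz) n u.
Context (f : {rmorphism palg R -> M}).
Hypothesis fZ : forall c u, f (c *: u) = c *: f u.
Hypothesis ft : forall i, f (ht i) = rep_t n' lam i.
Hypothesis fz : forall i, f (hz i) = rep_z n' d' K i.

(** Entries in the row of the identity diagram. The i-th normal form sends that diagram to its own
    one with coefficient 1, so these are the dual coordinates. *)
Definition coords (u : palg R) : 'rV[K]_N :=
  \row_i f u (enum_rank (id_diag n' d')) (enum_rank (nfdiag n' d' (w i))).

Lemma coords_linear : linear coords.
Proof.
move=> c u v; apply/rowP => i; rewrite !mxE.
by rewrite (rmorphD f) (fZ c u) !mxE.
Qed.

Definition comb (v : 'rV[K]_N) : palg R := \sum_i v 0 i *: e i.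

Lemma coords_e i : coords (e i) = delta_mx 0 i.
Proof.
apply/rowP => j; rewrite !mxE eqxx /=.
have := state_nfval ft fz (leqnn n) (w_nf i).
move/(congr1 (fun v : 'rV_(_) => v 0 (enum_rank (nfdiag n' d' (w j))))).
rewrite -rowE !mxE eqxx /= => ->.
rewrite (inj_eq enum_rank_inj); congr (_ %:R); congr nat_of_bool.
apply/eqP/eqP => [eq_d|->//]; apply: w_inj.
exact: (nfdiag_inj (leqnn n) (w_nf j) (w_nf i) (esym (esym eq_d))).
Qed.

HB.instance Definition _ := GRing.isLinear.Build K (palg R) 'rV[K]_N _ coords coords_linear.

Lemma combK : cancel comb coords.
Proof.
move=> v; rewrite /comb linear_sum [RHS]row_sum_delta; apply: eq_bigr => i _.
by rewrite linearZ /= coords_e.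
Qed.

Lemma comb_surj u : exists v, comb v = u.
Proof.
elim: (span_e u) => [|u1 u2 _ [v1 <-] _ [v2 <-]|c _ [s s_nf ->]].
- by exists 0; rewrite /comb big1 // => i _; rewrite mxE scale0r.
- exists (v1 + v2); rewrite /comb -big_split; apply: eq_bigr => i _.
  by rewrite mxE scalerDl.
- have si : (index s (nf d n n) < N)%N by rewrite -size_nfN index_mem.
  exists (c *: delta_mx 0 (Ordinal si)); rewrite /comb (bigD1 (Ordinal si)) //= big1.
    by rewrite addr0 !mxE !eqxx mulr1 palg_constM /e /w /= nth_index.
  by move=> i ne; rewrite !mxE (negbTE ne) andbF mulr0 scale0r.
Qed.

Lemma coords_bij : bijective coords.
Proof.
exists comb; last exact: combK.
(* [comb] is onto and has [coords] as a left inverse, so the two are mutually inverse. *)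
by move=> u; have [v <-] := comb_surj u; rewrite combK.
Qed.

Lemma palg_basis : exists g : {linear palg R -> 'rV[K]_(Catalan n * d ^ n)}, bijective g.
Proof. by exists (coords : {linear _ -> _}); apply: coords_bij. Qed.

End Coordinates.
End Dimension.

(** The parameters are carried by an arbitrary morphism [s] to a commutative ring; the embedding
    into the fraction field is the instance that gives the dimension. *)
Lemma framed_TL_dim (k0 K : comNzRingType) (n d : nat) (n_gt0 : (0 < n)%N) (d_gt0 : (0 < d)%N)
    (s : {rmorphism {mpoly k0[npar d]} -> K}) :
  exists g : {linear palg (specialize s (framed_TL_rels n d k0)) ->
                'rV[K]_(Catalan n * d ^ n)}, bijective g.
Proof.
case: n n_gt0 => // n' _; case: d d_gt0 s => // d' _ s.
have span := palg_span (palg_tl_axioms n'.+1 s) (palg_framing_axioms n'.+1 s)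
  (palg_loop_axioms s).
have [f [fZ ft fz]] := palg_rep (framed_TL_rels_hold (n := n'.+1) (s := s)).
exact (palg_basis span fZ ft fz).
Qed.

Theorem theorem5p1 (R : realType) (n d : nat) (hn : (1 <= n)%N) (hd : (1 <= d)%N) :
  [/\ is_framization (fun _ : 'I_1 => ord0 : 'I_(npar d))
        (jones_rels n) (framed_jones_rels n d)
        (TL_rels n R[i]) (framed_TL_rels n d R[i]),
      specializes_to_monoid_algebra (framed_TL_rels n d R[i])
        (framed_jones_rels n d) &
      exists f : {linear framed_TL_frac R[i] n d ->
                    'rV[{fraction {mpoly R[i][npar d]}}]_(Catalan n * d ^ n)},
        bijective f].
Proof.
split.
- exact (framed_TL_framization R[i] n hd).
- exact (deforms_specializes (@framed_TL_deforms R[i] n d hd)).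
- exact (framed_TL_dim hn hd (@FracField.tofrac {mpoly R[i][npar d]})).
Qed.
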